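(* In the additive growth curve model $Y_n=\sum_{i=1}^kX_i\Theta_iZ_i'+\mathcal E$ with orthogonal design matrices (as specified in the context), suppose that for each $l=1,\dots,k$ $$\lim_{n\to\infty}n^{-1}X_l'X_l=R_l,$$ where $R_l$ is positive definite. Then, for any $i\in\{1,\dots,k\}$, with $$\widehat\Theta_i(Y_n)=(X_i'X_i)^{-1}X_i'\,Y_n\,H_i(Y_n)\,Z_i(Z_i'Z_i)^{-1},$$ the statistic $\sqrt n\,[\widehat\Theta_i(Y_n)-\Theta_i]$ converges in distribution, as $n\to\infty$, to $$\mathcal N_{m_i\times q_i}\bigl(\mathbf 0,\;R_i^{-1}\otimes(Z_i'\Sigma^{-1}Z_i)^{-1}\bigr).$$
   Context: Model. For each sample size $n$, $Y_n$ is an $n\times p$ random matrix of observations with $Y_n=\sum_{i=1}^kX_i\Theta_iZ_i'+\mathcal E$. For $1\le i\le k$, $X_i$ (depending on $n$) is a known $n\times m_i$ design matrix ($n>m_i$) of full rank $m_i$, $Z_i$ is a known $p\times q_i$ profile matrix ($p>q_i$) of full rank $q_i$, and $\Theta_i$ is an unknown $m_i\times q_i$ matrix of regression coefficients; $k,p,m_i,q_i,Z_i,\Theta_i$ do not depend on $n$. The $n\times p$ error matrix $\mathcal E$ (depending on $n$) has a general continuous type distribution; its rows are independent and identically distributed with mean zero and common unknown positive definite $p\times p$ covariance matrix $\Sigma$. The design matrices satisfy $\operatorname{rank}(X_i)+p\le n$ for all $i$ and $X_i'X_j=\mathbf 0$ for all distinct $i,j$. As $n$ grows, new rows are added to the matrices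 $X_i$ (and to $Y_n,\mathcal E$), earlier rows remaining intact. Notation. $A'$ is the transpose, $P_A=A(A'A)^-A'$ the orthogonal projection onto the column space of $A$, $\otimes$ the Kronecker product. $\operatorname{vec}$ stacks the rows of a matrix one underneath another into a column vector. $\mathcal N_{a\times b}(\mathbf 0,A\otimes B)$ is the distribution of a random $a\times b$ matrix $T$ such that $\operatorname{vec}(T)$ is multivariate normal with mean $\mathbf 0$ and covariance $A\otimes B$. Quadratic estimator. $\widehat\Sigma(Y_n)=Y_n'WY_n$, $W=\frac1r\bigl(I-\sum_{i=1}^kP_{X_i}\bigr)$, $r=n-\sum_{i=1}^k\operatorname{rank}(X_i)$. The paper takes $\widehat\Sigma(Y_n)$ to be positive definite with probability one, so its inverse $\widehat\Sigma^{-1}(Y_n)$ exists with probability one. $H_i(Y_n)=\widehat\Sigma^{-1}(Y_n)Z_i\bigl(Z_i'\widehat\Sigma^{-1}(Y_n)Z_i\bigr)^{-1}Z_i'$. *)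

(* Defs.v *)
From HB Require Import structures.
From mathcomp Require Import all_boot all_order all_algebra.
From mathcomp Require Import all_classical all_reals all_analysis.
From mathcomp Require Export mxtens.
Set Implicit Arguments.
Unset Strict Implicit.
Unset Printing Implicit Defensive.
Import Order.TTheory GRing.Theory Num.Theory.
Import numFieldNormedType.Exports.

Local Open Scope classical_set_scope.
Local Open Scope ring_scope.

Section Matrices.
Context {R : realType}.

Definition posdefmx (n : nat) (A : 'M[R]_n) : Prop :=
  A^T = A /\ forall v : 'cV[R]_n, v != 0 -> 0 < (v^T *m A *m v) 0 0.

(* P_A = A (A'A)^- A'; [pinvmx B] is a generalized inverse of [B]
   ([B *m pinvmx B *m B = B]), and P_A does not depend on the choice of the
   generalized inverse. *)
Definition projmx (n m : nat) (A : 'M[R]_(n, m)) : 'M[R]_n :=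
  A *m pinvmx (A^T *m A) *m A^T.

(* [mxvec] lists the entries row by row, as a row vector. *)
Definition vec (m n : nat) (A : 'M[R]_(m, n)) : 'cV[R]_(m * n) := (mxvec A)^T.

(* The numbering of the entries of [vec] agrees with the block numbering of the
   Kronecker product [*t]: see [vecE] and [tensmxE]. *)
Lemma index_allpairs (T1 T2 : eqType) (s : seq T1) (t : seq T2) x y :
  x \in s -> y \in t ->
  index (x, y) [seq (a, b) | a <- s, b <- t] = (index x s * size t + index y t)%N.
Proof.
move=> + yt; elim: s => // a s IH; rewrite inE /= index_cat.
have inj : injective (pair a : T2 -> T1 * T2) by move=> u v [].
have [->|nax] := eqVneq a x.
  by move=> _; rewrite map_f// index_map ?mul0n// => u v [].
move=> /= xs.
rewrite ifN; last by apply/negP => /mapP[b _ [/eqP]]; rewrite eq_sym (negbTE nax).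
by rewrite size_map IH// mulSn addnA.
Qed.

Lemma mxvec_index_tens (m n : nat) (i : 'I_m) (j : 'I_n) :
  mxvec_index i j = mxtens_index (i, j).
Proof.
apply: val_inj => /=; rewrite /enum_rank enum_rank_in.unlock insubdK; last first.
  by rewrite cardE [_ \in _]index_mem mem_enum.
rewrite enumT unlock /= /prod_enum index_allpairs ?mem_enum//.
by rewrite !index_enum_ord size_enum_ord.
Qed.

Lemma vecE (m n : nat) (A : 'M[R]_(m, n)) (i : 'I_m) (j : 'I_n) :
  vec A (mxtens_index (i, j)) 0 = A i j.
Proof. by rewrite /vec mxE -mxvec_index_tens mxvecE. Qed.

Definition rowsmx (m : nat) (x : nat -> 'rV[R]_m) (n : nat) : 'M[R]_(n, m) :=
  \matrix_(a < n) x a.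

Definition borel_mx (m n : nat) : set (set 'M[R]_(m, n)) :=
  <<s [set U : set 'M[R]_(m, n) | open U] >>.

Definition lebesgue_null (m n : nat) (A : set 'M[R]_(m, n)) : Prop :=
  forall eps : R, 0 < eps ->
  exists a b : nat -> 'M[R]_(m, n),
    [/\ forall s i j, a s i j <= b s i j,
        A `<=` \bigcup_s [set M | forall i j, a s i j <= M i j <= b s i j] &
        (\sum_(0 <= s <oo) (\prod_i \prod_j (b s i j - a s i j))%:E
           <= eps%:E)%E].

End Matrices.

Section RandomMatrices.
Context {R : realType} {d : measure_display} {Omega : measurableType d}.
Variable P : probability Omega R.

Definition random_mx (m n : nat) (T : Omega -> 'M[R]_(m, n)) : Prop :=
  forall i j, measurable_fun [set: Omega] (fun w => T w i j).

(* "Continuous type": absolutely continuous with respect to Lebesgue measure. *)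
Definition continuous_type (m n : nat) (T : Omega -> 'M[R]_(m, n)) : Prop :=
  forall A, borel_mx A -> lebesgue_null A -> P (T @^-1` A) = 0%E.

(* Independence of every finite subfamily follows from that of the initial
   segments, since some of the [A a] may be the whole space. *)
Definition independent_rows (p : nat) (X : nat -> Omega -> 'rV[R]_p) : Prop :=
  forall (n : nat) (A : nat -> set 'rV[R]_p), (forall a, borel_mx (A a)) ->
  P (\bigcap_(a < n) (X a @^-1` A a)) = (\prod_(a < n) P (X a @^-1` A a))%E.

Definition identically_distributed_rows (p : nat)
    (X : nat -> Omega -> 'rV[R]_p) : Prop :=
  forall (a b : nat) (A : set 'rV[R]_p), borel_mx A ->
  P (X a @^-1` A) = P (X b @^-1` A).

(* The univariate normal law with mean [mu] and variance [v]; the second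
   argument of [normal_prob] is the standard deviation, and [normal_prob mu 0]
   is not the point mass. *)
Definition normal_law (mu v : R) : set R -> \bar R :=
  if v == 0 then \d_mu else normal_prob mu (Num.sqrt v).

Definition normal_vector (n : nat) (X : Omega -> 'cV[R]_n)
    (mu : 'cV[R]_n) (V : 'M[R]_n) : Prop :=
  random_mx X /\
  forall (c : 'cV[R]_n) (B : set R), measurable B ->
    P [set w | B ((c^T *m X w) 0 0)] =
    normal_law ((c^T *m mu) 0 0) ((c^T *m V *m c) 0 0) B.

Definition matrix_normal (m n : nat) (T : Omega -> 'M[R]_(m, n))
    (M : 'M[R]_(m, n)) (V : 'M[R]_(m * n)) : Prop :=
  normal_vector (fun w => vec (T w)) (vec M) V.

End RandomMatrices.

Definition cvg_in_distribution {R : realType}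
    {d : measure_display} {Omega : measurableType d} (P : probability Omega R)
    {d' : measure_display} {Omega' : measurableType d'}
    (P' : probability Omega' R) (m n : nat)
    (T_ : nat -> Omega -> 'M[R]_(m, n)) (T : Omega' -> 'M[R]_(m, n)) : Prop :=
  [/\ forall s, random_mx (T_ s), random_mx T &
      forall f : 'M[R]_(m, n) -> R,
        continuous f -> (exists C, forall M, `|f M| <= C) ->
        'E_P[fun w => f (T_ s w)]%E @[s --> \oo] --> 'E_P'[fun w => f (T w)]%E].

Section GrowthCurve.
Context {R : realType} {k p : nat} {m q : 'I_k -> nat}.
(* [X l] is the design matrix X_l for one sample size [n]. *)
Context {n : nat}.
Variables (X : forall l : 'I_k, 'M[R]_(n, m l)) (Z : forall l, 'M[R]_(p, q l)).

Definition observation (Theta : forall l, 'M[R]_(m l, q l)) (E : 'M[R]_(n, p))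
    : 'M[R]_(n, p) :=
  \sum_(l < k) X l *m Theta l *m (Z l)^T + E.

Definition weightmx : 'M[R]_n :=
  (n%:R - \sum_(l < k) (\rank (X l))%:R)^-1 *:
  (1%:M - \sum_(l < k) projmx (X l)).

Definition Sigma_hat (Y : 'M[R]_(n, p)) : 'M[R]_p := Y^T *m weightmx *m Y.

Definition Hmx (i : 'I_k) (Y : 'M[R]_(n, p)) : 'M[R]_p :=
  invmx (Sigma_hat Y) *m Z i *m
  invmx ((Z i)^T *m invmx (Sigma_hat Y) *m Z i) *m (Z i)^T.

Definition Theta_hat (i : 'I_k) (Y : 'M[R]_(n, p)) : 'M[R]_(m i, q i) :=
  invmx ((X i)^T *m X i) *m (X i)^T *m Y *m Hmx i Y *m Z i *m
  invmx ((Z i)^T *m Z i).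

End GrowthCurve.

(* Main.v *)
Require Import Defs.
From HB Require Import structures.
From mathcomp Require Import all_boot all_order all_algebra.
From mathcomp Require Import all_classical all_reals all_analysis.
From mathcomp Require Import measurable_realfun ring lra.
Set Implicit Arguments.
Unset Strict Implicit.
Unset Printing Implicit Defensive.
Import Order.TTheory GRing.Theory Num.Theory.
Import numFieldNormedType.Exports HBSimple HBNNSimple.

Local Open Scope classical_set_scope.
Local Open Scope ring_scope.

(** The estimator is a smooth function of two statistics, and the theorem is
a central limit theorem for the first one combined with a law of large numbers
for the second one.

Since the design matrices are mutually orthogonal, the residual projector
annihilates every [X_l], so [Sigma_hat] depends on the errors [E] only and, for
[S_n = n^(-1/2) X_i' E],
  [sqrt n (Theta_hat - Theta_i) = (n^-1 X_i'X_i)^-1 S_n (gls Z_i Sigma_hat)],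
where [gls Z S = S^-1 Z (Z' S^-1 Z)^-1] ([Theta_hat_error]).  The law of large
numbers applied to the products of error entries gives [Sigma_hat -> Sigma] in
probability ([Sigma_hat_consistent]); [gls Z_i] is continuous at [Sigma], and
[S_n] is bounded in probability, so that the estimation error differs from
[R_i^-1 S_n (gls Z_i Sigma)] by a term that vanishes in probability
([estimator_linearization]).

Every linear form of this linearization is a sum [n^(-1/2) sum_a <y_a, e_a>] of
independent centred variables.  Convergence of [n^-1 sum_a y_a' y_a] forces
[max_a |y_a|^2 / n -> 0], which is Lindeberg's condition
([design_negligible]), so the sum is asymptotically normal
([weighted_sum_clt]).  The limiting variance is a trace which, because
[(gls Z Sigma)' Sigma (gls Z Sigma) = (Z' Sigma^-1 Z)^-1] ([gls_var]), equals
the quadratic form of [R_i^-1 (x) (Z' Sigma^-1 Z)^-1] ([linearization_clt]).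

Three general tools carry the passage to convergence in distribution.
- Lindeberg's theorem ([lindeberg_clt]) is stated for the expectations of
  cosines and sines.  Independence enters only through the addition formulas:
  the trigonometric moments of a sum satisfy a linear recursion, and so does
  [normal_char], the trigonometric moment of the normal law; the two recursions
  are compared summand by summand with second order expansions.
- Trigonometric moments determine weak limits ([weak_cvg_of_char]): by
  tightness it is enough to control a test function on a cube, where a
  trigonometric polynomial approximates it ([trig_poly_approx]); a Bernstein
  operator in the variables [sin (x_j / 2K)] produces one that respects the
  global bound of the test function.
- The limiting Gaussian matrix is a linear image of independent standard
  normal variables ([gaussian_vector]), obtained from Cholesky factors of the
  two Kronecker factors ([tens_sqrt]). *)

(** * Expectations of real random variables *)

Definition integr {d : measure_display} {T : measurableType d} {R : realType}
    (P : probability T R) (X : T -> R) : Prop :=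
  P.-integrable [set: T] (EFin \o X).

(** The expectation as a real number; it agrees with ['E_P] on integrable
  variables ([expectation_Ex]). *)
Definition Ex {d : measure_display} {T : measurableType d} {R : realType}
    (P : probability T R) (X : T -> R) : R := \int[P]_w X w.

Section expectation.
Context {d : measure_display} {T : measurableType d} {R : realType}.
Variable P : probability T R.
Implicit Types X Y : T -> R.

Lemma integr_measurable X : integr P X -> measurable_fun [set: T] X.
Proof. by move=> /measurable_int /measurable_EFinP. Qed.

Lemma EFin_Ex X : integr P X -> (\int[P]_w (X w)%:E)%E = (Ex P X)%:E.
Proof. by move=> iX; rewrite /Ex /Rintegral fineK// integrable_fin_num. Qed.

Lemma expectation_Ex X : integr P X -> 'E_P[X]%E = (Ex P X)%:E.
Proof. by move=> iX; rewrite unlock EFin_Ex. Qed.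

Lemma integr_le X Y : measurable_fun [set: T] X -> integr P Y ->
  (forall w, `|X w| <= `|Y w|) -> integr P X.
Proof.
move=> mX iY XY; apply: (le_integrable measurableT _ _ iY).
  exact/measurable_EFinP.
by move=> w _ /=; rewrite lee_fin.
Qed.

Lemma integr_cst c : integr P (fun=> c).
Proof. exact: finite_measure_integrable_cst. Qed.

Lemma integr_bounded X (C : R) : measurable_fun [set: T] X ->
  (forall w, `|X w| <= C) -> integr P X.
Proof.
move=> mX XC; apply: (integr_le mX (integr_cst C)) => w.
by rewrite (le_trans (XC w))// ler_norm.
Qed.

Lemma integrD X Y : integr P X -> integr P Y -> integr P (fun w => X w + Y w).
Proof. by move=> iX iY; exact: (integrableD measurableT iX iY). Qed.

Lemma integrB X Y : integr P X -> integr P Y -> integr P (fun w => X w - Y w).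
Proof. by move=> iX iY; exact: (integrableB measurableT iX iY). Qed.

Lemma integrZ c X : integr P X -> integr P (fun w => c * X w).
Proof. by move=> iX; exact: (integrableZl measurableT c iX). Qed.

Lemma integr_abs X : integr P X -> integr P (fun w => `|X w|).
Proof.
move=> iX; apply: (integr_le _ iX) => [|w]; last by rewrite normr_id.
exact/measurableT_comp/integr_measurable.
Qed.

Lemma integr_of_sqr X : measurable_fun [set: T] X -> integr P (fun w => X w ^+ 2) -> integr P X.
Proof.
move=> mX iX2; apply: (integr_le mX (integrD (integr_cst 1) iX2)) => w.
rewrite [leRHS]ger0_norm ?addr_ge0 ?sqr_ge0//.
by rewrite ler_norml; apply/andP; split; nra.
Qed.

Lemma integr_sum (I : Type) (s : seq I) (F : I -> T -> R) :
  (forall i, integr P (F i)) -> integr P (fun w => \sum_(i <- s) F i w).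
Proof.
move=> iF; elim: s => [|i s IH].
  by under eq_fun do rewrite big_nil; exact: integr_cst.
by under eq_fun do rewrite big_cons; exact: integrD.
Qed.

Lemma measurable_cos X : measurable_fun [set: T] X -> measurable_fun [set: T] (fun w => cos (X w)).
Proof.
by apply: measurableT_comp; apply: continuous_measurable_fun; exact: continuous_cos.
Qed.

Lemma measurable_sin X : measurable_fun [set: T] X -> measurable_fun [set: T] (fun w => sin (X w)).
Proof.
by apply: measurableT_comp; apply: continuous_measurable_fun; exact: continuous_sin.
Qed.

Lemma integr_cos X : measurable_fun [set: T] X -> integr P (fun w => cos (X w)).
Proof. by move=> /measurable_cos mX; apply: (integr_bounded mX) => w; exact: cos_max. Qed.

Lemma integr_sin X : measurable_fun [set: T] X -> integr P (fun w => sin (X w)).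
Proof. by move=> /measurable_sin mX; apply: (integr_bounded mX) => w; exact: sin_max. Qed.

Lemma ExD X Y : integr P X -> integr P Y ->
  Ex P (fun w => X w + Y w) = Ex P X + Ex P Y.
Proof. by move=> iX iY; exact: RintegralD. Qed.

Lemma ExB X Y : integr P X -> integr P Y ->
  Ex P (fun w => X w - Y w) = Ex P X - Ex P Y.
Proof. by move=> iX iY; exact: RintegralB. Qed.

Lemma ExZ c X : integr P X -> Ex P (fun w => c * X w) = c * Ex P X.
Proof. by move=> iX; exact: RintegralZl. Qed.

Lemma Ex_cst c : Ex P (fun=> c) = c.
Proof. by rewrite /Ex Rintegral_cst// (congr1 fine (probability_setT P)) mulr1. Qed.

Lemma Ex_sum (I : Type) (s : seq I) (F : I -> T -> R) :
  (forall i, integr P (F i)) ->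
  Ex P (fun w => \sum_(i <- s) F i w) = \sum_(i <- s) Ex P (F i).
Proof.
move=> iF; elim: s => [|i s IH].
  by under eq_fun do rewrite big_nil; rewrite Ex_cst big_nil.
under eq_fun do rewrite big_cons.
by rewrite ExD ?IH ?big_cons//; exact: integr_sum.
Qed.

Lemma le_Ex X Y : integr P X -> integr P Y -> (forall w, X w <= Y w) ->
  Ex P X <= Ex P Y.
Proof. by move=> iX iY XY; apply: le_Rintegral. Qed.

Lemma Ex_ge0 X : (forall w, 0 <= X w) -> 0 <= Ex P X.
Proof. by move=> X0; exact: Rintegral_ge0. Qed.

Lemma norm_Ex X : integr P X -> `|Ex P X| <= Ex P (fun w => `|X w|).
Proof. by move=> iX; exact: le_normr_Rintegral. Qed.

Lemma norm_Ex_le X Y : integr P X -> integr P Y ->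
  (forall w, `|X w| <= Y w) -> `|Ex P X| <= Ex P Y.
Proof.
move=> iX iY XY; apply: (le_trans (norm_Ex iX)).
by apply: le_Ex => //; exact: integr_abs.
Qed.

Lemma norm_Ex_bounded X C : measurable_fun [set: T] X ->
  (forall w, `|X w| <= C) -> `|Ex P X| <= C.
Proof.
move=> mX XC; rewrite -[leRHS](Ex_cst C); apply: norm_Ex_le => //.
  exact: (integr_bounded mX XC).
exact: integr_cst.
Qed.

Lemma Ex_dominated (f : nat -> T -> R) (g h : T -> R) :
  (forall n, measurable_fun [set: T] (f n)) ->
  (forall w, f n w @[n --> \oo] --> g w) ->
  integr P h -> (forall n w, `|f n w| <= h w) ->
  Ex P (f n) @[n --> \oo] --> Ex P g.
Proof.
move=> mf fg ih fh.
have mg : measurable_fun [set: T] g.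
  by apply: (measurable_fun_cvg (h := f)) => // w _; exact: fg.
have h0 w : 0 <= h w by exact: le_trans (normr_ge0 _) (fh 0%N w).
have gh w : `|g w| <= h w.
  have fgw : `|f n w| @[n --> \oo] --> `|g w| by apply: cvg_norm; exact: fg.
  rewrite -(cvg_lim _ fgw)//; apply: limr_le; first exact: cvgP fgw.
  by near=> n; exact: fh.
have ig : integr P g.
  by apply: (integr_le mg ih) => w; rewrite (ger0_norm (h0 w)).
have if_ n : integr P (f n).
  by apply: (integr_le (mf n) ih) => w; rewrite (ger0_norm (h0 w)).
apply: fine_cvg; rewrite -/(Ex P g) -EFin_Ex//.
apply: (dominated_cvg measurableT _ _ _ ih) => //=.
- by move=> n; exact/measurable_EFinP.
- by move=> w _; apply: cvg_EFin; [near=> n|exact: fg].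
- by move=> n w _; rewrite lee_fin.
Unshelve. all: by end_near. Qed.

Lemma probability_indic (A : set T) : measurable A ->
  integr P (\1_A) /\ P A = (Ex P (\1_A))%:E.
Proof.
move=> mA; have iA : integr P (\1_A).
  apply: (@integr_bounded _ 1) => [|w]; first exact: measurable_indic.
  by rewrite indicE; case: (w \in A); rewrite ?normr1 ?normr0.
by split=> //; rewrite -EFin_Ex// integral_indic// setIT.
Qed.

(** Markov's inequality in the form of a small exceptional event, which is how
  probabilities of deviations are handled below. *)
Lemma markov_event X (eps : R) : 0 < eps -> integr P X -> (forall w, 0 <= X w) ->
  exists A : set T, [/\ measurable A, (P A <= (Ex P X / eps)%:E)%E &
    forall w, ~ A w -> X w <= eps].
Proof.
move=> e0 iX X0; have mX := integr_measurable iX.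
pose A := [set w | eps <= X w].
have mA : measurable A.
  have -> : A = [set: T] `&` [set w | eps <= X w] by rewrite setTI.
  exact: measurable_fun_le.
exists A; split => //; last by move=> w /= /negP; rewrite -ltNge => /ltW.
have [iA PA] := probability_indic mA.
rewrite PA lee_fin ler_pdivlMr// mulrC -ExZ//.
apply: le_Ex => // [|w]; first exact: integrZ.
rewrite indicE; have [/set_mem|] := boolP (w \in A); first by rewrite mulr1.
by rewrite mulr0.
Qed.

End expectation.

(** * Independence of the past and the next variable *)

Section independence.
Context {d : measure_display} {T : measurableType d} {R : realType}.
Variable P : probability T R.
Context {d' : measure_display} {T' : measurableType d'}.
Variable X : nat -> T -> T'.
Hypothesis mX : forall a, measurable_fun [set: T] (X a).
Hypothesis indX : forall (n : nat) (A : nat -> set T'),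
  (forall a, measurable (A a)) ->
  P (\bigcap_(a < n) (X a @^-1` A a)) = (\prod_(a < n) P (X a @^-1` A a))%E.

(** [F] behaves as if it were independent of [X n, X n.+1, ...].
  Multiplicativity against indicators is what the induction on [n] carries
  along, in place of the sigma-algebra generated by the past. *)
Definition from_past (n : nat) (F : T -> R) : Prop :=
  integr P F /\ forall N (A : nat -> set T'), (forall a, measurable (A a)) ->
  Ex P (fun w => F w * \prod_(a < N) \1_(A a) (X (n + a)%N w)) =
  Ex P F * \prod_(a < N) Ex P (fun w => \1_(A a) (X (n + a)%N w)).

Lemma indic_norm_le1 (U : Type) (A : set U) (x : U) : `|\1_A x : R| <= 1.
Proof. by rewrite indicE; case: (x \in A); rewrite ?normr1 ?normr0. Qed.

Lemma prod_norm_le1 (I : Type) (s : seq I) (f : I -> R) :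
  (forall i, `|f i| <= 1) -> `|\prod_(i <- s) f i| <= 1.
Proof.
move=> f1; elim: s => [|i s IH]; first by rewrite big_nil normr1.
by rewrite big_cons normrM mulr_ile1.
Qed.

Lemma measurable_indic_comp n (A : set T') : measurable A ->
  measurable_fun [set: T] (fun w => \1_A (X n w) : R).
Proof. by move=> mA; apply: measurableT_comp => //; exact: measurable_indic. Qed.

Lemma measurable_prod_indic n N (A : nat -> set T') :
  (forall a, measurable (A a)) ->
  measurable_fun [set: T] (fun w => \prod_(a < N) \1_(A a) (X (n + a)%N w) : R).
Proof. by move=> mA; apply: measurable_prod => a _; exact: measurable_indic_comp. Qed.

Lemma prod_indic_norm_le1 n N (A : nat -> set T') w :
  `|\prod_(a < N) \1_(A a) (X (n + a)%N w) : R| <= 1.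
Proof. by apply: prod_norm_le1 => a; exact: indic_norm_le1. Qed.

Lemma integr_mul_bounded (F G : T -> R) (C : R) : integr P F ->
  measurable_fun [set: T] G -> (forall w, `|G w| <= C) ->
  integr P (fun w => F w * G w).
Proof.
move=> iF mG GC; apply: (integr_le _ (integrZ C iF)) => [|w].
  by apply: measurable_funM => //; exact: integr_measurable iF.
by rewrite !normrM mulrC ler_wpM2r// (le_trans (GC w))// ler_norm.
Qed.

Lemma Ex_indic_comp n (A : set T') : measurable A ->
  P (X n @^-1` A) = (Ex P (fun w => \1_A (X n w)))%:E.
Proof.
move=> mA; have mXA : measurable (X n @^-1` A).
  by rewrite -[X in measurable X]setTI; exact: mX.
rewrite -EFin_Ex; last first.
  by apply: integr_bounded (measurable_indic_comp n mA) _ => w; exact: indic_norm_le1.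
have := integral_indic P measurableT mXA; rewrite setIT => <-.
by apply: eq_integral => w _.
Qed.

Lemma from_past0 : from_past 0 (fun=> 1).
Proof.
split=> [|N A mA]; first exact: integr_cst.
rewrite Ex_cst mul1r; under eq_fun do rewrite mul1r.
have mB : measurable (\bigcap_(a < N) (X a @^-1` A a)).
  rewrite bigcap_mkord; apply: bigsetI_measurable => a _.
  by rewrite -[X in measurable X]setTI; exact: mX.
have := indX N mA.
under [in RHS]eq_bigr do rewrite Ex_indic_comp//.
rewrite prodEFin => /(congr1 fine)/= <-.
have := integral_indic P measurableT mB; rewrite setIT => <-.
congr fine; apply: eq_integral => w _; congr (_%:E).
rewrite indicE; have [/set_mem Bw|] := boolP (w \in _).
  by rewrite big1// => a _; rewrite indicE mem_set//; exact: (Bw a (ltn_ord a)).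
move=> /negP Bw; apply/eqP/negPn/negP => pi0; apply: Bw.
apply/mem_set => a /= aN; apply: contrapT => Aa.
move/negP: pi0; apply.
by rewrite (bigD1 (Ordinal aN))//= indicE memNset// mul0r.
Qed.

Lemma from_past_measurable n F : from_past n F -> measurable_fun [set: T] F.
Proof. by move=> [iF _]; exact: integr_measurable iF. Qed.

Lemma from_pastZ n F c : from_past n F -> from_past n (fun w => c * F w).
Proof.
move=> [iF hF]; split=> [|N A mA]; first exact: integrZ.
under eq_fun do rewrite -mulrA.
rewrite ExZ; last exact: (integr_mul_bounded iF (measurable_prod_indic n N mA)
  (prod_indic_norm_le1 n N A)).
by rewrite hF// ExZ// mulrA.
Qed.

Lemma from_pastD n F G : from_past n F -> from_past n G ->
  from_past n (fun w => F w + G w).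
Proof.
move=> [iF hF] [iG hG]; split=> [|N A mA]; first exact: integrD.
under eq_fun do rewrite mulrDl.
have mN := measurable_prod_indic n N mA.
have le1 := prod_indic_norm_le1 n N A.
have iF1 := integr_mul_bounded iF mN le1.
have iG1 := integr_mul_bounded iG mN le1.
rewrite (ExD iF1 iG1).
by rewrite hF// hG// ExD// mulrDl.
Qed.

(** Multiplicativity against [g (X n)] that leaves the later variables free, so
  that it can be established class by class of functions [g]: indicators,
  simple functions, nonnegative and then integrable functions. *)
Definition step n F (g : T' -> R) := forall N (A : nat -> set T'),
  (forall a, measurable (A a)) ->
  Ex P (fun w => F w * g (X n w) * \prod_(a < N) \1_(A a) (X (n.+1 + a)%N w)) =
  Ex P F * Ex P (fun w => g (X n w)) *
  \prod_(a < N) Ex P (fun w => \1_(A a) (X (n.+1 + a)%N w)).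

(** An indicator of [X n] is absorbed as the first factor of the product over
  the later variables. *)
Lemma step_indic n F (B : set T') : from_past n F -> measurable B ->
  step n F \1_B.
Proof.
move=> [iF hF] mB N A mA.
pose A' a := if a is a'.+1 then A a' else B.
have mA' a : measurable (A' a) by case: a.
have := hF N.+1 A' mA'; rewrite big_ord_recl /= addn0.
under [in X in _ -> X]eq_fun do rewrite -mulrA.
under [in X in X -> _]eq_fun do rewrite big_ord_recl /= addn0.
rewrite -mulrA.
under [in X in X -> _]eq_fun do under eq_bigr do rewrite addnS -addSn.
by under [in X in _ = X -> _]eq_bigr do rewrite addnS -addSn.
Qed.

(** Both sides pass to the limit by dominated convergence. *)
Lemma step_approx n F (g : nat -> T' -> R) (h : T' -> R) :
  from_past n F -> (forall k, step n F (g k)) ->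
  (forall k, measurable_fun [set: T'] (g k)) ->
  (forall x, g k x @[k --> \oo] --> h x) ->
  (forall k x, `|g k x| <= `|h x|) ->
  integr P (fun w => h (X n w)) -> integr P (fun w => F w * h (X n w)) ->
  step n F h.
Proof.
move=> [iF hF] gstep mg gh leg ih iFh N A mA.
have mF := integr_measurable iF.
have mN := measurable_prod_indic n.+1 N mA.
have le1 := prod_indic_norm_le1 n.+1 N A.
have mgX k : measurable_fun [set: T] (fun w => g k (X n w)).
  exact: measurableT_comp.
have lhs : Ex P (fun w => F w * g k (X n w) *
    \prod_(a < N) \1_(A a) (X (n.+1 + a)%N w)) @[k --> \oo] -->
  Ex P (fun w => F w * h (X n w) *
    \prod_(a < N) \1_(A a) (X (n.+1 + a)%N w)).
  apply: (Ex_dominated (h := fun w => `|F w * h (X n w)|)).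
  - by move=> k; apply: measurable_funM => //; exact: measurable_funM.
  - by move=> w; apply: cvgMl; apply: cvgMr; exact: gh.
  - exact: integr_abs.
  - move=> k w; rewrite !normrM -[leRHS]mulr1 ler_pM//.
    by rewrite ler_wpM2l.
have rhs : Ex P F * Ex P (fun w => g k (X n w)) *
    \prod_(a < N) Ex P (fun w => \1_(A a) (X (n.+1 + a)%N w)) @[k --> \oo] -->
  Ex P F * Ex P (fun w => h (X n w)) *
    \prod_(a < N) Ex P (fun w => \1_(A a) (X (n.+1 + a)%N w)).
  apply: cvgMl; apply: cvgMr.
  apply: (Ex_dominated (h := fun w => `|h (X n w)|)) => //.
  exact: integr_abs.
apply: (cvg_unique _ lhs) => //.
by move: rhs; under eq_fun do rewrite -(gstep _ N A mA).
Qed.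

Lemma step_sum n F (I : Type) (s : seq I) (c : I -> R) (B : I -> set T') :
  from_past n F -> (forall i, measurable (B i)) ->
  step n F (fun x => \sum_(i <- s) c i * \1_(B i) x).
Proof.
move=> pF mB N A mA; have [iF _] := pF.
have mN := measurable_prod_indic n.+1 N mA.
have le1 := prod_indic_norm_le1 n.+1 N A.
have mBX i := measurable_indic_comp n (mB i).
have iB i : integr P (fun w => \1_(B i) (X n w)).
  by apply: integr_bounded (mBX i) _ => w; exact: indic_norm_le1.
have iFB i : integr P (fun w => F w * \1_(B i) (X n w) *
    \prod_(a < N) \1_(A a) (X (n.+1 + a)%N w)).
  apply: (integr_mul_bounded (C := 1)) => //.
  by apply: (integr_mul_bounded (C := 1)) => // w; exact: indic_norm_le1.
transitivity (\sum_(i <- s) c i * Ex P (fun w => F w * \1_(B i) (X n w) *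
    \prod_(a < N) \1_(A a) (X (n.+1 + a)%N w))).
  under [RHS]eq_bigr do rewrite -ExZ//.
  rewrite -Ex_sum; last by move=> i; exact: integrZ.
  congr (Ex P _); apply/funext => w; rewrite mulr_sumr mulr_suml.
  by apply: eq_bigr => i _; rewrite mulrCA !mulrA.
under eq_bigr do rewrite step_indic//.
rewrite Ex_sum; last by move=> i; exact: integrZ.
rewrite mulr_sumr mulr_suml; apply: eq_bigr => i _.
by rewrite ExZ// !mulrA [c i * _]mulrC.
Qed.

(** Monotone approximation by simple functions. *)
Lemma step_ge0 n F (g : T' -> R) : from_past n F ->
  measurable_fun [set: T'] g -> (forall x, 0 <= g x) ->
  integr P (fun w => g (X n w)) -> integr P (fun w => F w * g (X n w)) ->
  step n F g.
Proof.
move=> pF mg g0 ig iFg.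
have mEg : measurable_fun [set: T'] (EFin \o g) by exact/measurable_EFinP.
have g0' x : [set: T'] x -> (0 <= (EFin \o g) x)%E by rewrite /= lee_fin.
pose h k := nnsfun_approx measurableT mEg k.
pose h' k : T' -> R := h k.
apply: (@step_approx n F h' g pF) => // [k|x|k x]; rewrite /h'.
- have -> : (h k : T' -> R) = fun x =>
      \sum_(y <- finmap.enum_fset (fset_set (range (h k)))) y * \1_(h k @^-1` [set y]) x.
    by apply/funext => x; rewrite {1}fimfunE fsbig_finite.
  by apply: step_sum => // y; exact: measurable_sfunP.
- have /fine_cvg := cvg_nnsfun_approx measurableT mEg g0' (I : [set: T'] x).
  exact.
- rewrite !ger0_norm// -lee_fin /h nnsfun_approxE.
  exact: (le_approx k g0' (I : [set: T'] x)).
Qed.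

Lemma step_integr n F (g : T' -> R) : from_past n F ->
  measurable_fun [set: T'] g ->
  integr P (fun w => g (X n w)) -> integr P (fun w => F w * g (X n w)) ->
  step n F g.
Proof.
move=> pF mg ig iFg N A mA.
have mF := from_past_measurable pF.
pose gp x := Num.max (g x) 0; pose gn x : R := Num.max (- g x) 0.
have gE x : g x = gp x - gn x.
  by rewrite /gp /gn; case: (leP (g x) 0) => ?; case: (leP (- g x) 0) => ?; lra.
have gp_le x : `|gp x| <= `|g x|.
  by rewrite /gp; case: (leP (g x) 0); rewrite ?normr0.
have gn_le x : `|gn x| <= `|g x|.
  by rewrite /gn; case: (leP (- g x) 0); rewrite ?normr0 ?normrN.
have mgp : measurable_fun [set: T'] gp by exact: measurable_maxr.
have mgn : measurable_fun [set: T'] gn.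
  by apply: measurable_maxr => //; exact: measurableT_comp.
have part (u : T' -> R) : measurable_fun [set: T'] u ->
    (forall x, `|u x| <= `|g x|) ->
    integr P (fun w => u (X n w)) /\ integr P (fun w => F w * u (X n w)).
  move=> mu ug; have muX : measurable_fun [set: T] (fun w => u (X n w)).
    exact: measurableT_comp.
  split; first exact: integr_le ig _.
  apply: (integr_le _ iFg) => [|w]; first exact: measurable_funM.
  by rewrite !normrM ler_wpM2l.
have [igp iFgp] := part gp mgp gp_le.
have [ign iFgn] := part gn mgn gn_le.
have gp0 x : 0 <= gp x by rewrite le_max lexx orbT.
have gn0 x : 0 <= gn x by rewrite le_max lexx orbT.
have sp := step_ge0 pF mgp gp0 igp iFgp N mA.
have sn := step_ge0 pF mgn gn0 ign iFgn N mA.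
have mN := measurable_prod_indic n.+1 N mA.
have le1 := prod_indic_norm_le1 n.+1 N A.
under eq_fun do rewrite gE mulrBr mulrBl.
rewrite (ExB (integr_mul_bounded iFgp mN le1) (integr_mul_bounded iFgn mN le1)).
under [in RHS]eq_fun do rewrite gE.
by rewrite ExB// sp sn mulrBr mulrBl.
Qed.

(** The step of all inductions over independent variables: a function of the
  next variable factors out of the expectation, and the product belongs to the
  past of the following variable. *)
Lemma from_pastM n F (g : T' -> R) : from_past n F ->
  measurable_fun [set: T'] g ->
  integr P (fun w => g (X n w)) -> integr P (fun w => F w * g (X n w)) ->
  Ex P (fun w => F w * g (X n w)) = Ex P F * Ex P (fun w => g (X n w)) /\
  from_past n.+1 (fun w => F w * g (X n w)).
Proof.
move=> pF mg ig iFg; have st := step_integr pF mg ig iFg.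
have E : Ex P (fun w => F w * g (X n w)) = Ex P F * Ex P (fun w => g (X n w)).
  have := st 0 (fun=> setT) (fun=> measurableT); rewrite big_ord0 mulr1 => <-.
  by under [in RHS]eq_fun do rewrite big_ord0 mulr1.
by split=> //; split=> // N A mA; rewrite st// E.
Qed.

Lemma from_pastS n F : from_past n F -> from_past n.+1 F.
Proof.
move=> pF; have [iF _] := pF.
have iF1 : integr P (fun w => F w * cst 1 (X n w)).
  by under eq_fun do rewrite mulr1.
have [_] := from_pastM (g := cst 1) pF (measurable_cst _) (integr_cst P 1) iF1.
by under eq_fun do rewrite mulr1.
Qed.

End independence.

(** * Trigonometric moments and variance of independent sums *)

Section independent_sums.
Context {d : measure_display} {T : measurableType d} {R : realType}.
Variable P : probability T R.
Context {d' : measure_display} {T' : measurableType d'}.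
Variable X : nat -> T -> T'.
Hypothesis mX : forall a, measurable_fun [set: T] (X a).
Hypothesis indX : forall (n : nat) (A : nat -> set T'),
  (forall a, measurable (A a)) ->
  P (\bigcap_(a < n) (X a @^-1` A a)) = (\prod_(a < n) P (X a @^-1` A a))%E.
Variable u : nat -> T' -> R.
Hypothesis mu : forall a, measurable_fun [set: T'] (u a).

Let U n w := \sum_(a < n) u a (X a w).

Let muX a : measurable_fun [set: T] (fun w => u a (X a w)).
Proof. exact: measurableT_comp. Qed.

Let integr_trig (f g : T -> R) : measurable_fun [set: T] f ->
  measurable_fun [set: T] g -> (forall w, `|f w| <= 1) -> (forall w, `|g w| <= 1) ->
  integr P (fun w => f w * g w).
Proof.
move=> mf mg f1 g1; apply: (@integr_bounded _ _ _ _ _ 1).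
  exact: measurable_funM.
by move=> w; rewrite normrM mulr_ile1.
Qed.

Lemma trig_sum_step n (F : T -> R) : from_past P X n F -> (forall w, `|F w| <= 1) ->
  [/\ integr P (fun w => F w * cos (u n (X n w))),
      integr P (fun w => F w * sin (u n (X n w))),
      Ex P (fun w => F w * cos (u n (X n w))) =
        Ex P F * Ex P (fun w => cos (u n (X n w))),
      Ex P (fun w => F w * sin (u n (X n w))) =
        Ex P F * Ex P (fun w => sin (u n (X n w))) &
      from_past P X n.+1 (fun w => F w * cos (u n (X n w))) /\
      from_past P X n.+1 (fun w => F w * sin (u n (X n w)))].
Proof.
move=> pF F1; have mF := from_past_measurable pF.
have ic : integr P (fun w => cos (u n (X n w))).
  exact: integr_cos.
have is_ : integr P (fun w => sin (u n (X n w))).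
  exact: integr_sin.
have iFc : integr P (fun w => F w * cos (u n (X n w))).
  by apply: integr_trig => //; [exact: measurable_cos|move=> w; exact: cos_max].
have iFs : integr P (fun w => F w * sin (u n (X n w))).
  by apply: integr_trig => //; [exact: measurable_sin|move=> w; exact: sin_max].
have [Ec pc] := from_pastM mX pF (measurable_cos (mu n)) ic iFc.
have [Es ps] := from_pastM mX pF (measurable_sin (mu n)) is_ iFs.
by split.
Qed.

(** By the addition formulas, cosine and sine of a partial sum are combinations
  of products of a function of the past and a function of the next variable. *)
Lemma trig_sum_past n : from_past P X n (fun w => cos (U n w)) /\
  from_past P X n (fun w => sin (U n w)).
Proof.
elim: n => [|n [pc ps]].
  split.
    have -> : (fun w => cos (U 0 w)) = fun=> 1.
      by apply/funext => w; rewrite /U big_ord0 cos0.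
    exact: from_past0.
  have -> : (fun w => sin (U 0 w)) = fun=> 0 * 1.
    by apply/funext => w; rewrite /U big_ord0 sin0 mul0r.
  by apply: from_pastZ => //; exact: from_past0.
have [_ _ _ _ [pcc pcs]] := trig_sum_step pc (fun w => cos_max _).
have [_ _ _ _ [psc pss]] := trig_sum_step ps (fun w => sin_max _).
split.
  have -> : (fun w => cos (U n.+1 w)) = fun w => cos (U n w) * cos (u n (X n w)) +
      -1 * (sin (U n w) * sin (u n (X n w))).
    by apply/funext => w; rewrite /U big_ord_recr /= cosD mulN1r.
  by apply: from_pastD => //; exact: from_pastZ.
have -> : (fun w => sin (U n.+1 w)) = fun w => sin (U n w) * cos (u n (X n w)) +
    cos (U n w) * sin (u n (X n w)).
  by apply/funext => w; rewrite /U big_ord_recr /= sinD.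
exact: from_pastD.
Qed.

Lemma Ex_cos_sumS n : Ex P (fun w => cos (U n.+1 w)) =
  Ex P (fun w => cos (U n w)) * Ex P (fun w => cos (u n (X n w))) -
  Ex P (fun w => sin (U n w)) * Ex P (fun w => sin (u n (X n w))).
Proof.
have [pc ps] := trig_sum_past n.
have [_ _ Ecc _ _] := trig_sum_step pc (fun w => cos_max _).
have [_ _ _ Ess _] := trig_sum_step ps (fun w => sin_max _).
have [icc _ _ _ _] := trig_sum_step pc (fun w => cos_max _).
have [_ iss _ _ _] := trig_sum_step ps (fun w => sin_max _).
rewrite -Ecc -Ess -ExB//; congr (Ex P _); apply/funext => w.
by rewrite /U big_ord_recr /= cosD.
Qed.

Lemma Ex_sin_sumS n : Ex P (fun w => sin (U n.+1 w)) =
  Ex P (fun w => sin (U n w)) * Ex P (fun w => cos (u n (X n w))) +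
  Ex P (fun w => cos (U n w)) * Ex P (fun w => sin (u n (X n w))).
Proof.
have [pc ps] := trig_sum_past n.
have [_ ics _ Ecs _] := trig_sum_step pc (fun w => cos_max _).
have [isc _ Esc _ _] := trig_sum_step ps (fun w => sin_max _).
rewrite -Ecs -Esc -ExD//; congr (Ex P _); apply/funext => w.
by rewrite /U big_ord_recr /= sinD.
Qed.

Let mU n : measurable_fun [set: T] (U n).
Proof. exact: measurable_sum. Qed.

Let Ecos_le1 (f : T -> R) : measurable_fun [set: T] f -> `|Ex P (fun w => cos (f w))| <= 1.
Proof.
by move=> mf; apply: norm_Ex_bounded (measurable_cos mf) _ => w; exact: cos_max.
Qed.

Let Esin_le1 (f : T -> R) : measurable_fun [set: T] f -> `|Ex P (fun w => sin (f w))| <= 1.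
Proof.
by move=> mf; apply: norm_Ex_bounded (measurable_sin mf) _ => w; exact: sin_max.
Qed.

Lemma Ex_sin_sum_le n : `|Ex P (fun w => sin (U n w))| <=
  \sum_(a < n) `|Ex P (fun w => sin (u a (X a w)))|.
Proof.
elim: n => [|n IH].
  rewrite big_ord0 (_ : (fun _ => _) = fun=> 0) ?Ex_cst ?normr0//.
  by apply/funext => w; rewrite /U big_ord0 sin0.
rewrite Ex_sin_sumS big_ord_recr /= (le_trans (ler_normD _ _))// lerD//.
  by rewrite normrM (le_trans _ IH)// ler_piMr// Ecos_le1.
by rewrite normrM ler_piMl// Ecos_le1.
Qed.

(** With [Ex_sin_sum_le], the telescoping comparison of a product of
  trigonometric moments with a product of real numbers [b a] of modulus at most
  1; the sine terms are errors because the law compared with is symmetric. *)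
Lemma Ex_cos_sum_le n (b : nat -> R) : (forall a, `|b a| <= 1) ->
  `|Ex P (fun w => cos (U n w)) - \prod_(a < n) b a| <=
  \sum_(a < n) (`|Ex P (fun w => cos (u a (X a w))) - b a| +
    `|Ex P (fun w => sin (u a (X a w)))|).
Proof.
move=> b1; elim: n => [|n IH].
  rewrite !big_ord0 (_ : (fun _ => _) = fun=> 1) ?Ex_cst ?subrr ?normr0//.
  by apply/funext => w; rewrite /U big_ord0 cos0.
rewrite Ex_cos_sumS !big_ord_recr /=.
set C := Ex P (fun w => cos (U n w)); set S := Ex P (fun w => sin (U n w)).
set c := Ex P _; set s := Ex P (fun w => sin (u n (X n w))).
set B := \prod_(a < n) _ in IH *.
have -> : C * c - S * s - B * b n = (C - B) * b n + (C * (c - b n) - S * s) by ring.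
rewrite (le_trans (ler_normD _ _))// lerD//.
  by rewrite normrM (le_trans _ IH)// ler_piMr.
rewrite (le_trans (ler_normB _ _))// lerD//.
  by rewrite normrM ler_piMl// Ecos_le1.
by rewrite normrM ler_piMl// Esin_le1.
Qed.

Hypothesis iu2 : forall a, integr P (fun w => u a (X a w) ^+ 2).
Hypothesis u_mean0 : forall a, Ex P (fun w => u a (X a w)) = 0.

Let iu a : integr P (fun w => u a (X a w)).
Proof. exact: integr_of_sqr. Qed.

(** Variances of independent centred variables add: the cross term vanishes
  since the partial sum belongs to the past of the next variable. *)
Lemma sum_past_moment n : [/\ from_past P X n (U n),
  integr P (fun w => U n w ^+ 2) &
  Ex P (fun w => U n w ^+ 2) = \sum_(a < n) Ex P (fun w => u a (X a w) ^+ 2)].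
Proof.
elim: n => [|n [pU iU EU]].
  have U0 : U 0 = fun=> 0 * 1 by apply/funext => w; rewrite /U big_ord0 mul0r.
  rewrite U0; split.
  - exact: (from_pastZ mX 0 (from_past0 mX indX)).
  - exact: integr_cst.
  - by rewrite Ex_cst big_ord0; ring.
have UE w : U n.+1 w = U n w + u n (X n w) by rewrite /U big_ord_recr.
have iUu : integr P (fun w => U n w * u n (X n w)).
  apply: (integr_le _ (integrD iU (iu2 n))) => [|w].
    exact: measurable_funM.
  rewrite [leRHS]ger0_norm ?addr_ge0 ?sqr_ge0//.
  by rewrite ler_norml; apply/andP; split; nra.
have sqE w : U n.+1 w ^+ 2 = U n w ^+ 2 + u n (X n w) ^+ 2 + 2 * (U n w * u n (X n w)).
  by rewrite UE; ring.
have i1 := integrD iU (iu2 n).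
have i2 := integrZ 2 iUu.
have p1 : from_past P X n.+1 (fun w => 1 * u n (X n w)).
  have p0 k : from_past P X k (fun=> 1).
    by elim: k => [|k IH]; [exact: (from_past0 mX indX)|exact: (from_pastS mX)].
  have iu1 : integr P (fun w => 1 * u n (X n w)) by under eq_fun do rewrite mul1r.
  exact: (from_pastM mX (p0 n) (mu n) (iu n) iu1).2.
split.
- have -> : U n.+1 = fun w => U n w + 1 * u n (X n w).
    by apply/funext => w; rewrite UE mul1r.
  by apply: from_pastD => //; exact: from_pastS.
- by rewrite (funext sqE); exact: integrD.
rewrite (funext sqE) ExD// ExZ// ExD// EU big_ord_recr /=.
by have [-> _] := from_pastM mX pU (mu n) (iu n) iUu; rewrite u_mean0; ring.
Qed.

End independent_sums.

(** * Second order expansions of sine and cosine *)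

Section trigonometric_estimates.
Context {R : realType}.
Implicit Types x y a b : R.

Lemma le_mean_value (f df : R -> R) (a b M : R) :
  (forall x, is_derive x 1 f (df x)) ->
  (forall c, `|c - a| <= `|b - a| -> `|df c| <= M) ->
  `|f b - f a| <= M * `|b - a|.
Proof.
move=> fdf dfM.
have cf : continuous f.
  move=> x; apply/differentiable_continuous/derivable1_diffP.
  exact: (@ex_derive _ _ _ _ _ _ _ (fdf x)).
have [ab|ba] := leP a b.
  have [c cab ->] := MVT_segment ab (fun x _ => fdf x) (continuous_subspaceT cf).
  move: cab; rewrite in_itv /= => /andP[ac cb].
  by rewrite normrM ler_wpM2r// dfM// !ger0_norm ?subr_ge0// lerD2r.
have [c cab fE] := MVT_segment (ltW ba) (fun x _ => fdf x) (continuous_subspaceT cf).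
move: cab; rewrite in_itv /= => /andP[ac cb].
rewrite distrC fE normrM [`|a - b|]distrC ler_wpM2r// dfM//.
by rewrite distrC [leRHS]distrC !ger0_norm ?subr_ge0 ?(ltW ba)// lerD2l lerN2.
Qed.

Lemma sin_lipschitz a b : `|sin b - sin a| <= `|b - a|.
Proof.
rewrite -[leRHS]mul1r; apply: (le_mean_value (df := cos)) => c _.
exact: cos_max.
Qed.

Lemma cos_lipschitz a b : `|cos b - cos a| <= `|b - a|.
Proof.
rewrite -[leRHS]mul1r; apply: (le_mean_value (df := fun x => - sin x)) => c _.
by rewrite normrN sin_max.
Qed.

Lemma norm_sin_le x : `|sin x| <= `|x|.
Proof. by have := sin_lipschitz 0 x; rewrite sin0 !subr0. Qed.

(** This and the next two bounds come from the previous one by the mean value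
  inequality applied on the segment from 0 to [x]. *)
Lemma norm_oneBcos_le x : `|1 - cos x| <= `|x| ^+ 2.
Proof.
have /(_ 0 x (`|x|)) := @le_mean_value cos (fun x => - sin x).
rewrite cos0 !subr0 distrC expr2; apply => c.
by rewrite subr0 normrN; apply: le_trans; exact: norm_sin_le.
Qed.

Lemma norm_sin_sub_le x : `|sin x - x| <= `|x| ^+ 3.
Proof.
have /(_ 0 x (`|x| ^+ 2)) := @le_mean_value (fun x => sin x - x) (fun x => cos x - 1).
rewrite sin0 !subr0 -exprSr; apply => c.
rewrite subr0 => cx; rewrite distrC (le_trans (norm_oneBcos_le c))//.
by rewrite lerXn2r ?nnegrE.
Qed.

Lemma norm_cos_sub_le x : `|cos x - (1 - x ^+ 2 / 2)| <= `|x| ^+ 4.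
Proof.
have H y : is_derive y 1 (fun x => cos x - (1 - x ^+ 2 / 2)) (- sin y - (0 - y)).
  apply: is_derive_eq.
  by rewrite !scaler0 /GRing.scale /=; field.
have := le_mean_value (a := 0) (b := x) (M := `|x| ^+ 3) H.
rewrite cos0 expr0n/= mul0r !subr0 subrr subr0 -exprSr; apply => c.
rewrite subr0 => cx.
have -> : - sin c - (0 - c) = - (sin c - c) by ring.
rewrite normrN (le_trans (norm_sin_sub_le c))//.
by rewrite lerXn2r ?nnegrE.
Qed.

(** The size of a second order Taylor remainder, uniformly in [x]: cubic near
  0, quadratic at infinity. Its expectation is what Lindeberg's condition
  controls. *)
Definition lindeberg_fun x := x ^+ 2 * Num.min 1 `|x|.

Lemma lindeberg_fun_ge0 x : 0 <= lindeberg_fun x.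
Proof. by rewrite mulr_ge0 ?sqr_ge0// le_min ler01 normr_ge0. Qed.

Lemma lindeberg_fun_le x : lindeberg_fun x <= x ^+ 2.
Proof. by rewrite ler_piMr ?sqr_ge0// ge_min lexx. Qed.

Lemma le_lindeberg_fun x y : `|x| <= `|y| -> lindeberg_fun x <= lindeberg_fun y.
Proof.
move=> xy; rewrite /lindeberg_fun -(real_normK (num_real x)).
rewrite -(real_normK (num_real y)) ler_pM ?sqr_ge0//.
- by rewrite lerXn2r ?nnegrE.
- by rewrite le_min !ge_min lexx xy orbT.
Qed.

Lemma sin_sub_lindeberg x : `|sin x - x| <= 2 * lindeberg_fun x.
Proof.
rewrite /lindeberg_fun -(real_normK (num_real x)).
case: (leP 1 `|x|) => x1.
  rewrite (le_trans (ler_normB _ _))// mulr1.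
  by have := norm_sin_le x; nra.
rewrite (le_trans (norm_sin_sub_le x))// -exprSr.
by rewrite ler_peMl ?exprn_ge0// ler1n.
Qed.

(** For [`|x| <= 1] this is the Taylor bound; otherwise it follows from [`|cos
  x| <= 1]. *)
Lemma cos_sub_lindeberg x : `|cos x - (1 - x ^+ 2 / 2)| <= 3 * lindeberg_fun x.
Proof.
rewrite /lindeberg_fun; case: (leP 1 `|x|) => x1.
  have x2 : 1 <= x ^+ 2 by rewrite -(real_normK (num_real x)) exprn_ege1.
  have := cos_max x; rewrite mulr1 !ler_norml => /andP[c1 c2].
  by apply/andP; split; nra.
rewrite (le_trans (norm_cos_sub_le x))// -(real_normK (num_real x)) -exprSr.
have x0 := normr_ge0 x; have : 0 <= `|x| ^+ 3 by exact: exprn_ge0.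
by rewrite [_ ^+ 4]exprS; nra.
Qed.

End trigonometric_estimates.

(** * Normal laws under affine maps and convolution *)

Section normal_laws.
Context {R : realType}.
Notation leb := (@lebesgue_measure R).

(** Both sides are measures in [B], and they agree on half-open intervals. *)
Lemma lebesgue_affine (x c : R) (B : set R) : c != 0 -> measurable B ->
  leb B = (`|c|%:E * leb [set y | B (x + c * y)%R])%E.
Proof.
move=> c0 mB.
have mphi : measurable_fun [set: measurableTypeR R] (fun y : measurableTypeR R => (x + c * y) : measurableTypeR R).
  by apply: measurable_funD => //; exact: measurable_funM.
pose phi := (fun y : measurableTypeR R => (x + c * y) : measurableTypeR R).
(* The image of Lebesgue measure under the affine map, rescaled, is a measure
   to which uniqueness of Lebesgue measure applies. *)
pose nu := mscale (NngNum (normr_ge0 c)) (pushforward leb phi).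
suff -> : leb B = nu mphi B by [].
apply: lebesgue_measure_unique => // _ [[a b] /= ab <-].
change (leb `]a, b]%classic = (`|c|%:E * leb (phi @^-1` `]a, b]))%E).
have cN0 : 0 < `|c| by rewrite normr_gt0.
have -> : phi @^-1` `]a, b] =
    if 0 < c then `](a - x) / c, (b - x) / c]%classic
    else `[(b - x) / c, (a - x) / c[%classic.
  have [c1|c1] := ltP 0 c; apply/seteqP; split => y /=; rewrite !in_itv /= /phi.
  1,2: by rewrite ltr_pdivrMr// ler_pdivlMr//; move=> /andP[? ?]; apply/andP; split; lra.
  1,2: have c2 : c < 0 by rewrite lt_neqAle c0.
  1,2: by rewrite ler_ndivrMr// ltr_ndivlMr//; move=> /andP[? ?]; apply/andP; split; lra.
case: (boolP (0 < c)) => c1; rewrite !lebesgue_measure_itv/= !lte_fin.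
  rewrite ltr_pM2r ?invr_gt0// ltrD2r; case: ifP => _; last by rewrite mule0.
  by rewrite -!EFinB -EFinM gtr0_norm//; congr (_%:E); field.
have c2 : c < 0 by rewrite lt_neqAle c0 leNgt.
rewrite ltr_nM2r ?invr_lt0// ltrD2r; case: ifP => _; last by rewrite mule0.
by rewrite -!EFinB -EFinM ltr0_norm//; congr (_%:E); field.
Qed.

(** The density of the normal law is its Radon-Nikodym derivative. *)
Lemma integral_normal_prob (m s : R) (f : R -> R) : integr (normal_prob m s) f ->
  (\int[normal_prob m s]_x (f x)%:E = \int[leb]_x (f x * normal_pdf m s x)%:E)%E.
Proof.
move=> fi; have dom := normal_prob_dominates m s.
rewrite -(Radon_Nikodym_change_of_variables dom measurableT fi).
have mf : measurable_fun [set: R] (EFin \o f) by exact: measurable_int fi.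
apply: ae_eq_integral => //.
- exact: emeasurable_funM.
- apply/measurable_EFinP; apply: measurable_funM; first exact/measurable_EFinP.
  exact: measurable_normal_pdf.
have : ae_eq leb [set: R] (Radon_Nikodym (charge_of_finite_measure (normal_prob m s)) leb)
    (fun x => (normal_pdf m s x)%:E).
  apply: integral_ae_eq => //.
  - by apply: Radon_Nikodym_integrable; exact: dom.
  - by apply/measurable_EFinP; exact: measurable_normal_pdf.
  - by move=> E _ mE; rewrite -Radon_Nikodym_integral.
by apply: ae_eqe_mul2l.
Qed.

Lemma normal_pdf_affine (x c s y : R) : c != 0 -> 0 < s ->
  `|c| * normal_pdf x (`|c| * s) (x + c * y) = normal_pdf 0 s y.
Proof.
move=> c0 s0; have c1 : 0 < `|c| by rewrite normr_gt0.
have cs : `|c| * s != 0 by rewrite gt_eqF// mulr_gt0.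
rewrite !normal_pdfE ?gt_eqF//; last exact: mulr_gt0.
rewrite /normal_fun subr0 mulrA; congr (_ * expR _).
  rewrite /normal_peak exprMn -mulrA -mulrnAr sqrtrM ?sqr_ge0//.
  by rewrite -mulrnAl sqrtr_sqr normr_id invfM mulrA divff ?mul1r// gt_eqF.
rewrite addrAC subrr add0r !exprMn real_normK ?num_real//.
rewrite -mulrnAr -mulrN -mulf_div divff ?mul1r//.
by rewrite expf_neq0.
Qed.

Lemma normal_prob_affine (x c s : R) (B : set R) : c != 0 -> 0 < s -> measurable B ->
  normal_prob 0 s [set y | B (x + c * y)] = normal_prob x (`|c| * s) B.
Proof.
move=> c0 s0 mB.
have mphi : measurable_fun [set: measurableTypeR R]
    (fun y : measurableTypeR R => (x + c * y) : measurableTypeR R).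
  by apply: measurable_funD => //; exact: measurable_funM.
pose phi := (fun y : measurableTypeR R => (x + c * y) : measurableTypeR R).
pose nu := mscale (NngNum (normr_ge0 c)) (pushforward leb phi).
have nuE A : measurable A -> leb A = nu mphi A.
  by move=> mA; exact: (lebesgue_affine x c0).
have mpdf : measurable_fun B (EFin \o normal_pdf x (`|c| * s)).
  by apply/measurable_EFinP/measurable_funTS; exact: measurable_normal_pdf.
rewrite /normal_prob; symmetry.
rewrite (eq_measure_integral (nu mphi)); last by move=> A mA _; exact: nuE.
rewrite /nu ge0_integral_mscale//; last first.
  by move=> y _; rewrite lee_fin normal_pdf_ge0.
rewrite ge0_integral_pushforward//; last first.
  by move=> y _; rewrite lee_fin normal_pdf_ge0.
rewrite -ge0_integralZl//.
- by apply: eq_integral => y _; rewrite /= -EFinM normal_pdf_affine.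
- by rewrite -[X in measurable X]setTI; apply: (mphi _ B).
- apply: measurable_funTS; apply: (measurableT_comp _ mphi).
  by apply/measurable_EFinP; exact: measurable_normal_pdf.
- by move=> y _; rewrite lee_fin normal_pdf_ge0.
Qed.

Lemma normal_peakE (s : R) : 0 < s -> normal_peak s = (s * Num.sqrt (pi *+ 2))^-1.
Proof.
by move=> s0; rewrite /normal_peak -mulrnAr sqrtrM ?sqr_ge0// sqrtr_sqr gtr0_norm.
Qed.

(** Completing the square: if [x] has variance [s ^+ 2] and [z - x] is
  independent with variance [t ^+ 2], the joint density is the density of [z]
  times the conditional density of [x] given [z]. *)
Lemma normal_pdf_product (s t x z : R) (r := Num.sqrt (s ^+ 2 + t ^+ 2)) :
  0 < s -> 0 < t ->
  normal_pdf x t z * normal_pdf 0 s x =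
  normal_pdf 0 r z * normal_pdf (z * s ^+ 2 / r ^+ 2) (s * t / r) x.
Proof.
move=> s0 t0; have st0 : 0 < s ^+ 2 + t ^+ 2 by rewrite addr_gt0// exprn_gt0.
have r0 : 0 < r by rewrite sqrtr_gt0.
have r2 : r ^+ 2 = s ^+ 2 + t ^+ 2 by rewrite sqr_sqrtr// ltW.
have str0 : 0 < s * t / r by rewrite divr_gt0// mulr_gt0.
rewrite !normal_pdfE ?gt_eqF// !normal_peakE// /normal_fun.
have sp0 : 0 < Num.sqrt (pi *+ 2) :> R by rewrite sqrtr_gt0 mulrn_wgt0// pi_gt0.
rewrite mulrACA [RHS]mulrACA -!expRD; congr (_ * expR _).
  by field; rewrite !gt_eqF.
have -> : (s * t / r) ^+ 2 = s ^+ 2 * t ^+ 2 / (s ^+ 2 + t ^+ 2).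
  by rewrite -r2; field; rewrite gt_eqF.
by rewrite r2; field; rewrite !gt_eqF.
Qed.

Lemma measurable_normal_pdf_mean (t : R) : 0 < t ->
  measurable_fun [set: R * R] (fun v : R * R => normal_pdf v.1 t v.2).
Proof.
move=> t0; under eq_fun do rewrite normal_pdfE ?gt_eqF// /normal_fun.
apply: measurable_funM => //; apply: measurableT_comp => //.
apply: measurable_funM => //; apply: measurableT_comp => //.
by apply: measurable_funX; exact: measurable_funB.
Qed.

Let slice (t : R) (B : set R) (v : measurableTypeR R * measurableTypeR R) : R :=
  \1_B v.2 * normal_pdf v.1 t v.2.

Let mslice (t : R) (B : set R) : 0 < t -> measurable B ->
  measurable_fun [set: measurableTypeR R * measurableTypeR R] (slice t B).
Proof.
move=> t0 mB; apply: measurable_funM; last exact: measurable_normal_pdf_mean.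
by apply: measurableT_comp => //; exact: measurable_indic.
Qed.

Let slice_ge0 t B v : (0 <= (slice t B v)%:E)%E.
Proof. by rewrite lee_fin mulr_ge0 ?normal_pdf_ge0// indicE ler0n. Qed.

Let integral_slice t B x : normal_prob x t B = (\int[leb]_z (slice t B (x, z))%:E)%E.
Proof.
rewrite /normal_prob integral_mkcond; apply: eq_integral => z _.
by rewrite patchE /slice /= indicE; case: (z \in B); rewrite ?mul1r ?mul0r.
Qed.

Lemma measurable_normal_prob_mean (t : R) (B : set R) : 0 < t -> measurable B ->
  measurable_fun [set: measurableTypeR R] (fun x => normal_prob x t B).
Proof.
move=> t0 mB.
have mE : measurable_fun [set: measurableTypeR R * measurableTypeR R] (EFin \o slice t B).
  by apply/measurable_EFinP; exact: mslice.
apply: eq_measurable_fun (measurable_fun_fubini_tonelli_F (m2 := leb) (EFin \o slice t B)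
  mE (slice_ge0 _ _)).
by move=> x _; rewrite /fubini_F integral_slice.
Qed.

(** Exchange the two integrals; after [normal_pdf_product] the inner one is the
  total mass of a normal density. *)
Lemma normal_prob_convolution (s t : R) (B : set R) : 0 < s -> 0 < t -> measurable B ->
  (\int[normal_prob 0 s]_x normal_prob x t B)%E =
  normal_prob 0 (Num.sqrt (s ^+ 2 + t ^+ 2)) B.
Proof.
move=> s0 t0 mB; set r := Num.sqrt _.
pose g := slice t B; have mg := mslice t0 mB.
have gB x := integral_slice t B x.
have g0 v : (0 <= (g v)%:E)%E by exact: slice_ge0.
have prob_fin x : normal_prob x t B \is a fin_num by exact: fin_num_measure.
pose f x := fine (normal_prob x t B).
have fE x : (f x)%:E = normal_prob x t B by rewrite fineK.
have mf : measurable_fun [set: measurableTypeR R] f.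
  apply/measurable_EFinP; apply: eq_measurable_fun (measurable_normal_prob_mean t0 mB).
  by move=> x _; rewrite /= fE.
have if_ : integr (normal_prob 0 s) f.
  apply: (@integr_bounded _ _ _ _ _ 1) => // x.
  rewrite ger0_norm; last by rewrite fine_ge0.
  by rewrite -lee_fin fE probability_le1.
transitivity (\int[normal_prob 0 s]_x (f x)%:E)%E.
  by apply: eq_integral => x _; rewrite fE.
rewrite (integral_normal_prob if_).
pose h (v : measurableTypeR R * measurableTypeR R) : R := g v * normal_pdf 0 s v.1.
have mh : measurable_fun [set: measurableTypeR R * measurableTypeR R] (EFin \o h).
  apply/measurable_EFinP; apply: measurable_funM => //.
  by apply: measurableT_comp => //; exact: measurable_normal_pdf.
have h0 v : (0 <= (EFin \o h) v)%E.
  by rewrite lee_fin mulr_ge0 ?normal_pdf_ge0// -lee_fin.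
transitivity (\int[leb]_x \int[leb]_z (h (x, z))%:E)%E.
  apply: eq_integral => x _; rewrite EFinM fE gB -ge0_integralZr//.
  - by apply/measurable_EFinP; apply: (measurableT_comp mg); exact: measurable_pair1.
  - by rewrite lee_fin normal_pdf_ge0.
rewrite (fubini_tonelli (EFin \o h) mh h0) /normal_prob [RHS]integral_mkcond.
apply: eq_integral => z _ /=.
rewrite /h /g /slice /=.
under eq_integral do rewrite -mulrA normal_pdf_product// mulrA EFinM.
rewrite ge0_integralZl//.
- by rewrite integral_normal_pdf mule1 patchE indicE; case: (z \in B); rewrite ?mul1r ?mul0r.
- by apply/measurable_EFinP; exact: measurable_normal_pdf.
- by move=> x _; rewrite lee_fin normal_pdf_ge0.
- by rewrite lee_fin mulr_ge0 ?normal_pdf_ge0// indicE ler0n.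
Qed.

End normal_laws.

(** * Sums of independent normal variables *)

Section product_probability.
Context {d1 d2 : measure_display} {T1 : measurableType d1} {T2 : measurableType d2}.
Context {R : realType} (P1 : probability T1 R) (P2 : probability T2 R).

(** The product measure under a name that carries the probability structure. *)
Definition product_prob : set (T1 * T2) -> \bar R := (P1 \x P2)%E.

HB.instance Definition _ := Measure.on product_prob.

Let product_prob_setT : product_prob [set: T1 * T2] = 1%E.
Proof.
rewrite /product_prob -setXTT [LHS]product_measure1E//.
rewrite -[RHS]mule1; congr (_ * _)%E; exact: probability_setT.
Qed.

HB.instance Definition _ :=
  Measure_isProbability.Build _ _ _ product_prob product_prob_setT.

End product_probability.

(** The centred normal law with variance [v], the point mass at 0 for [v = 0]. *)
Definition has_normal_law {R : realType} {d : measure_display} {T : measurableType d}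
    (P : probability T R) (X : T -> R) (v : R) : Prop :=
  measurable_fun [set: T] X /\
  forall B, measurable B -> P [set w | B (X w)] = normal_law 0 v B.

Section gaussian_sums.
Context {R : realType}.

Lemma normal_law_shift (x v : R) (B : set R) : 0 <= v -> measurable B ->
  normal_law 0 v [set y | B (x + y)] = normal_law x v B.
Proof.
move=> v0 mB; rewrite /normal_law; have [_|v_neq0] := eqVneq v 0.
  by rewrite !diracE -[in RHS](addr0 x).
have sv : 0 < Num.sqrt v by rewrite sqrtr_gt0 lt0r v_neq0.
have := normal_prob_affine x (oner_neq0 R) sv mB.
by rewrite normr1 mul1r => <-; under [in RHS]eq_fun do rewrite mul1r.
Qed.

Context {d1 d2 : measure_display} {T1 : measurableType d1} {T2 : measurableType d2}.
Context (P1 : probability T1 R) (P2 : probability T2 R).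

(** Conditioning on the first coordinate gives the integral of shifted normal
  laws; the cases where one variance is 0 are separate because [normal_law] is
  then a point mass without density. *)
Lemma has_normal_lawD (X1 : T1 -> R) (X2 : T2 -> R) (v1 v2 : R) :
  0 <= v1 -> 0 <= v2 -> has_normal_law P1 X1 v1 -> has_normal_law P2 X2 v2 ->
  has_normal_law (product_prob P1 P2) (fun w => X1 w.1 + X2 w.2) (v1 + v2).
Proof.
move=> v10 v20 [mX1 law1] [mX2 law2]; split.
  by apply: measurable_funD; exact: measurableT_comp.
move=> B mB.
have shift_mB x : measurable [set y | B (x + y)].
  have : measurable_fun [set: R] (fun y : R => x + y) by exact: measurable_funD.
  by move=> /(_ measurableT B mB); rewrite setTI.
transitivity (\int[P1]_x normal_law (X1 x) v2 B)%E.
  apply: eq_integral => x _; rewrite /= -normal_law_shift// -law2//.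
  by congr (P2 _); apply/seteqP; split => y /=; rewrite /xsection /= in_setE.
rewrite /normal_law; have [v2E|v2_neq0] := eqVneq v2 0.
  rewrite v2E addr0 -/(normal_law 0 v1 B) -law1//.
  have mXB : measurable [set w | B (X1 w)].
    by rewrite -[X in measurable X]setTI; exact: mX1.
  have := integral_indic P1 measurableT mXB; rewrite setIT => <-.
  by apply: eq_integral => x _; rewrite diracE.
have s2 : 0 < Num.sqrt v2 by rewrite sqrtr_gt0 lt0r v2_neq0.
have v12 : v1 + v2 != 0 by rewrite gt_eqF// ltr_wpDl// lt0r v2_neq0.
rewrite (negbTE v12).
have mh := measurable_normal_prob_mean s2 mB.
have h0 (x : R) : (0 <= normal_prob x (Num.sqrt v2) B)%E by [].
have mX1' : measurable_fun [set: T1] (X1 : T1 -> measurableTypeR R) := mX1.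
rewrite -(ge0_integral_pushforward mX1' P1 measurableT mh)//.
have [v1E|v1_neq0] := eqVneq v1 0.
  pose z : measurableTypeR R := 0.
  transitivity (\int[\d_z]_y normal_prob y (Num.sqrt v2) B)%E.
    apply: eq_measure_integral => A mA _; rewrite /pushforward [LHS]law1//.
    by rewrite /normal_law v1E eqxx.
  by rewrite integral_dirac// diracT mul1e v1E add0r.
have s1 : 0 < Num.sqrt v1 by rewrite sqrtr_gt0 lt0r v1_neq0.
transitivity (\int[normal_prob 0 (Num.sqrt v1)]_y normal_prob y (Num.sqrt v2) B)%E.
  apply: eq_measure_integral => A mA _; rewrite /pushforward [LHS]law1//.
  by rewrite /normal_law (negbTE v1_neq0).
have := normal_prob_convolution s1 s2 mB.
by rewrite (sqr_sqrtr v10) (sqr_sqrtr v20).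
Qed.

End gaussian_sums.

(** * Gaussian families and trigonometric moments of normal laws *)

Lemma Ex_same_law {R : realType} {d1 d2 d' : measure_display}
    {T1 : measurableType d1} {T2 : measurableType d2} {T' : measurableType d'}
    (P1 : probability T1 R) (P2 : probability T2 R) (X1 : T1 -> T') (X2 : T2 -> T')
    (h : T' -> R) :
  measurable_fun [set: T1] X1 -> measurable_fun [set: T2] X2 ->
  (forall A, measurable A -> P1 (X1 @^-1` A) = P2 (X2 @^-1` A)) ->
  measurable_fun [set: T'] h -> integr P1 (fun w => h (X1 w)) ->
  integr P2 (fun w => h (X2 w)) /\
  Ex P1 (fun w => h (X1 w)) = Ex P2 (fun w => h (X2 w)).
Proof.
move=> mX1 mX2 law mh i1.
have mEh : measurable_fun [set: T'] (EFin \o h) by exact/measurable_EFinP.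
have i2 : integr P2 (fun w => h (X2 w)).
  apply/integrableP; split.
    by apply/measurable_EFinP; exact: measurableT_comp.
  have /integrableP[_] := i1.
  have mah : measurable_fun [set: T'] (fun x => `|(h x)%:E|)%E.
    exact: measurableT_comp.
  have e1 := ge0_integral_pushforward mX1 P1 measurableT mah (fun _ _ => abse_ge0 _).
  have e2 := ge0_integral_pushforward mX2 P2 measurableT mah (fun _ _ => abse_ge0 _).
  move: e1 e2; rewrite !preimage_setT => /= <- <-; apply: le_lt_trans.
  by rewrite le_eqVlt; apply/orP; left; apply/eqP; apply: eq_measure_integral => A mA _;
    exact: esym (law A mA).
split=> //; rewrite /Ex /Rintegral; congr fine.
have e1 := integral_pushforward mX1 mEh i1 measurableT.
have e2 := integral_pushforward mX2 mEh i2 measurableT.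
move: e1 e2; rewrite !preimage_setT => /= <- <-.
by apply: eq_measure_integral => A mA _; exact: (law A mA).
Qed.

Lemma Ex_product_prob {R : realType} {d1 d2 : measure_display}
    {T1 : measurableType d1} {T2 : measurableType d2}
    (P1 : probability T1 R) (P2 : probability T2 R) (f : T1 -> R) (g : T2 -> R) :
  measurable_fun [set: T1] f -> measurable_fun [set: T2] g ->
  (forall x, `|f x| <= 1) -> (forall y, `|g y| <= 1) ->
  Ex (product_prob P1 P2) (fun w => f w.1 * g w.2) = Ex P1 f * Ex P2 g.
Proof.
move=> mf mg f1 g1.
have if_ : integr P1 f by exact: (integr_bounded P1 mf f1).
have ig : integr P2 g by exact: (integr_bounded P2 mg g1).
have mfg : measurable_fun [set: T1 * T2] (fun w => f w.1 * g w.2).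
  by apply: measurable_funM; exact: measurableT_comp.
have ifg : integr (product_prob P1 P2) (fun w => f w.1 * g w.2).
  apply: (@integr_bounded _ _ _ _ _ 1) => // w.
  by rewrite normrM mulr_ile1.
apply: EFin_inj; rewrite -EFin_Ex//.
rewrite -(integral12_prod_meas1 ifg) /fubini_F /= EFinM -(EFin_Ex if_).
rewrite -integralZr//.
apply: eq_integral => x _; under eq_integral do rewrite EFinM.
by rewrite integralZl// EFin_Ex.
Qed.

Section standard_normal.
Context {R : realType}.

Definition std_normal : probability (measurableTypeR R) R := normal_prob 0 1.

(** The characteristic function of the standard normal law. In this form it is
  visibly continuous and equal to [1 - s ^+ 2 / 2] up to second order; together
  with multiplicativity ([normal_charD]) this is what the central limit theorem
  takes from it. *)
Definition normal_char (s : R) : R := Ex std_normal (fun x => cos (s * x)).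

Lemma has_normal_law_scale (c : R) :
  has_normal_law std_normal (fun x => c * x) (c ^+ 2).
Proof.
split; first exact: measurable_funM.
move=> B mB; rewrite /normal_law sqrf_eq0; have [->|c0] := eqVneq c 0.
  rewrite diracE; have [/set_mem B0|/negP B0] := boolP (0 \in B).
    rewrite (_ : [set _ | _] = setT) ?probability_setT//.
    by apply/seteqP; split => x //= _; rewrite mul0r.
  rewrite (_ : [set _ | _] = set0) ?measure0//.
  by apply/seteqP; split => x //=; rewrite mul0r => /mem_set.
have := normal_prob_affine 0 c0 ltr01 mB.
by rewrite mulr1 sqrtr_sqr => <-; under [in RHS]eq_fun do rewrite add0r.
Qed.

(** Independent standard normal variables on a product space, one factor at a
  time. The law of every linear combination is the induction hypothesis, since
  it is what [has_normal_lawD] propagates. *)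
Lemma gaussian_family (N : nat) : exists (d : measure_display)
    (T : measurableType d) (P : probability T R) (g : 'I_N -> T -> R),
  forall c : 'I_N -> R, has_normal_law P (fun w => \sum_i c i * g i w) (\sum_i c i ^+ 2).
Proof.
elim: N => [|N [d [T [P [g hg]]]]].
  exists _, _, std_normal, (fun _ _ => 0) => c.
  have E : (fun w : measurableTypeR R => \sum_(i < 0) c i * 0) = (fun x => 0 * x).
    by apply/funext => w; rewrite big_ord0 mul0r.
  by have := has_normal_law_scale 0; rewrite -E !big_ord0 expr0n /=.
exists _, _, (product_prob P std_normal),
  (fun i w => if unlift ord_max i is Some j then g j w.1 else w.2) => c.
have := has_normal_lawD (sumr_ge0 _ (fun i _ => sqr_ge0 (c (widen_ord (leqnSn N) i))))
  (sqr_ge0 (c ord_max)) (hg _) (has_normal_law_scale (c ord_max)).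
rewrite big_ord_recr /=.
rewrite [X in has_normal_law _ X _ -> _](_ : _ = (fun w => \sum_i c i *
  if unlift ord_max i is Some j then g j w.1 else w.2)) //.
apply/funext => w.
rewrite big_ord_recr /= unlift_none; congr (_ + _); apply: eq_bigr => i _.
rewrite (_ : widen_ord _ i = lift ord_max i) ?liftK//.
by apply: val_inj; rewrite /= /bump leqNgt ltn_ord.
Qed.

(** The sine moment vanishes because the law is the image of the standard
  normal one under both [Num.sqrt v] and [- Num.sqrt v]. *)
Lemma has_normal_law_char {d : measure_display} {T : measurableType d}
    (P : probability T R) (X : T -> R) (v : R) : 0 <= v -> has_normal_law P X v ->
  Ex P (fun w => cos (X w)) = normal_char (Num.sqrt v) /\
  Ex P (fun w => sin (X w)) = 0.
Proof.
move=> v0 [mX law].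
have msin : measurable_fun [set: measurableTypeR R] (@sin R).
  by apply: continuous_measurable_fun; exact: continuous_sin.
have mcos : measurable_fun [set: measurableTypeR R] (@cos R).
  by apply: continuous_measurable_fun; exact: continuous_cos.
have mX' : measurable_fun [set: T] (X : T -> measurableTypeR R) := mX.
have same c : c ^+ 2 = v -> forall A : set (measurableTypeR R), measurable A ->
    P (X @^-1` A) = std_normal ((fun x => c * x) @^-1` A).
  by move=> cv A mA; rewrite [LHS]law// -cv [RHS](has_normal_law_scale c).2.
have mc (c : R) : measurable_fun [set: measurableTypeR R]
    (fun x : measurableTypeR R => c * x : measurableTypeR R) by exact: measurable_funM.
have icos := integr_cos P mX; have isin := integr_sin P mX.
have sv : Num.sqrt v ^+ 2 = v by rewrite sqr_sqrtr.
have svN : (- Num.sqrt v) ^+ 2 = v by rewrite sqrrN.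
split; first exact: (Ex_same_law mX' (mc _) (same _ sv) mcos icos).2.
have [isn e1] := Ex_same_law mX' (mc _) (same _ sv) msin isin.
have [_ e2] := Ex_same_law mX' (mc _) (same _ svN) msin isin.
have : Ex P (fun w => sin (X w)) = - Ex P (fun w => sin (X w)).
  rewrite {1}e2 e1 -[RHS]mulN1r -ExZ//; congr (Ex _ _); apply/funext => x.
  by rewrite mulNr sinN mulN1r.
by lra.
Qed.

End standard_normal.

(** * Variance of the standard normal law *)

Section normal_variance.
Context {R : realType}.
Notation gamma := (@std_normal R).

Let measurable_trig (c : R) (f : R -> R) : continuous f ->
  measurable_fun [set: measurableTypeR R] (fun x => f (c * x)).
Proof.
move=> cf; apply: measurableT_comp; last exact: measurable_funM.
exact: continuous_measurable_fun.
Qed.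

(** The sum of independent normal variables is normal, and the cosine of the
  sum expands with vanishing sine moments. *)
Lemma normal_charD (s t : R) :
  normal_char s * normal_char t = normal_char (Num.sqrt (s ^+ 2 + t ^+ 2)).
Proof.
have law := has_normal_lawD (sqr_ge0 s) (sqr_ge0 t)
  (has_normal_law_scale s) (has_normal_law_scale t).
have [<- _] := has_normal_law_char (addr_ge0 (sqr_ge0 s) (sqr_ge0 t)) law.
have [_ sin0] := has_normal_law_char (sqr_ge0 s) (has_normal_law_scale s).
have mc (c : R) := measurable_trig c (@continuous_cos R).
have ms (c : R) := measurable_trig c (@continuous_sin R).
rewrite [RHS](_ : _ = Ex (product_prob gamma gamma) (fun w =>
  cos (s * w.1) * cos (t * w.2) - sin (s * w.1) * sin (t * w.2))); last first.
  by congr (Ex _ _); apply/funext => w; rewrite cosD.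
have le1 (f : R -> R) : (forall x, `|f x| <= 1) -> forall c x : R, `|f (c * x)| <= 1 by [].
have i2 (f g : R -> R) : (forall x, `|f x| <= 1) -> (forall x, `|g x| <= 1) ->
    continuous f -> continuous g ->
    integr (product_prob gamma gamma) (fun w => f (s * w.1) * g (t * w.2)).
  move=> f1 g1 cf cg; apply: (@integr_bounded _ _ _ _ _ 1) => [|w]; last first.
    by rewrite normrM mulr_ile1.
  apply: measurable_funM; first exact: (measurableT_comp (measurable_trig s cf)).
  exact: (measurableT_comp (measurable_trig t cg)).
rewrite (ExB (i2 _ _ (@cos_max R) (@cos_max R) (@continuous_cos R) (@continuous_cos R))
  (i2 _ _ (@sin_max R) (@sin_max R) (@continuous_sin R) (@continuous_sin R))).
rewrite (Ex_product_prob _ _ (mc s) (mc t) (le1 _ (@cos_max R) s) (le1 _ (@cos_max R) t)).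
rewrite (Ex_product_prob _ _ (ms s) (ms t) (le1 _ (@sin_max R) s) (le1 _ (@sin_max R) t)).
by rewrite sin0 mul0r subr0.
Qed.

Lemma normal_char0 : normal_char 0 = 1 :> R.
Proof.
rewrite /normal_char -[RHS](Ex_cst gamma); congr (Ex _ _).
by apply/funext => x; rewrite mul0r cos0.
Qed.

Lemma prod_normal_char (n : nat) (v : nat -> R) : (forall a, 0 <= v a) ->
  \prod_(a < n) normal_char (Num.sqrt (v a)) = normal_char (Num.sqrt (\sum_(a < n) v a)).
Proof.
move=> v0; elim: n => [|n IH]; first by rewrite !big_ord0 sqrtr0 normal_char0.
rewrite !big_ord_recr /= IH normal_charD !sqr_sqrtr//.
by apply: sumr_ge0.
Qed.

Lemma norm_normal_char_le1 (s : R) : `|normal_char s| <= 1.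
Proof.
apply: norm_Ex_bounded => [|x]; last exact: cos_max.
exact: (measurable_trig s (@continuous_cos R)).
Qed.

(** The integrand times the standard normal density is [(1 + a)^-1] times the
  normal density with standard deviation [(1 + a)^-1]. *)
Lemma Ex_exp_sqr_normal (a : R) : 0 < a ->
  Ex gamma (fun x => expR (- (2 * a + a ^+ 2) * x ^+ 2 / 2)) = (1 + a)^-1.
Proof.
move=> a0; set f := fun x : R => expR (- (2 * a + a ^+ 2) * x ^+ 2 / 2).
have mf : measurable_fun [set: measurableTypeR R] f.
  apply: measurableT_comp => //; apply: measurable_funM => //.
  by apply: measurable_funM => //; exact: measurable_funX.
have if_ : integr gamma f.
  apply: (@integr_bounded _ _ _ _ _ 1) => // x.
  rewrite ger0_norm ?expR_ge0// -[leRHS]expR0 ler_expR.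
  by have := sqr_ge0 x; nra.
have s0 : 0 < (1 + a)^-1 by rewrite invr_gt0; lra.
rewrite /Ex /Rintegral (integral_normal_prob if_).
have h1 : 1 + a != 0 by rewrite gt_eqF//; lra.
have h2 : Num.sqrt (pi *+ 2) != 0 :> R.
  by rewrite gt_eqF// sqrtr_gt0 mulrn_wgt0// pi_gt0.
have E x : f x * normal_pdf 0 1 x = (1 + a)^-1 * normal_pdf 0 (1 + a)^-1 x.
  rewrite !normal_pdfE ?gt_eqF// !normal_peakE// /normal_fun /f.
  rewrite mulrCA -expRD [RHS]mulrA; congr (_ * expR _).
    by field; rewrite h1 h2.
  by field; rewrite h1.
under eq_integral do rewrite E EFinM.
rewrite integralZl//; last exact: integrable_normal_pdf.
by rewrite integral_normal_pdf mule1.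
Qed.

(** Monotone convergence of the truncations. *)
Lemma integr_truncation {d : measure_display} {T : measurableType d}
    (P : probability T R) (Y : T -> R) (C : R) :
  measurable_fun [set: T] Y -> (forall w, 0 <= Y w) ->
  (forall M : nat, Ex P (fun w => Num.min (Y w) M%:R) <= C) -> integr P Y.
Proof.
move=> mY Y0 YC.
pose g (M : nat) (w : T) := (Num.min (Y w) M%:R)%:E.
have mg M : measurable_fun [set: T] (g M).
  by apply/measurable_EFinP; exact: measurable_minr.
have g0 M w : [set: T] w -> (0 <= g M w)%E by rewrite lee_fin le_min Y0 ler0n.
have gnd w : [set: T] w -> {homo g^~ w : n m / (n <= m)%N >-> (n <= m)%E}.
  by move=> _ n m nm; rewrite lee_fin le_min !ge_min lexx ler_nat nm orbT.
have glim w : limn (g^~ w) = (Y w)%:E.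
  apply/cvg_lim => //; apply: cvg_EFin; first by near=> n.
  apply: cvg_near_cst; near=> n; rewrite /g /=.
  by apply/min_idPl; near: n; exact: nbhs_infty_ger.
apply/integrableP; split; first exact/measurable_EFinP.
have -> : (\int[P]_w `|(EFin \o Y) w| = \int[P]_w limn (g^~ w))%E.
  by apply: eq_integral => w _; rewrite glim /= ger0_norm.
rewrite (monotone_convergence P measurableT mg g0 gnd).
apply: (@le_lt_trans _ _ C%:E); last exact: ltry.
apply: lime_le.
  apply: ereal_nondecreasing_is_cvgn => n m nm.
  by apply: ge0_le_integral => // w wT; first [exact: (g0 _ w wT)|exact: gnd].
near=> M; have iM : integr P (fun w => Num.min (Y w) M%:R).
  apply: (@integr_bounded _ _ _ _ _ M%:R) => [|w]; first exact: measurable_minr.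
  by rewrite ger0_norm ?ge_min ?lexx ?orbT// le_min Y0 ler0n.
by rewrite (EFin_Ex iM) lee_fin.
Unshelve. all: by end_near. Qed.

Let lambda (n : nat) : R := 2 * n.+1%:R^-1 + n.+1%:R^-1 ^+ 2.
Let f (n : nat) (x : R) := (1 - expR (- lambda n * x ^+ 2 / 2)) * (2 / lambda n).

Let lambda_gt0 n : 0 < lambda n.
Proof.
have : 0 < n.+1%:R^-1 :> R by rewrite invr_gt0.
by move=> a0; rewrite /lambda addr_gt0// ?mulr_gt0// exprn_gt0.
Qed.

Let lambda_cvg : lambda n @[n --> \oo] --> (0 : R).
Proof.
have h : n.+1%:R^-1 @[n --> \oo] --> (0 : R) by exact: cvg_harmonic.
rewrite [X in _ --> X](_ : 0 = 2 * 0 + 0 ^+ 2); last by ring.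
by apply: cvgD; [exact: cvgMr|exact: cvgM].
Qed.

Let f_le n x : f n x <= x ^+ 2.
Proof.
have l0 := lambda_gt0 n; rewrite /f mulrA ler_pdivrMr//.
have := expR_ge1Dx (- lambda n * x ^+ 2 / 2); lra.
Qed.

Let f_ge n x : x ^+ 2 / (1 + lambda n * x ^+ 2 / 2) <= f n x.
Proof.
have l0 := lambda_gt0 n; have x0 := sqr_ge0 x.
set y := x ^+ 2 in x0 *; rewrite /f -/y; set z := lambda n * y / 2.
have z0 : 0 <= z by rewrite /z; nra.
have -> : - lambda n * y / 2 = - z by rewrite /z; ring.
have e1 : 1 + z <= expR z := expR_ge1Dx z.
have e2 : expR (- z) <= (1 + z)^-1.
  by rewrite expRN lef_pV2 ?posrE ?expR_gt0//; lra.
have -> : y / (1 + z) = (1 - (1 + z)^-1) * (2 / lambda n).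
  by rewrite /z; field; rewrite !gt_eqF//; nra.
by rewrite ler_wpM2r ?divr_ge0 ?(ltW l0)//; lra.
Qed.

Let f_ge0 n x : 0 <= f n x.
Proof.
apply: le_trans (f_ge n x); rewrite divr_ge0 ?sqr_ge0//.
by have := lambda_gt0 n; have := sqr_ge0 x; nra.
Qed.

Let mf n : measurable_fun [set: measurableTypeR R] (f n).
Proof.
apply: measurable_funM => //; apply: measurable_funB => //.
apply: measurableT_comp => //; apply: measurable_funM => //.
by apply: measurable_funM => //; exact: measurable_funX.
Qed.

Let f_bounded n x : `|f n x| <= 2 / lambda n.
Proof.
by rewrite ger0_norm// ler_piMl ?divr_ge0 ?(ltW (lambda_gt0 n))// lerBlDr lerDl expR_ge0.
Qed.

Let Ex_f n : Ex gamma (f n) = 2 / ((1 + n.+1%:R^-1) * (2 + n.+1%:R^-1)).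
Proof.
set a : R := n.+1%:R^-1; have a0 : 0 < a by rewrite invr_gt0.
pose e x := expR (- lambda n * x ^+ 2 / 2).
have me : measurable_fun [set: measurableTypeR R] e.
  apply: measurableT_comp => //; apply: measurable_funM => //.
  by apply: measurable_funM => //; exact: measurable_funX.
have ie : integr gamma e.
  apply: (@integr_bounded _ _ _ _ _ 1) => // x.
  rewrite ger0_norm ?expR_ge0// -[leRHS]expR0 ler_expR.
  by have := sqr_ge0 x; have := lambda_gt0 n; nra.
transitivity (Ex gamma (fun x => (2 / lambda n) * (1 - e x))).
  by congr (Ex _ _); apply/funext => x; rewrite mulrC.
rewrite ExZ; last by apply: integrB => //; exact: integr_cst.
rewrite ExB//; last exact: integr_cst.
rewrite Ex_cst (Ex_exp_sqr_normal a0) /lambda -/a.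
by field; rewrite !gt_eqF//; nra.
Qed.

(** The bounded functions [f n] tend to [x ^+ 2] from below and have an
  explicit expectation by [Ex_exp_sqr_normal]. Their expectations first bound
  the truncations of [x ^+ 2], which yields integrability, and then give the
  value by dominated convergence. *)
Lemma std_normal_sqr : integr gamma (fun x => x ^+ 2) /\ Ex gamma (fun x => x ^+ 2) = 1.
Proof.
have msq : measurable_fun [set: measurableTypeR R] (fun x : R => x ^+ 2).
  exact: measurable_funX.
have if_ n : integr gamma (f n) := integr_bounded gamma (mf n) (f_bounded n).
have isq : integr gamma (fun x => x ^+ 2).
  apply: (integr_truncation (C := 1)) => // [x|M]; first exact: sqr_ge0.
  have bound n : Ex gamma (fun x => Num.min (x ^+ 2) M%:R) <= 1 + lambda n * M%:R / 2.
    have imin : integr gamma (fun x => Num.min (x ^+ 2) M%:R).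
      apply: (@integr_bounded _ _ _ _ _ M%:R) => [|w]; first exact: measurable_minr.
      by rewrite ger0_norm ?ge_min ?lexx ?orbT// le_min sqr_ge0 ler0n.
    have l0 := lambda_gt0 n.
    have c0 : 0 <= 1 + lambda n * M%:R / 2 by have := ler0n R M; nra.
    apply: (@le_trans _ _ (Ex gamma (fun x => (1 + lambda n * M%:R / 2) * f n x))).
      apply: le_Ex => // [|x]; first exact: integrZ.
      apply: (@le_trans _ _ ((1 + lambda n * M%:R / 2) *
        (x ^+ 2 / (1 + lambda n * x ^+ 2 / 2)))); last by rewrite ler_wpM2l.
      have x0 := sqr_ge0 x; have M0 := ler0n R M.
      rewrite mulrA ler_pdivlMr; last by nra.
      case: (leP (x ^+ 2) M%:R) => xM; last by nra.
      have : 0 <= lambda n * (x ^+ 2 * (M%:R - x ^+ 2)).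
        by rewrite mulr_ge0 ?(ltW l0)// mulr_ge0// subr_ge0.
      by move: (x ^+ 2) => y; lra.
    rewrite ExZ// ler_piMr// Ex_f.
    have a0 : 0 < n.+1%:R^-1 :> R by rewrite invr_gt0.
    move: (n.+1%:R^-1) a0 => a a0.
    have d0 : 0 < (1 + a) * (2 + a) by apply: mulr_gt0; lra.
    by rewrite (ler_pdivrMr _ _ d0) mul1r; nra.
  have cvg1 : 1 + lambda n * M%:R / 2 @[n --> \oo] --> (1 + 0 * M%:R / 2 : R).
    by apply: cvgD; [exact: cvg_cst|apply: cvgMl; exact: cvgMl].
  rewrite [leRHS](_ : 1 = 1 + 0 * M%:R / 2); last by ring.
  rewrite -(cvg_lim _ cvg1)//; apply: limr_ge; first exact: cvgP cvg1.
  by near=> n; exact: bound.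
split=> //.
have lim1 : Ex gamma (f n) @[n --> \oo] --> Ex gamma (fun x => x ^+ 2).
  apply: (@Ex_dominated _ _ _ gamma f (fun x => x ^+ 2) (fun x => x ^+ 2)) => // [x|n x]; last first.
    by rewrite ger0_norm.
  have lo : x ^+ 2 / (1 + lambda n * x ^+ 2 / 2) @[n --> \oo] --> x ^+ 2.
    rewrite [X in _ --> X](_ : _ = x ^+ 2 / (1 + 0 * x ^+ 2 / 2)); last by field.
    apply: cvgMr; apply: cvgV; first by rewrite !mul0r addr0 oner_neq0.
    by apply: cvgD; [exact: cvg_cst|apply: cvgMl; exact: cvgMl].
  apply: (squeeze_cvgr _ lo (cvg_cst _)).
  by near=> n; rewrite f_ge f_le.
have lim2 : Ex gamma (f n) @[n --> \oo] --> (1 : R).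
  rewrite (funext Ex_f).
  have h : n.+1%:R^-1 @[n --> \oo] --> (0 : R) by exact: cvg_harmonic.
  rewrite [X in _ --> X](_ : 1 = 2 / ((1 + 0) * (2 + 0)) :> R); last by field.
  apply: cvgMr; apply: cvgV; first by rewrite !addr0 mul1r.
  by apply: cvgM; apply: cvgD => //; exact: cvg_cst.
exact: (cvg_unique _ lim1 lim2).
Unshelve. all: by end_near. Qed.

End normal_variance.

(** * Lindeberg's central limit theorem *)

Section lindeberg_tail.
Context {d : measure_display} {T : measurableType d} {R : realType}.
Variables (P : probability T R) (Y : T -> R).
Hypotheses (mY : measurable_fun [set: T] Y) (iY2 : integr P (fun w => Y w ^+ 2)).

(** Lindeberg's function for weights at most [delta]; the factor [Num.min 1 _]
  is a continuous substitute for the indicator of large values. *)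
Definition lindeberg_tail (delta : R) : R :=
  Ex P (fun w => Y w ^+ 2 * Num.min 1 (delta * `|Y w|)).

Let mtail delta : measurable_fun [set: T] (fun w => Y w ^+ 2 * Num.min 1 (delta * `|Y w|)).
Proof.
apply: measurable_funM; first exact: measurable_funX.
apply: measurable_minr => //; apply: measurable_funM => //.
exact: measurableT_comp.
Qed.

Let tail_norm delta w : 0 <= delta ->
  `|Y w ^+ 2 * Num.min 1 (delta * `|Y w|)| <= Y w ^+ 2.
Proof.
move=> d0; have y0 : 0 <= delta * `|Y w| by rewrite mulr_ge0.
rewrite normrM ger0_norm ?sqr_ge0// ler_piMr ?sqr_ge0// ger0_norm ?ge_min ?lexx//.
by rewrite le_min ler01.
Qed.

Lemma integr_lindeberg_tail delta : 0 <= delta ->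
  integr P (fun w => Y w ^+ 2 * Num.min 1 (delta * `|Y w|)).
Proof.
move=> d0; apply: (integr_le _ iY2) => // w.
by rewrite (le_trans (tail_norm w d0))// ler_norm.
Qed.

Lemma lindeberg_tail_ge0 delta : 0 <= delta -> 0 <= lindeberg_tail delta.
Proof.
move=> d0; apply: Ex_ge0 => w; rewrite mulr_ge0 ?sqr_ge0// le_min ler01/=.
exact: mulr_ge0.
Qed.

Lemma le_lindeberg_tail delta delta' : 0 <= delta -> delta <= delta' ->
  lindeberg_tail delta <= lindeberg_tail delta'.
Proof.
move=> d0 dd'; apply: le_Ex => [||w].
- exact: integr_lindeberg_tail.
- by apply: integr_lindeberg_tail; exact: le_trans dd'.
by rewrite ler_wpM2l ?sqr_ge0// le_min !ge_min lexx ler_wpM2r ?orbT.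
Qed.

(** Dominated convergence, the integrand being at most the integrable [Y ^+ 2]. *)
Lemma lindeberg_tail_small (eps : R) : 0 < eps ->
  exists2 delta, 0 < delta & lindeberg_tail delta <= eps.
Proof.
move=> e0.
have h : n.+1%:R^-1 @[n --> \oo] --> (0 : R) by exact: cvg_harmonic.
have cvgL : lindeberg_tail n.+1%:R^-1 @[n --> \oo] --> Ex P (fun=> 0).
  apply: (@Ex_dominated _ _ _ P (fun n w => Y w ^+ 2 * Num.min 1 (n.+1%:R^-1 * `|Y w|))
    _ (fun w => Y w ^+ 2)) => // [w|n w]; last by apply: tail_norm; rewrite invr_ge0.
  rewrite -[X in _ --> X](mulr0 (Y w ^+ 2)); apply: cvgMr.
  have hY : n.+1%:R^-1 * `|Y w| @[n --> \oo] --> (0 : R).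
    by rewrite -[X in _ --> X](mul0r `|Y w|); exact: cvgMl.
  apply: (squeeze_cvgr _ (cvg_cst 0) hY).
  by near=> n; rewrite le_min ler01 ge_min lexx orbT /= mulr_ge0.
rewrite Ex_cst in cvgL.
have [n _ hn] := cvgr_le 0 cvgL _ e0.
exists n.+1%:R^-1; first by rewrite invr_gt0.
exact: (hn n (leqnn n)).
Unshelve. all: by end_near. Qed.

End lindeberg_tail.

Section lindeberg_clt.
Context {d : measure_display} {T : measurableType d} {R : realType}.
Variable P : probability T R.
Context {d' : measure_display} {T' : measurableType d'}.
Variable X : nat -> T -> T'.
Hypothesis mX : forall a, measurable_fun [set: T] (X a).
Hypothesis indX : forall (n : nat) (A : nat -> set T'),
  (forall a, measurable (A a)) ->
  P (\bigcap_(a < n) (X a @^-1` A a)) = (\prod_(a < n) P (X a @^-1` A a))%E.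
Hypothesis identX : forall a (A : set T'), measurable A ->
  P (X 0%N @^-1` A) = P (X a @^-1` A).

Lemma Ex_ident (h : T' -> R) a : measurable_fun [set: T'] h ->
  integr P (fun w => h (X 0%N w)) ->
  integr P (fun w => h (X a w)) /\
  Ex P (fun w => h (X a w)) = Ex P (fun w => h (X 0%N w)).
Proof.
move=> mh ih.
by have [i <-] := Ex_same_law (mX 0) (mX a) (identX a) mh ih.
Qed.

Variable N : T' -> R.
Hypotheses (mN : measurable_fun [set: T'] N) (N0 : forall x, 0 <= N x).
Hypothesis iN2 : integr P (fun w => N (X 0%N w) ^+ 2).

Let LN := lindeberg_tail P (fun w => N (X 0%N w)).
Let LG := lindeberg_tail std_normal (fun x : R => x).
Let D := Ex P (fun w => N (X 0%N w) ^+ 2).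

Section row.
Variables (u : nat -> T' -> R) (k v : nat -> R) (n : nat) (delta : R).
Hypothesis mu : forall a, measurable_fun [set: T'] (u a).
Hypotheses (k0 : forall a, 0 <= k a) (uk : forall a x, `|u a x| <= k a * N x).
Hypothesis u_mean : forall a, Ex P (fun w => u a (X a w)) = 0.
Hypothesis u_var : forall a, Ex P (fun w => u a (X a w) ^+ 2) = v a.
Hypothesis delta0 : 0 <= delta.
Hypothesis kdelta : forall a, (a < n)%N -> k a <= delta.

Let muX a : measurable_fun [set: T] (fun w => u a (X a w)).
Proof. exact: measurableT_comp. Qed.

Let iNX2 a : integr P (fun w => N (X a w) ^+ 2) /\ Ex P (fun w => N (X a w) ^+ 2) = D.
Proof. by apply: (@Ex_ident (fun x => N x ^+ 2)) => //; exact: measurable_funX. Qed.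

Let iu2 a : integr P (fun w => u a (X a w) ^+ 2).
Proof.
apply: (integr_le _ (integrZ (k a ^+ 2) (iNX2 a).1)) => [|w].
  exact: measurable_funX.
rewrite -exprMn !normrX lerXn2r ?nnegrE//.
by rewrite (le_trans (uk _ _))// ler_norm.
Qed.

Let iu a : integr P (fun w => u a (X a w)).
Proof. exact: integr_of_sqr. Qed.

Let v_ge0 a : 0 <= v a.
Proof. by rewrite -u_var; apply: Ex_ge0 => w; exact: sqr_ge0. Qed.

Let v_le a : v a <= k a ^+ 2 * D.
Proof.
have [i2 E2] := iNX2 a.
rewrite -u_var -E2 -ExZ//; apply: le_Ex => // [|w]; first exact: integrZ.
rewrite -exprMn -(real_normK (num_real (u a _))) lerXn2r ?nnegrE//.
by rewrite mulr_ge0.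
Qed.

Let ilind a : integr P (fun w => lindeberg_fun (u a (X a w))).
Proof.
apply: (integr_le _ (iu2 a)) => [|w].
  apply: measurable_funM; first exact: measurable_funX.
  by apply: measurable_minr => //; exact: measurableT_comp.
by rewrite ger0_norm ?lindeberg_fun_ge0// (le_trans (lindeberg_fun_le _))// ler_norm.
Qed.

Let tailX a : (a < n)%N -> Ex P (fun w => lindeberg_fun (u a (X a w))) <= k a ^+ 2 * LN delta.
Proof.
move=> an; have [iT ET] : integr P (fun w => N (X a w) ^+ 2 * Num.min 1 (delta * `|N (X a w)|)) /\
    Ex P (fun w => N (X a w) ^+ 2 * Num.min 1 (delta * `|N (X a w)|)) = LN delta.
  apply: (@Ex_ident (fun x => N x ^+ 2 * Num.min 1 (delta * `|N x|))).
    apply: measurable_funM; first exact: measurable_funX.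
    apply: measurable_minr => //; apply: measurable_funM => //.
    exact: measurableT_comp.
  by apply: (integr_lindeberg_tail _ iN2) => //; exact: measurableT_comp.
rewrite -ET -ExZ//; apply: le_Ex => [||w].
- exact: ilind.
- exact: integrZ.
have uN : `|u a (X a w)| <= `|k a * N (X a w)| by rewrite (le_trans (uk _ _))// ler_norm.
rewrite (le_trans (le_lindeberg_fun uN))// /lindeberg_fun exprMn -mulrA.
rewrite ler_wpM2l ?sqr_ge0// ler_wpM2l ?sqr_ge0// normrM (ger0_norm (k0 a)).
by rewrite le_min !ge_min lexx ler_wpM2r ?orbT// kdelta.
Qed.

Let Esin_le a : (a < n)%N -> `|Ex P (fun w => sin (u a (X a w)))| <= 2 * (k a ^+ 2 * LN delta).
Proof.
move=> an; have isin := integr_sin P (muX a).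
rewrite -[X in `|X|]subr0 -(u_mean a) -ExB//.
apply: (@le_trans _ _ (Ex P (fun w => 2 * lindeberg_fun (u a (X a w))))).
  apply: norm_Ex_le => [||w]; [exact: integrB|exact: integrZ|].
  exact: sin_sub_lindeberg.
by rewrite ExZ// ler_wpM2l// tailX.
Qed.

Let Ecos_le a : (a < n)%N ->
  `|Ex P (fun w => cos (u a (X a w))) - (1 - v a / 2)| <= 3 * (k a ^+ 2 * LN delta).
Proof.
move=> an; have icos := integr_cos P (muX a).
have i2 := integrZ 2^-1 (iu2 a).
have -> : 1 - v a / 2 = Ex P (fun w => 1 - 2^-1 * u a (X a w) ^+ 2).
  by rewrite ExB ?Ex_cst ?ExZ ?u_var ?[_ / 2]mulrC//; exact: integr_cst.
have i3 := integrB (integr_cst P 1) i2.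
rewrite -ExB//.
apply: (@le_trans _ _ (Ex P (fun w => 3 * lindeberg_fun (u a (X a w))))).
  apply: norm_Ex_le => [||w]; [exact: integrB|exact: integrZ|].
  by have := cos_sub_lindeberg (u a (X a w)); rewrite [_ / 2]mulrC.
by rewrite ExZ// ler_wpM2l// tailX.
Qed.

Let LG_le a : (a < n)%N ->
  `|normal_char (Num.sqrt (v a)) - (1 - v a / 2)| <=
  3 * (k a ^+ 2 * (D * LG (delta * Num.sqrt D))).
Proof.
move=> an; set s := Num.sqrt (v a); have s2 : s ^+ 2 = v a by rewrite sqr_sqrtr.
have [ix2 Ex2] := @std_normal_sqr R.
have s0 : 0 <= s by exact: sqrtr_ge0.
have D0 : 0 <= D by apply: Ex_ge0 => w; exact: sqr_ge0.
have sD : s <= delta * Num.sqrt D.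
  have -> : delta * Num.sqrt D = Num.sqrt (delta ^+ 2 * D).
    by rewrite sqrtrM ?sqr_ge0// sqrtr_sqr ger0_norm.
  rewrite ler_wsqrtr// (le_trans (v_le a))// ler_wpM2r// lerXn2r ?nnegrE//.
  exact: kdelta.
have mid : measurable_fun [set: measurableTypeR R] (fun x : R => x) by [].
have icos : integr std_normal (fun x => cos (s * x)).
  by apply: integr_cos; exact: measurable_funM.
have i2 := integrZ (v a / 2) ix2.
have -> : 1 - v a / 2 = Ex std_normal (fun x => 1 - v a / 2 * x ^+ 2).
  by rewrite ExB ?Ex_cst ?ExZ ?Ex2 ?mulr1//; exact: integr_cst.
have i3 := integrB (integr_cst std_normal 1) i2.
have itail : integr std_normal (fun x => x ^+ 2 * Num.min 1 (s * `|x|)).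
  exact: integr_lindeberg_tail.
rewrite /normal_char -ExB//.
apply: (@le_trans _ _ (Ex std_normal (fun x => (3 * v a) * (x ^+ 2 * Num.min 1 (s * `|x|))))).
  apply: norm_Ex_le => [||x]; [exact: integrB|exact: integrZ|].
  have := cos_sub_lindeberg (s * x).
  rewrite /lindeberg_fun normrM (ger0_norm s0) exprMn s2.
  have -> : v a * x ^+ 2 / 2 = v a / 2 * x ^+ 2 by ring.
  by rewrite -!mulrA.
rewrite ExZ// -mulrA ler_wpM2l// -/(lindeberg_tail _ _ s) mulrA ler_pM//.
  exact: lindeberg_tail_ge0.
exact: le_lindeberg_tail.
Qed.

(** Replacing each summand by a normal variable of the same variance costs [3]
  tails for the cosine and twice [2] for the sine on the side of the summand,
  and [3] tails of the normal law. *)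
Lemma lindeberg_row :
  `|Ex P (fun w => cos (\sum_(a < n) u a (X a w))) -
    normal_char (Num.sqrt (\sum_(a < n) v a))| +
  `|Ex P (fun w => sin (\sum_(a < n) u a (X a w)))| <=
  (\sum_(a < n) k a ^+ 2) * (7 * LN delta + 3 * (D * LG (delta * Num.sqrt D))).
Proof.
rewrite -prod_normal_char//.
have h1 := Ex_cos_sum_le mX indX mu n (fun a => norm_normal_char_le1 (Num.sqrt (v a))).
have h2 := Ex_sin_sum_le mX indX mu n.
apply: (le_trans (lerD h1 h2)); rewrite -big_split /= mulr_suml.
apply: ler_sum => a _; have an := ltn_ord a.
have e1 := Ecos_le an; have e2 := Esin_le an; have e3 := LG_le an.
have e4 := ler_distD (1 - v a / 2) (Ex P (fun w => cos (u a (X a w))))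
  (normal_char (Num.sqrt (v a))).
move: e4; rewrite [`|1 - v a / 2 - _|]distrC; lra.
Qed.

End row.

Lemma normal_char_cvg (s : nat -> R) (l : R) : s n @[n --> \oo] --> l ->
  normal_char (s n) @[n --> \oo] --> normal_char l.
Proof.
move=> sl; apply: (@Ex_dominated _ _ _ std_normal (fun n x => cos (s n * x))
  (fun x => cos (l * x)) (fun=> 1)) => [n|x||n x].
- by apply: measurable_cos; exact: measurable_funM.
- apply: continuous_cvg; first exact: continuous_cos.
  exact: cvgMl.
- exact: integr_cst.
- exact: cos_max.
Qed.

(** The bound of [lindeberg_row] is small once the weights are, since the sum
  of the squared weights stays bounded and both tails vanish with [delta]. *)
Lemma lindeberg_clt (u : nat -> nat -> T' -> R) (k v : nat -> nat -> R) (M s2 : R) :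
  (forall n a, measurable_fun [set: T'] (u n a)) ->
  (forall n a, 0 <= k n a) -> (forall n a x, `|u n a x| <= k n a * N x) ->
  (forall n a, Ex P (fun w => u n a (X a w)) = 0) ->
  (forall n a, Ex P (fun w => u n a (X a w) ^+ 2) = v n a) ->
  (\forall n \near \oo, \sum_(a < n) k n a ^+ 2 <= M) ->
  (forall delta, 0 < delta -> \forall n \near \oo, forall a, (a < n)%N -> k n a <= delta) ->
  \sum_(a < n) v n a @[n --> \oo] --> s2 ->
  Ex P (fun w => cos (\sum_(a < n) u n a (X a w))) @[n --> \oo] -->
    normal_char (Num.sqrt s2) /\
  Ex P (fun w => sin (\sum_(a < n) u n a (X a w))) @[n --> \oo] --> (0 : R).
Proof.
move=> mu k0 uk u_mean u_var kM ksmall vs2.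
pose e1 n := Ex P (fun w => cos (\sum_(a < n) u n a (X a w))) -
    normal_char (Num.sqrt (\sum_(a < n) v n a)).
pose e2 n := Ex P (fun w => sin (\sum_(a < n) u n a (X a w))).
have D0 : 0 <= D by apply: Ex_ge0 => w; exact: sqr_ge0.
have small : forall eps, 0 < eps -> \forall n \near \oo, `|e1 n| + `|e2 n| <= eps.
  move=> eps eps0; pose C := (`|M| + 1) * (7 + 3 * D).
  have C0 : 0 < C by apply: mulr_gt0; [have := normr_ge0 M; lra|lra].
  have ep0 : 0 < eps / C by rewrite divr_gt0.
  have mNX : measurable_fun [set: T] (fun w => N (X 0%N w)) by exact: measurableT_comp.
  have [d1 d10 Hd1] := lindeberg_tail_small mNX iN2 ep0.
  have [ix2 _] := @std_normal_sqr R.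
  have mid : measurable_fun [set: measurableTypeR R] (fun x : R => x) by [].
  have [d2 d20 Hd2] := lindeberg_tail_small mid ix2 ep0.
  have sD : 0 < Num.sqrt D + 1 by have := sqrtr_ge0 D; lra.
  pose delta := Num.min d1 (d2 / (Num.sqrt D + 1)).
  have delta0 : 0 < delta by rewrite lt_min d10 divr_gt0.
  have LN1 : LN delta <= eps / C.
    apply: le_trans Hd1; apply: le_lindeberg_tail => //; first exact: ltW.
    by rewrite ge_min lexx.
  have LG1 : LG (delta * Num.sqrt D) <= eps / C.
    apply: le_trans Hd2; apply: le_lindeberg_tail => //.
      by rewrite mulr_ge0 ?sqrtr_ge0 ?ltW.
    have dd2 : delta <= d2 / (Num.sqrt D + 1) by rewrite ge_min lexx orbT.
    move: dd2; rewrite ler_pdivlMr// => dd2; apply: le_trans dd2.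
    by rewrite ler_wpM2l ?ltW// ltrDl.
  near=> n.
  have row : `|e1 n| + `|e2 n| <= (\sum_(a < n) k n a ^+ 2) *
      (7 * LN delta + 3 * (D * LG (delta * Num.sqrt D))).
    apply: lindeberg_row => //; first exact: ltW.
    by near: n; exact: ksmall.
  apply: (le_trans row).
  apply: (@le_trans _ _ ((`|M| + 1) * ((7 + 3 * D) * (eps / C)))); last first.
    by rewrite mulrA -/C mulrCA divff ?mulr1// gt_eqF.
  apply: ler_pM.
  - by apply: sumr_ge0 => a _; exact: sqr_ge0.
  - rewrite addr_ge0// ?mulr_ge0// ?lindeberg_tail_ge0//; first exact: ltW.
    by rewrite mulr_ge0 ?sqrtr_ge0 ?ltW.
  - apply: (@le_trans _ _ M); first by near: n; exact: kM.
    by have := ler_norm M; lra.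
  - have : D * LG (delta * Num.sqrt D) <= D * (eps / C) by rewrite ler_wpM2l.
    lra.
have e1_cvg : e1 n @[n --> \oo] --> (0 : R).
  apply/cvgr0Pnorm_le => eps /small; apply: filterS => n.
  by apply: le_trans; rewrite lerDl.
have e2_cvg : e2 n @[n --> \oo] --> (0 : R).
  apply/cvgr0Pnorm_le => eps /small; apply: filterS => n.
  by apply: le_trans; rewrite lerDr.
split=> //.
have sq : Num.sqrt (\sum_(a < n) v n a) @[n --> \oo] --> Num.sqrt s2.
  by apply: continuous_cvg => //; exact: sqrt_continuous.
have E : (fun n => Ex P (fun w => cos (\sum_(a < n) u n a (X a w)))) =
    (fun n => e1 n + normal_char (Num.sqrt (\sum_(a < n) v n a))).
  by apply/funext => n; rewrite /e1 subrK.
by rewrite E -[X in _ --> X]add0r; exact: (cvgD e1_cvg (normal_char_cvg sq)).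
Unshelve. all: by end_near. Qed.

End lindeberg_clt.

(** * Bernstein weights and trigonometric polynomials *)

Section bernstein.
Context {R : realType}.
Implicit Types (y c : R) (h : nat -> R).

(** The binomial probability of [k] successes in [n] trials of success
  probability [y]. *)
Definition bernstein_weight (n k : nat) y : R := 'C(n, k)%:R * y ^+ k * (1 - y) ^+ (n - k).

Lemma bernstein_weight_ge0 n k y : 0 <= y <= 1 -> 0 <= bernstein_weight n k y.
Proof.
by move=> /andP[y0 y1]; rewrite !mulr_ge0// exprn_ge0// subr_ge0.
Qed.

(** Pascal's rule: conditioning on the last trial. *)
Lemma bernstein_sumS n h y :
  \sum_(k < n.+2) h k * bernstein_weight n.+1 k y =
  \sum_(k < n.+1) (y * h k.+1 + (1 - y) * h k) * bernstein_weight n k y.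
Proof.
have low : \sum_(k < n.+1) (1 - y) * h k * bernstein_weight n k y =
    h 0%N * bernstein_weight n.+1 0 y +
    \sum_(k < n.+1) h k.+1 * ('C(n, k.+1)%:R * y ^+ k.+1 * (1 - y) ^+ (n - k)).
  transitivity (\sum_(k < n.+2) h k * ('C(n, k)%:R * y ^+ k * (1 - y) ^+ (n.+1 - k))).
    rewrite [RHS]big_ord_recr /= bin_small// !mul0r mulr0 addr0.
    apply: eq_bigr => k _; rewrite /bernstein_weight subSn; last by rewrite -ltnS.
    by rewrite exprS; ring.
  rewrite big_ord_recl /= /bernstein_weight !bin0 subn0; congr (_ + _).
under [RHS]eq_bigr do rewrite mulrDl.
rewrite big_split /= low addrCA big_ord_recl /=; congr (_ + _).
rewrite -big_split /=; apply: eq_bigr => k _.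
by rewrite /bump /= add1n /bernstein_weight binS natrD subSS exprS; ring.
Qed.

Lemma bernstein_sum1 n y : \sum_(k < n.+1) bernstein_weight n k y = 1.
Proof.
elim: n => [|n IH].
  by rewrite big_ord1 /bernstein_weight bin0 subnn !expr0 !mulr1.
have := bernstein_sumS n (fun=> 1) y; under eq_bigr do rewrite mul1r.
by move=> ->; under eq_bigr do rewrite !mulr1 subrKC mul1r.
Qed.

(** Mean and variance of the binomial law; the arbitrary centre [c] lets the
  induction shift it. *)
Lemma bernstein_sum_sqr n y c : \sum_(k < n.+1) (k%:R - c) ^+ 2 * bernstein_weight n k y =
  (n%:R * y - c) ^+ 2 + n%:R * (y * (1 - y)).
Proof.
elim: n c => [|n IH] c.
  by rewrite big_ord1 /= /bernstein_weight bin0 subnn !expr0; ring.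
rewrite (bernstein_sumS n (fun k => (k%:R - c) ^+ 2)).
transitivity (\sum_(k < n.+1) ((k%:R - (c - y)) ^+ 2 * bernstein_weight n k y +
    y * (1 - y) * bernstein_weight n k y)).
  by apply: eq_bigr => k _; rewrite -natr1; ring.
by rewrite big_split /= IH -mulr_sumr bernstein_sum1 -natr1; ring.
Qed.

Lemma bernstein_variance_le n y : 0 <= y <= 1 ->
  \sum_(k < n.+2) (k%:R / n.+1%:R - y) ^+ 2 * bernstein_weight n.+1 k y <= n.+1%:R^-1.
Proof.
move=> /andP[y0 y1]; have n0 : n.+1%:R != 0 :> R by rewrite pnatr_eq0.
have -> : \sum_(k < n.+2) (k%:R / n.+1%:R - y) ^+ 2 * bernstein_weight n.+1 k y =
    n.+1%:R^-1 ^+ 2 *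
    \sum_(k < n.+2) (k%:R - n.+1%:R * y) ^+ 2 * bernstein_weight n.+1 k y.
  rewrite mulr_sumr; apply: eq_bigr => k _.
  have -> : k%:R / n.+1%:R - y = n.+1%:R^-1 * (k%:R - n.+1%:R * y).
    by rewrite mulrBr mulrA mulVf// mul1r mulrC.
  by rewrite exprMn -mulrA.
rewrite bernstein_sum_sqr subrr expr0n /= add0r expr2 -mulrA [_^-1 * (n.+1%:R * _)]mulrA.
rewrite mulVf// mul1r ler_piMr ?invr_ge0//; nra.
Qed.

End bernstein.

Section trig_polynomials.
Context {R : realType} {N : nat}.
Implicit Types (F G : 'rV[R]_N -> R) (t x : 'rV[R]_N).

Definition dotv t x : R := \sum_j t 0 j * x 0 j.

(** Only linear combinations are constructors, because convergence of
  expectations passes through them; closure under products is [trig_polyM],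
  from the product-to-sum formulas. *)
Inductive trig_poly : ('rV[R]_N -> R) -> Prop :=
| trig_poly_cos t : trig_poly (fun x => cos (dotv t x))
| trig_poly_sin t : trig_poly (fun x => sin (dotv t x))
| trig_polyD F G : trig_poly F -> trig_poly G -> trig_poly (fun x => F x + G x)
| trig_polyZ c F : trig_poly F -> trig_poly (fun x => c * F x).

Lemma dotvD t t' x : dotv (t + t') x = dotv t x + dotv t' x.
Proof. by rewrite /dotv -big_split /=; apply: eq_bigr => j _; rewrite mxE mulrDl. Qed.

Lemma dotvN t x : dotv (- t) x = - dotv t x.
Proof. by rewrite /dotv -sumrN; apply: eq_bigr => j _; rewrite mxE mulNr. Qed.

Lemma trig_poly_cst c : trig_poly (fun=> c).
Proof.
have -> : (fun=> c) = (fun x : 'rV[R]_N => c * cos (dotv 0 x)).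
  apply/funext => x; rewrite /dotv big1 ?cos0 ?mulr1// => j _.
  by rewrite mxE mul0r.
exact/trig_polyZ/trig_poly_cos.
Qed.

Lemma trig_poly_sum (I : Type) (s : seq I) (F : I -> 'rV[R]_N -> R) :
  (forall i, trig_poly (F i)) -> trig_poly (fun x => \sum_(i <- s) F i x).
Proof.
move=> tF; elim: s => [|i s IH].
  by under eq_fun do rewrite big_nil; exact: trig_poly_cst.
by under eq_fun do rewrite big_cons; exact: trig_polyD.
Qed.

Lemma trig_polyM F G : trig_poly F -> trig_poly G -> trig_poly (fun x => F x * G x).
Proof.
move=> tF tG; elim: tF => [t|t|F1 F2 _ t1 _ t2|c F1 _ t1]; last 2 first.
- by under eq_fun do rewrite mulrDl; exact: trig_polyD.
- by under eq_fun do rewrite -mulrA; exact: trig_polyZ.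
- elim: tG => [s|s|G1 G2 _ t1 _ t2|c G1 _ t1].
  + have -> : (fun x => cos (dotv t x) * cos (dotv s x)) = fun x =>
        2^-1 * cos (dotv (t - s) x) + 2^-1 * cos (dotv (t + s) x).
      by apply/funext => x; rewrite !dotvD dotvN cosB cosD; field.
    by apply: trig_polyD; apply: trig_polyZ; exact: trig_poly_cos.
  + have -> : (fun x => cos (dotv t x) * sin (dotv s x)) = fun x =>
        2^-1 * sin (dotv (t + s) x) + - 2^-1 * sin (dotv (t - s) x).
      by apply/funext => x; rewrite !dotvD dotvN sinB sinD; field.
    by apply: trig_polyD; apply: trig_polyZ; exact: trig_poly_sin.
  + by under eq_fun do rewrite mulrDr; exact: trig_polyD.
  + by under eq_fun do rewrite mulrCA; exact: trig_polyZ.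
- elim: tG => [s|s|G1 G2 _ t1 _ t2|c G1 _ t1].
  + have -> : (fun x => sin (dotv t x) * cos (dotv s x)) = fun x =>
        2^-1 * sin (dotv (t - s) x) + 2^-1 * sin (dotv (t + s) x).
      by apply/funext => x; rewrite !dotvD dotvN sinB sinD; field.
    by apply: trig_polyD; apply: trig_polyZ; exact: trig_poly_sin.
  + have -> : (fun x => sin (dotv t x) * sin (dotv s x)) = fun x =>
        2^-1 * cos (dotv (t - s) x) + - 2^-1 * cos (dotv (t + s) x).
      by apply/funext => x; rewrite !dotvD dotvN cosB cosD; field.
    by apply: trig_polyD; apply: trig_polyZ; exact: trig_poly_cos.
  + by under eq_fun do rewrite mulrDr; exact: trig_polyD.
  + by under eq_fun do rewrite mulrCA; exact: trig_polyZ.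
Qed.

Lemma trig_poly_prod (I : Type) (s : seq I) (F : I -> 'rV[R]_N -> R) :
  (forall i, trig_poly (F i)) -> trig_poly (fun x => \prod_(i <- s) F i x).
Proof.
move=> tF; elim: s => [|i s IH].
  by under eq_fun do rewrite big_nil; exact: trig_poly_cst.
by under eq_fun do rewrite big_cons; exact: trig_polyM.
Qed.

Lemma trig_polyX F n : trig_poly F -> trig_poly (fun x => F x ^+ n).
Proof.
move=> tF; elim: n => [|n IH].
  by under eq_fun do rewrite expr0; exact: trig_poly_cst.
by under eq_fun do rewrite exprS; exact: trig_polyM.
Qed.

Lemma trig_poly_sin_coord (j : 'I_N) c : trig_poly (fun x => sin (c * x 0 j)).
Proof.
have -> : (fun x : 'rV[R]_N => sin (c * x 0 j)) = fun x => sin (dotv (c *: delta_mx 0 j) x).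
  apply/funext => x; rewrite /dotv (bigD1 j)//= big1 ?addr0 ?mxE ?eqxx ?mulr1//.
  by move=> i ij; rewrite !mxE eqxx (negbTE ij) mulr0 mul0r.
exact: trig_poly_sin.
Qed.

Lemma trig_poly_bernstein F n k : trig_poly F ->
  trig_poly (fun x => bernstein_weight n k (F x)).
Proof.
move=> tF; apply: trig_polyM; last first.
  apply: trig_polyX.
  have -> : (fun x => 1 - F x) = fun x => 1 + -1 * F x.
    by apply/funext => x; rewrite mulN1r.
  by apply: trig_polyD; [exact: trig_poly_cst|exact: trig_polyZ].
by apply: trig_polyM; [exact: trig_poly_cst|exact: trig_polyX].
Qed.

End trig_polynomials.

(** * Approximation by trigonometric polynomials on cubes *)

Section approximation.
Context {R : realType} {N : nat}.
Variables (f : 'rV[R]_N -> R) (K : R).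
Hypotheses (cf : continuous f) (K0 : 0 < K).

Let node (z : 'I_N -> R) : 'rV[R]_N := \row_j (2 * K * asin (z j)).

Lemma row_ball (x y : 'rV[R]_N) (e : R) : 0 < e ->
  (forall j, `|x 0 j - y 0 j| < e) -> ball x e y.
Proof. by move=> e0 xy; split=> // i j; rewrite ord1; exact: xy. Qed.

(** Uniform continuity on the compact cube, expressed in the variables [sin
  (x_j / 2K)]; the factor 2 keeps them inside the open interval from -1 to 1,
  the domain of continuity of the arc sine. *)
Lemma uniform_asin_nodes (eps : R) : 0 < eps ->
  exists2 delta, 0 < delta & forall x : 'rV[R]_N, (forall j, `|x 0 j| <= K) ->
    forall z : 'I_N -> R, (forall j, `|sin (x 0 j / (2 * K)) - z j| < delta) ->
      `|f x - f (node z)| <= eps.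
Proof.
move=> e0; pose cube := [set x : 'rV[R]_N | forall j, `[- K, K]%classic (x 0 j)].
have cube_compact : compact cube.
  by apply: (@rV_compact _ N (fun=> `[- K, K]%classic)) => _; exact: segment_compact.
pose good (delta : R) (x : 'rV[R]_N) := forall z : 'I_N -> R,
  (forall j, `|sin (x 0 j / (2 * K)) - z j| < delta) -> `|f x - f (node z)| <= eps.
have /compact_near_coveringP/(_ R (0^'+) good _) := cube_compact.
have near_good x : cube x -> \forall x' \near x & delta \near (0 : R)^'+, good delta x'.
  move=> xcube; have xK j : `|x 0 j| <= K by rewrite ler_norml; have := xcube j; rewrite /= in_itv.
  pose z0 j : R := sin (x 0 j / (2 * K)).
  have K2 : 0 < 2 * K by rewrite mulr_gt0.
  have xK1 j : `|x 0 j / (2 * K)| <= 2^-1.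
    rewrite normrM [`|(2 * K)^-1|]gtr0_norm ?invr_gt0// ler_pdivrMr//.
    by rewrite mulrA mulVf// mul1r.
  have z0_lt1 j : -1 < z0 j < 1.
    by rewrite -ltr_norml (le_lt_trans (norm_sin_le _))// (le_lt_trans (xK1 j))//; lra.
  have node_z0 j : 2 * K * asin (z0 j) = x 0 j.
    rewrite sinK; first by rewrite mulrC divfK// gt_eqF.
    rewrite in_itv /= -ler_norml (le_trans (xK1 j))//.
    by have := @pihalf_ge1 R; lra.
  have e4 : 0 < eps / 2 by rewrite divr_gt0.
  have cfx : f z @[z --> x] --> f x by exact: cf.
  have /cvgrPdist_lt/(_ _ e4)/nbhs_ballP[eta /= eta0 Heta] := cfx.
  have [dl dl0 Hdl] : exists2 dl, 0 < dl & forall j s, `|z0 j - s| < dl ->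
      `|x 0 j - 2 * K * asin s| < eta.
    have cj j : \forall dl \near (0 : R)^'+, forall s, `|z0 j - s| < dl ->
        `|x 0 j - 2 * K * asin s| < eta.
      have casin : 2 * K * asin s @[s --> z0 j] --> x 0 j.
        by rewrite -(node_z0 j); apply: cvgMr; exact: continuous_asin.
      have /cvgrPdist_lt/(_ _ eta0)/nbhs_ballP[r /= r0 Hr] := casin.
      near=> dl => s sdl; apply: Hr; apply: (lt_le_trans sdl).
      by near: dl; exact: nbhs_right_le.
    have : \forall dl \near (0 : R)^'+, forall j, forall s, `|z0 j - s| < dl ->
        `|x 0 j - 2 * K * asin s| < eta by exact: filter_forall.
    move=> cjs; near (0:R)^'+ => dl; exists dl.
      by near: dl; exact: nbhs_right_gt.
    by near: dl.
  have dl2 : 0 < dl / 2 by rewrite divr_gt0.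
  exists (ball x (Num.min eta (2 * K * (dl / 2))), [set delta | delta < dl / 2]).
    split=> /=; last exact: nbhs_right_lt.
    by apply: nbhsx_ballx; rewrite lt_min eta0 mulr_gt0.
  move=> [x' delta] /= [[m0 xx'] ddl] z xz.
  have fx' : `|f x - f x'| < eps / 2.
    apply: Heta; split => // i j; apply: (lt_le_trans (xx' i j)).
    by rewrite ge_min lexx.
  have fz : `|f x - f (node z)| < eps / 2.
    apply: Heta; apply: row_ball => // j; rewrite mxE; apply: Hdl.
    have lip : `|z0 j - sin (x' 0 j / (2 * K))| < dl / 2.
      apply: (le_lt_trans (sin_lipschitz _ _)).
      rewrite -mulrBl normrM [`|(2 * K)^-1|]gtr0_norm ?invr_gt0// ltr_pdivrMr//.
      by rewrite mulrC; have := xx' 0 j; rewrite /ball /= lt_min => /andP[].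
    have := ler_distD (sin (x' 0 j / (2 * K))) (z0 j) (z j).
    have := xz j; move=> h1 h2; apply: (le_lt_trans h2).
    by rewrite [dl]splitr; apply: ltrD => //; exact: lt_trans ddl.
  apply: (le_trans (ler_distD (f x) _ _)); rewrite distrC [leRHS]splitr.
  by apply: lerD; exact: ltW.
move=> /(_ near_good) H.
near (0:R)^'+ => delta.
exists delta; first by near: delta; exact: nbhs_right_gt.
move=> x xK z xz.
have Hd : cube `<=` good delta by near: delta; exact: H.
apply: (Hd x _ z xz) => j /=.
by rewrite in_itv /= -ler_norml.
Unshelve. all: by end_near. Qed.

(** The map [x |-> (sin (x_j / 2K))_j] is injective on the cube with continuous
  inverse [node], so [f] is there a continuous function of these sines, to
  which the Bernstein operator applies. Its value is a convex combination of
  values of [f], at every point of the space: this gives the bound [C] outside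
  the cube too. *)
Lemma trig_poly_approx (C eps : R) : (forall x, `|f x| <= C) -> 0 < eps ->
  exists F, [/\ trig_poly F, forall x, `|F x| <= C &
    forall x : 'rV[R]_N, (forall j, `|x 0 j| <= K) -> `|F x - f x| <= eps].
Proof.
move=> fC e0; have e2 : 0 < eps / 2 by rewrite divr_gt0.
have [delta d0 Hd] := uniform_asin_nodes e2.
have C0 : 0 <= C by exact: le_trans (fC 0).
(* This degree makes the variance term below, [8 * C / delta ^+ 2 * (N%:R /
   n.+1%:R)], at most [eps / 2]. *)
pose n := Num.truncn (16 * C * N%:R / (delta ^+ 2 * eps)).
(* The success probabilities of the Bernstein weights, and below the sines [z]
   that correspond to the frequencies of success. *)
pose y (j : 'I_N) (x : 'rV[R]_N) : R := 2^-1 + 2^-1 * sin ((2 * K)^-1 * x 0 j).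
pose W (kappa : {ffun 'I_N -> 'I_n.+2}) (x : 'rV[R]_N) : R :=
  \prod_j bernstein_weight n.+1 (kappa j) (y j x).
pose z (kappa : {ffun 'I_N -> 'I_n.+2}) (j : 'I_N) : R :=
  2 * ((kappa j)%:R / n.+1%:R) - 1.
have y01 j x : 0 <= y j x <= 1.
  have := sin_geN1 ((2 * K)^-1 * x 0 j); have := sin_le1 ((2 * K)^-1 * x 0 j).
  by rewrite /y => ? ?; apply/andP; split; lra.
have W0 kappa x : 0 <= W kappa x.
  by apply: prodr_ge0 => j _; apply: bernstein_weight_ge0.
have W1 x : \sum_kappa W kappa x = 1.
  rewrite /W -(bigA_distr_bigA (fun j (k : 'I_n.+2) => bernstein_weight n.+1 k (y j x))).
  by apply: big1 => j _; exact: bernstein_sum1.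
have Wvar x j : \sum_kappa W kappa x * ((kappa j)%:R / n.+1%:R - y j x) ^+ 2 <= n.+1%:R^-1.
  pose G i (k : 'I_n.+2) := bernstein_weight n.+1 k (y i x) *
    (if i == j then (k%:R / n.+1%:R - y i x) ^+ 2 else 1).
  have -> : \sum_kappa W kappa x * ((kappa j)%:R / n.+1%:R - y j x) ^+ 2 =
      \sum_(kappa : {ffun 'I_N -> 'I_n.+2}) \prod_i G i (kappa i).
    apply: eq_bigr => kappa _; rewrite /G big_split /=; congr (_ * _).
    rewrite (bigD1 j)//= eqxx big1 ?mulr1// => i ij.
    by rewrite (negbTE ij).
  have Gi i : i != j -> \sum_k G i k = 1.
    move=> ij; rewrite /G (negbTE ij).
    by under eq_bigr do rewrite mulr1; exact: bernstein_sum1.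
  rewrite -(bigA_distr_bigA G) (bigD1 j)//= [X in _ * X]big1 ?mulr1; last exact: Gi.
  apply: le_trans (bernstein_variance_le n (y01 j x)).
  by rewrite /G eqxx; under eq_bigr do rewrite mulrC.
exists (fun x => \sum_kappa f (node (z kappa)) * W kappa x); split.
- apply: trig_poly_sum => kappa; apply: trig_polyZ; apply: trig_poly_prod => j.
  apply: trig_poly_bernstein; apply: trig_polyD; first exact: trig_poly_cst.
  by apply: trig_polyZ; exact: trig_poly_sin_coord.
- move=> x; apply: (le_trans (ler_norm_sum _ _ _)).
  rewrite -[leRHS]mulr1 -(W1 x) mulr_sumr; apply: ler_sum => kappa _.
  by rewrite normrM (ger0_norm (W0 _ _)) ler_wpM2r.
move=> x xK; rewrite -[f x]mulr1 -(W1 x) mulr_sumr -sumrB.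
apply: (le_trans (ler_norm_sum _ _ _)).
pose dev (kappa : {ffun 'I_N -> 'I_n.+2}) := \sum_j ((kappa j)%:R / n.+1%:R - y j x) ^+ 2 : R.
(* Either all frequencies are close to the sines, or one of them deviates by at
   least [delta / 2], and then the trivial bound [2 * C] is at most [8 * C /
   delta ^+ 2] times the squared deviation. *)
have pointwise kappa : `|f (node (z kappa)) - f x| <= eps / 2 + 8 * C / delta ^+ 2 * dev kappa.
  have dev0 : 0 <= dev kappa by apply: sumr_ge0 => j _; exact: sqr_ge0.
  have d2 : 0 < delta ^+ 2 by exact: exprn_gt0.
  have [/forallP near_z|] := boolP [forall j, `|sin (x 0 j / (2 * K)) - z kappa j| < delta].
    rewrite distrC (le_trans (Hd x xK (z kappa) near_z))// lerDl.
    by rewrite mulr_ge0// divr_ge0// ?mulr_ge0// ltW.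
  rewrite negb_forall => /existsP[j]; rewrite -leNgt => far.
  have : delta ^+ 2 / 4 <= dev kappa.
    apply: (@le_trans _ _ (((kappa j)%:R / n.+1%:R - y j x) ^+ 2)); last first.
      by rewrite /dev (bigD1 j)//= lerDl; apply: sumr_ge0 => i _; exact: sqr_ge0.
    have -> : (kappa j)%:R / n.+1%:R - y j x = - (sin (x 0 j / (2 * K)) - z kappa j) / 2.
      by rewrite /y /z [_^-1 * x 0 j]mulrC; field; rewrite addrC natr1 pnatr_eq0.
    rewrite mulNr sqrrN expr_div_n; move: far; set s := sin _ - _ => far.
    rewrite (_ : 2 ^+ 2 = 4); last by ring.
    by rewrite ler_wpM2r// -(real_normK (num_real s)) lerXn2r ?nnegrE// ltW.
  move=> devd; apply: (@le_trans _ _ (2 * C)).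
    by rewrite (le_trans (ler_normB _ _))// mulr_natl mulr2n lerD.
  apply: (@le_trans _ _ (8 * C / delta ^+ 2 * (delta ^+ 2 / 4))).
    rewrite mulrA divfK ?gt_eqF//; lra.
  rewrite ler_wpDl ?(ltW e2)// ler_wpM2l// divr_ge0 ?mulr_ge0// ltW//.
apply: (@le_trans _ _ (\sum_kappa (eps / 2 * W kappa x +
    8 * C / delta ^+ 2 * \sum_j W kappa x * ((kappa j)%:R / n.+1%:R - y j x) ^+ 2))).
  apply: ler_sum => kappa _; rewrite -mulrBl normrM (ger0_norm (W0 _ _)).
  rewrite -mulr_sumr -/(dev kappa) [W kappa x * dev kappa]mulrC mulrA -mulrDl.
  by rewrite ler_wpM2r.
rewrite big_split /= -!mulr_sumr W1 mulr1 exchange_big /=.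
have : \sum_j \sum_kappa W kappa x * ((kappa j)%:R / n.+1%:R - y j x) ^+ 2 <=
    N%:R / n.+1%:R.
  apply: (@le_trans _ _ (\sum_(j < N) n.+1%:R^-1)); first by apply: ler_sum.
  by rewrite sumr_const card_ord mulr_natl.
set S := \sum_j _ => SN.
have d2 : 0 < delta ^+ 2 by exact: exprn_gt0.
have nN : 16 * C * N%:R / (delta ^+ 2 * eps) <= n.+1%:R by apply: ltW; exact: real_truncnS_gt (num_real _).
have : 8 * C / delta ^+ 2 * S <= eps / 2.
  apply: (@le_trans _ _ (8 * C / delta ^+ 2 * (N%:R / n.+1%:R))).
    by rewrite ler_wpM2l// divr_ge0 ?mulr_ge0// ltW.
  rewrite mulrA ler_pdivrMr ?ltr0n//.
  move: nN; rewrite ler_pdivrMr ?mulr_gt0// => nN.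
  rewrite mulrAC ler_pdivrMr//; lra.
by lra.
Qed.

End approximation.

(** * Measurability of random matrices *)

Section random_matrices.
Context {R : realType} {d : measure_display} {T : measurableType d}.

Lemma measurable_preimage_ball (m n : nat) (X : T -> 'M[R]_(m, n)) (M : 'M[R]_(m, n))
    (e : R) : 0 < e -> random_mx X -> measurable (X @^-1` ball M e).
Proof.
move=> e0 mX.
have -> : X @^-1` ball M e = \bigcap_(ij : 'I_m * 'I_n) [set w | `|M ij.1 ij.2 - X w ij.1 ij.2| < e].
  by apply/seteqP; split => [w [_ h] [i j] _|w h]; [exact: h|split=> // i j; exact: (h (i, j))].
apply: fin_bigcap_measurable => // ij _.
have mf : measurable_fun [set: T] (fun w => `|M ij.1 ij.2 - X w ij.1 ij.2|).
  by apply: measurableT_comp => //; apply: measurable_funB => //; exact: mX.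
have := mf measurableT `]-oo, e[%classic (measurable_itv _); rewrite setTI.
by congr (measurable _); apply/seteqP; split => w /=; rewrite in_itv.
Qed.

(** An open set is the union of the balls with rational centre and radius
  [k.+1%:R^-1] that it contains. *)
Lemma measurable_preimage_open (m n : nat) (X : T -> 'M[R]_(m, n)) (U : set 'M[R]_(m, n)) :
  random_mx X -> open U -> measurable (X @^-1` U).
Proof.
move=> mX oU.
pose B (i : 'M[rat]_(m, n) * nat) : set 'M[R]_(m, n) :=
  ball (map_mx ratr i.1 : 'M[R]_(m, n)) (i.2.+1%:R^-1 : R).
pose F i : set T := if `[< B i `<=` U >] then X @^-1` B i else set0.
have -> : X @^-1` U = \bigcup_i F i.
  apply/seteqP; split=> [w Uw|w [i _]]; last first.
    by rewrite /F; case: asboolP => // BU /BU.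
  have : nbhs (X w) U by exact: open_nbhs_nbhs.
  move=> /nbhs_ballP[e /= e0 He].
  have [k _ Hk] := near_infty_natSinv_lt (PosNum (divr_gt0 e0 (ltr0n R 2))).
  have := Hk k (leqnn k) => /= {Hk}; set r : R := k.+1%:R^-1 => re.
  have r0 : 0 < r by rewrite invr_gt0.
  have approx i j : exists q : rat, `|ratr q - X w i j| < r.
    have /rat_in_itvoo[q] : X w i j - r < X w i j + r by lra.
    by rewrite in_itv /= => qr; exists q; rewrite ltr_distl.
  pose q : 'M[rat]_(m, n) := \matrix_(i, j) projT1 (cid (approx i j)).
  have wB : B (q, k) (X w).
    by split=> // i j; rewrite !mxE; exact: (projT2 (cid (approx i j))).
  exists (q, k) => //; rewrite /F; case: asboolP => // BU; exfalso; apply: BU.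
  move=> M BM; apply: He; apply: (@le_ball _ _ _ (r + r)).
    by rewrite [leRHS]splitr lerD// ltW.
  by apply: ball_triangle BM; exact: ball_sym.
apply: countable_bigcupT_measurable; first exact: countableP.
move=> i; rewrite /F; case: asboolP => // _.
by apply: measurable_preimage_ball => //; rewrite invr_gt0.
Qed.

Definition borelM (m n : nat) := g_sigma_algebraType [set U : set 'M[R]_(m, n) | open U].

Lemma random_mx_measurable (m n : nat) (X : T -> 'M[R]_(m, n)) :
  random_mx X -> measurable_fun [set: T] (X : T -> borelM m n).
Proof.
move=> mX.
apply: (measurability _ (erefl : @measurable _ (borelM m n) = <<s [set U | open U] >>)).
by move=> _ [U oU <-]; rewrite setTI; exact: measurable_preimage_open.
Qed.

Lemma continuous_borelM (m n : nat) (f : 'M[R]_(m, n) -> R) :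
  continuous f -> measurable_fun [set: borelM m n] (f : borelM m n -> R).
Proof.
move=> cf; apply: (measurability _ (RGenOInfty.measurableE R)).
move=> _ [_ [a ->] <-]; rewrite setTI; apply: sub_sigma_algebra => /=.
by apply: open_comp; [move=> x _; exact: cf|exact: interval_open].
Qed.

Lemma measurable_continuous_comp (m n : nat) (X : T -> 'M[R]_(m, n)) (f : 'M[R]_(m, n) -> R) :
  random_mx X -> continuous f -> measurable_fun [set: T] (fun w => f (X w)).
Proof.
move=> mX cf.
exact: (measurableT_comp (continuous_borelM cf) (random_mx_measurable mX)).
Qed.

Lemma random_mxM (m n p : nat) (A : T -> 'M[R]_(m, n)) (B : T -> 'M[R]_(n, p)) :
  random_mx A -> random_mx B -> random_mx (fun w => A w *m B w).
Proof.
move=> mA mB i j; under eq_fun do rewrite mxE.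
by apply: measurable_sum => l; exact: measurable_funM.
Qed.

Lemma random_mx_cst (m n : nat) (A : 'M[R]_(m, n)) : random_mx (fun _ : T => A).
Proof. by move=> i j; exact: measurable_cst. Qed.

Lemma random_mxD (m n : nat) (A B : T -> 'M[R]_(m, n)) :
  random_mx A -> random_mx B -> random_mx (fun w => A w + B w).
Proof.
move=> mA mB i j; under eq_fun do rewrite mxE.
exact: measurable_funD.
Qed.

Lemma random_mxZ (m n : nat) (c : R) (A : T -> 'M[R]_(m, n)) :
  random_mx A -> random_mx (fun w => c *: A w).
Proof.
by move=> mA i j; under eq_fun do rewrite mxE; exact: measurable_funM.
Qed.

Lemma random_trmx (m n : nat) (A : T -> 'M[R]_(m, n)) :
  random_mx A -> random_mx (fun w => (A w)^T).
Proof. by move=> mA i j; under eq_fun do rewrite mxE; exact: mA. Qed.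

Lemma measurable_det (n : nat) (A : T -> 'M[R]_n) :
  random_mx A -> measurable_fun [set: T] (fun w => \det (A w)).
Proof.
move=> mA; rewrite /determinant; apply: measurable_sum => s.
by apply: measurable_funM => //; apply: measurable_prod => i _; exact: mA.
Qed.

(** A pointwise limit of continuous functions, also at 0 where the inverse is 0
  by convention. *)
Lemma measurable_invr : measurable_fun [set: R] (fun x : R => x^-1).
Proof.
pose h (k : nat) (x : R) := x * (x ^+ 2 + k.+1%:R^-1)^-1.
have d0 k (x : R) : 0 < x ^+ 2 + k.+1%:R^-1 by rewrite ltr_wpDl ?sqr_ge0// invr_gt0.
apply: (measurable_fun_cvg (h := h)) => [k|x _].
  apply: continuous_measurable_fun => x; apply: cvgM; first exact: cvg_id.
  apply: cvgV; first by rewrite gt_eqF.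
  by apply: cvgD; [exact: sqr_continuous|exact: cvg_cst].
have [->|x0] := eqVneq x 0.
  rewrite invr0; apply: cvg_near_cst; near=> k.
  by rewrite /h mul0r.
have -> : x^-1 = x * (x ^+ 2 + 0)^-1 by field.
apply: cvgMr; apply: cvgV; first by rewrite addr0 sqrf_eq0.
by apply: cvgD; [exact: cvg_cst|exact: cvg_harmonic].
Unshelve. all: by end_near. Qed.

(** The adjugate formula; on the singular matrices [invmx] is the identity. *)
Lemma random_invmx (n : nat) (A : T -> 'M[R]_n) :
  random_mx A -> random_mx (fun w => invmx (A w)).
Proof.
move=> mA i j; have mdet := measurable_det mA.
have -> : (fun w => invmx (A w) i j) = (fun w => if \det (A w) == 0 then A w i j
    else (\det (A w))^-1 * cofactor (A w) j i).
  apply/funext => w; rewrite /invmx unitmxE unitfE.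
  by case: eqP => //= _; rewrite !mxE.
apply: measurable_fun_ifT => //; first exact: measurable_fun_eqr.
apply: measurable_funM; first exact: (measurableT_comp measurable_invr).
apply: measurable_funM => //; apply: measurable_det => a b.
by under eq_fun do rewrite !mxE; exact: mA.
Qed.

End random_matrices.

(** * Convergence in probability *)

Section in_probability.
Context {d : measure_display} {T : measurableType d} {R : realType}.
Variable P : probability T R.

(** Only the exceptional event has to be measurable, so that [Q] can be any
  property. *)
Definition outside_event (eta : R) (Q : T -> Prop) : Prop :=
  exists A, [/\ measurable A, (P A <= eta%:E)%E & forall w, ~ A w -> Q w].

Definition whp (eta : R) (Q : nat -> T -> Prop) : Prop :=
  \forall n \near \oo, outside_event eta (Q n).

Definition bounded_in_prob (Y : nat -> T -> R) : Prop :=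
  forall eta, 0 < eta -> exists K, whp eta (fun n w => `|Y n w| <= K).

Definition to0_in_prob (Y : nat -> T -> R) : Prop :=
  forall eps eta, 0 < eps -> 0 < eta -> whp eta (fun n w => `|Y n w| <= eps).

Lemma whp_mono eta (Q Q' : nat -> T -> Prop) :
  (\forall n \near \oo, forall w, Q n w -> Q' n w) -> whp eta Q -> whp eta Q'.
Proof.
apply: filterS2 => n QQ' [A [mA PA AQ]]; exists A; split => // w Aw.
exact/QQ'/AQ.
Qed.

Lemma whp_and eta (Q Q' : nat -> T -> Prop) : whp (eta / 2) Q -> whp (eta / 2) Q' ->
  whp eta (fun n w => Q n w /\ Q' n w).
Proof.
apply: filterS2 => n [A [mA PA AQ]] [A' [mA' PA' AQ']].
exists (A `|` A'); split; first exact: measurableU.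
  apply: (le_trans (measureU2 _ mA mA')).
  by rewrite [eta]splitr EFinD leeD.
by move=> w /not_orP[Aw A'w]; split; [exact: AQ|exact: AQ'].
Qed.

Lemma whp_true eta (Q : nat -> T -> Prop) : 0 <= eta ->
  (\forall n \near \oo, forall w, Q n w) -> whp eta Q.
Proof.
move=> e0; apply: filterS => n Qn; exists set0; split => //.
by rewrite measure0 lee_fin.
Qed.

Lemma whp_forall (I : finType) (Q : I -> nat -> T -> Prop) :
  (forall i eta, 0 < eta -> whp eta (Q i)) ->
  forall eta, 0 < eta -> whp eta (fun n w => forall i, Q i n w).
Proof.
move=> hQ.
have : forall (s : seq I) eta, 0 < eta -> whp eta (fun n w => forall i, i \in s -> Q i n w).
  elim=> [|i s IH] eta eta0; first by apply: whp_true; [exact: ltW|near=> n].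
  have e2 : 0 < eta / 2 by rewrite divr_gt0.
  apply: whp_mono (whp_and (hQ i _ e2) (IH _ e2)).
  by near=> n => w [Qi Qs] j; rewrite inE => /predU1P[->|/Qs].
move=> /(_ (enum I)) h eta /h; apply: whp_mono; near=> n => w Qw i.
by apply: Qw; rewrite mem_enum.
Unshelve. all: by end_near. Qed.

Lemma to0_bounded_in_prob Y : to0_in_prob Y -> bounded_in_prob Y.
Proof. by move=> Y0 eta eta0; exists 1; exact: Y0. Qed.

Lemma to0_in_probD Y Z : to0_in_prob Y -> to0_in_prob Z ->
  to0_in_prob (fun n w => Y n w + Z n w).
Proof.
move=> Y0 Z0 eps eta e0 eta0; have e2 : 0 < eps / 2 by rewrite divr_gt0.
have h2 : 0 < eta / 2 by rewrite divr_gt0.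
apply: whp_mono (whp_and (Y0 _ _ e2 h2) (Z0 _ _ e2 h2)); near=> n => w [Yw Zw].
by rewrite (le_trans (ler_normD _ _))// [eps]splitr lerD.
Unshelve. all: by end_near. Qed.

Lemma bounded_in_probD Y Z : bounded_in_prob Y -> bounded_in_prob Z ->
  bounded_in_prob (fun n w => Y n w + Z n w).
Proof.
move=> Yb Zb eta eta0; have h2 : 0 < eta / 2 by rewrite divr_gt0.
have [K YK] := Yb _ h2; have [L ZL] := Zb _ h2; exists (K + L).
apply: whp_mono (whp_and YK ZL); near=> n => w [Yw Zw].
by rewrite (le_trans (ler_normD _ _))// lerD.
Unshelve. all: by end_near. Qed.

Lemma bounded_in_probM Y Z : bounded_in_prob Y -> bounded_in_prob Z ->
  bounded_in_prob (fun n w => Y n w * Z n w).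
Proof.
move=> Yb Zb eta eta0; have h2 : 0 < eta / 2 by rewrite divr_gt0.
have [K YK] := Yb _ h2; have [L ZL] := Zb _ h2; exists (K * L).
apply: whp_mono (whp_and YK ZL); near=> n => w [Yw Zw].
by rewrite normrM ler_pM.
Unshelve. all: by end_near. Qed.

Lemma to0_in_probMl Y Z : to0_in_prob Y -> bounded_in_prob Z ->
  to0_in_prob (fun n w => Y n w * Z n w).
Proof.
move=> Y0 Zb eps eta e0 eta0; have h2 : 0 < eta / 2 by rewrite divr_gt0.
have [L ZL] := Zb _ h2; have L0 : 0 < `|L| + 1 by rewrite ltr_wpDl.
have eL : 0 < eps / (`|L| + 1) by rewrite divr_gt0.
apply: whp_mono (whp_and (Y0 _ _ eL h2) ZL); near=> n => w [Yw Zw].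
rewrite normrM -[eps](divfK (lt0r_neq0 L0)) ler_pM// (le_trans Zw)//.
by rewrite (le_trans (ler_norm L))// lerDl.
Unshelve. all: by end_near. Qed.

Lemma to0_in_probMr Y Z : bounded_in_prob Y -> to0_in_prob Z ->
  to0_in_prob (fun n w => Y n w * Z n w).
Proof.
move=> Yb Z0; have := to0_in_probMl Z0 Yb.
by under eq_fun do under eq_fun do rewrite mulrC.
Qed.

Lemma to0_in_prob_cvg (c : nat -> R) : c n @[n --> \oo] --> (0 : R) ->
  to0_in_prob (fun n _ => c n).
Proof.
move=> c0 eps eta e0 eta0; apply: whp_true; first exact: ltW.
by have /cvgr0Pnorm_le/(_ _ e0) := c0; apply: filterS.
Qed.

Lemma bounded_in_prob_cvg (c : nat -> R) (l : R) : c n @[n --> \oo] --> l ->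
  bounded_in_prob (fun n _ => c n).
Proof.
move=> cl eta eta0; exists (`|l| + 1); apply: whp_true; first exact: ltW.
have /cvgrPdist_le/(_ _ ltr01) := cl; apply: filterS => n cn w.
have := ler_normB l (l - c n); rewrite subKr => /le_trans; apply.
by rewrite lerD2l.
Qed.

Lemma to0_in_prob_sum (I : Type) (s : seq I) (Y : I -> nat -> T -> R) :
  (forall i, to0_in_prob (Y i)) -> to0_in_prob (fun n w => \sum_(i <- s) Y i n w).
Proof.
move=> Y0; elim: s => [|i s IH].
  under eq_fun do under eq_fun do rewrite big_nil.
  by apply: to0_in_prob_cvg; exact: cvg_cst.
under eq_fun do under eq_fun do rewrite big_cons.
exact: to0_in_probD.
Qed.

Lemma bounded_in_prob_sum (I : Type) (s : seq I) (Y : I -> nat -> T -> R) :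
  (forall i, bounded_in_prob (Y i)) -> bounded_in_prob (fun n w => \sum_(i <- s) Y i n w).
Proof.
move=> Y0; elim: s => [|i s IH].
  under eq_fun do under eq_fun do rewrite big_nil.
  by apply: bounded_in_prob_cvg; exact: cvg_cst.
under eq_fun do under eq_fun do rewrite big_cons.
exact: bounded_in_probD.
Qed.

(** Chebyshev's inequality. *)
Lemma bounded_in_prob_moment (Y : nat -> T -> R) (M : R) :
  (forall n, integr P (fun w => Y n w ^+ 2)) ->
  (\forall n \near \oo, Ex P (fun w => Y n w ^+ 2) <= M) -> bounded_in_prob Y.
Proof.
move=> iY YM eta eta0; pose K := Num.sqrt ((`|M| + 1) / eta).
have M0 : 0 < (`|M| + 1) / eta by rewrite divr_gt0// ltr_wpDl.
exists K; near=> n.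
have [A [mA PA AY]] := markov_event M0 (iY n) (fun w => sqr_ge0 _).
exists A; split => //.
  apply: (le_trans PA); rewrite lee_fin ler_pdivrMr// mulrCA divff ?gt_eqF// mulr1.
  apply: (@le_trans _ _ M); first by near: n.
  by rewrite (le_trans (ler_norm M))// lerDl.
by move=> w /AY YK; rewrite -sqrtr_sqr /K ler_wsqrtr.
Unshelve. all: by end_near. Qed.

Lemma to0_in_prob_L1 (Y : nat -> T -> R) :
  (forall n, integr P (fun w => `|Y n w|)) ->
  Ex P (fun w => `|Y n w|) @[n --> \oo] --> (0 : R) -> to0_in_prob Y.
Proof.
move=> iY Y0 eps eta e0 eta0; have ee : 0 < eta * eps by rewrite mulr_gt0.
near=> n; have [A [mA PA AY]] := markov_event e0 (iY n) (fun w => normr_ge0 _).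
exists A; split => //; apply: (le_trans PA); rewrite lee_fin ler_pdivrMr//.
by apply/ltW; near: n; exact: (cvgr_lt 0 Y0 _ ee).
Unshelve. all: by end_near. Qed.

(** A single real variable is tight, by continuity of the probability along the
  decreasing events [k <= `|Y|]. *)
Lemma bounded_in_prob_cst (Y : T -> R) : measurable_fun [set: T] Y ->
  bounded_in_prob (fun _ => Y).
Proof.
move=> mY eta eta0; pose A (k : nat) := [set w | k%:R <= `|Y w|].
have mA k : measurable (A k).
  rewrite -[A k]setTI; apply: measurable_fun_le => //; exact: measurableT_comp.
have PA : P (A k) @[k --> \oo] --> P (\bigcap_k A k).
  apply: nonincreasing_cvg_mu => //.
  - by rewrite (le_lt_trans (probability_le1 _ (mA 0%N)))// ltry.
  - exact: bigcapT_measurable.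
  - move=> k l kl; apply/subsetPset => w /=; apply: le_trans.
    by rewrite ler_nat.
have A0 : \bigcap_k A k = set0.
  apply/seteqP; split => // w /(_ (Num.truncn `|Y w|).+1 I) /=.
  by rewrite /A /= leNgt real_truncnS_gt// num_real.
rewrite A0 measure0 in PA.
have [k _ Hk] : \forall k \near \oo, (P (A k) < eta%:E)%E.
  have f0 : fine (P (A k)) @[k --> \oo] --> (0 : R) by exact: fine_cvg.
  apply: filterS (cvgr_lt 0 f0 _ eta0) => k /= Hk.
  by rewrite -(fineK (fin_num_measure P _ (mA k))) lte_fin.
exists k%:R; near=> n; exists (A k); split => //; first exact/ltW/Hk/leqnn.
by move=> w /negP; rewrite -ltNge => /ltW.
Unshelve. all: by end_near. Qed.

Lemma norm_Ex_outside_event (X : T -> R) (C eps eta : R) : measurable_fun [set: T] X ->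
  (forall w, `|X w| <= C) -> 0 <= C -> 0 <= eps -> outside_event eta (fun w => `|X w| <= eps) ->
  `|Ex P X| <= eps + C * eta.
Proof.
move=> mX XC C0 e0 [A [mA PA AX]].
have [iA EA] := probability_indic P mA.
have iX : integr P X := integr_bounded P mX XC.
apply: (@le_trans _ _ (Ex P (fun w => eps + C * \1_A w))).
  apply: norm_Ex_le => // [|w].
    by apply: integrD; [exact: integr_cst|exact: integrZ].
  rewrite indicE; have [/set_mem Aw|/negP Aw] := boolP (w \in A).
    by rewrite mulr1 (le_trans (XC w))// lerDr.
  by rewrite mulr0 addr0 AX// => /mem_set.
rewrite ExD; [|exact: integr_cst|exact: integrZ].
rewrite Ex_cst ExZ// lerD2l ler_wpM2l//.
by rewrite -lee_fin -EA.
Qed.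

End in_probability.

(** * Weak convergence from trigonometric moments *)

Lemma bounded_in_prob_row {R : realType} {d : measure_display} {T : measurableType d}
    (P : probability T R) (N : nat) (V : nat -> T -> 'rV[R]_N) :
  (forall j, bounded_in_prob P (fun n w => V n w 0 j)) ->
  forall eta, 0 < eta -> exists2 K, 0 < K &
    whp P eta (fun n w => forall j, `|V n w 0 j| <= K).
Proof.
move=> bV eta eta0.
have : bounded_in_prob P (fun n w => \sum_j `|V n w 0 j|).
  apply: bounded_in_prob_sum => j e e0; have [K VK] := bV j e e0.
  by exists K; apply: whp_mono VK; near=> n => w; rewrite normr_id.
move=> /(_ _ eta0)[K VK]; exists (`|K| + 1); first by rewrite ltr_wpDl.
apply: whp_mono VK; near=> n => w VK j.
apply: (@le_trans _ _ K); last by rewrite (le_trans (ler_norm K))// lerDl.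
apply: le_trans VK; rewrite [leRHS]ger0_norm; last by apply: sumr_ge0.
by rewrite (bigD1 j)//= lerDl; apply: sumr_ge0.
Unshelve. all: by end_near. Qed.

Lemma measurable_dotv {R : realType} {d : measure_display} {T : measurableType d}
    (N : nat) (V : T -> 'rV[R]_N) (t : 'rV[R]_N) :
  random_mx V -> measurable_fun [set: T] (fun w => dotv t (V w)).
Proof.
by move=> mV; apply: measurable_sum => j; apply: measurable_funM => //; exact: mV.
Qed.

Lemma integr_trig_poly {R : realType} {d : measure_display} {T : measurableType d}
    (P : probability T R) (N : nat) (V : T -> 'rV[R]_N) (F : 'rV[R]_N -> R) :
  random_mx V -> trig_poly F -> integr P (fun w => F (V w)).
Proof.
move=> mV; elim=> [t|t|F1 F2 _ i1 _ i2|c F1 _ i1].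
- by apply: integr_cos; exact: measurable_dotv.
- by apply: integr_sin; exact: measurable_dotv.
- exact: integrD.
- exact: integrZ.
Qed.

Section weak_convergence.
Context {R : realType} {d d' : measure_display} {T : measurableType d} {T' : measurableType d'}.
Variables (P : probability T R) (P' : probability T' R) (N : nat).
Variables (V_ : nat -> T -> 'rV[R]_N) (V : T' -> 'rV[R]_N).
Hypotheses (mV_ : forall n, random_mx (V_ n)) (mV : random_mx V).
Hypothesis tightV_ : forall j, bounded_in_prob P (fun n w => V_ n w 0 j).
Hypothesis cvg_cos : forall t, Ex P (fun w => cos (dotv t (V_ n w))) @[n --> \oo] -->
  Ex P' (fun w => cos (dotv t (V w))).
Hypothesis cvg_sin : forall t, Ex P (fun w => sin (dotv t (V_ n w))) @[n --> \oo] -->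
  Ex P' (fun w => sin (dotv t (V w))).

Let cvg_trig_poly F : trig_poly F -> Ex P (fun w => F (V_ n w)) @[n --> \oo] -->
  Ex P' (fun w => F (V w)).
Proof.
elim=> [t|t|F1 F2 t1 c1 t2 c2|c F1 t1 c1]; [exact: cvg_cos|exact: cvg_sin| |].
- rewrite (ExD (integr_trig_poly P' mV t1) (integr_trig_poly P' mV t2)).
  rewrite (_ : (fun n => _) = fun n => Ex P (fun w => F1 (V_ n w)) + Ex P (fun w => F2 (V_ n w))).
    exact: cvgD.
  apply/funext => n.
  by rewrite (ExD (integr_trig_poly P (mV_ n) t1) (integr_trig_poly P (mV_ n) t2)).
- rewrite (ExZ c (integr_trig_poly P' mV t1)).
  rewrite (_ : (fun n => _) = fun n => c * Ex P (fun w => F1 (V_ n w))).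
    exact: cvgMr.
  by apply/funext => n; rewrite (ExZ c (integr_trig_poly P (mV_ n) t1)).
Qed.

(** By tightness all variables lie in one cube up to probability [eta]; there
  [f] is uniformly close to a trigonometric polynomial with the same global
  bound, and the expectation of that polynomial converges by linearity. *)
Lemma weak_cvg_of_char (f : 'rV[R]_N -> R) (C : R) : continuous f ->
  (forall x, `|f x| <= C) ->
  Ex P (fun w => f (V_ n w)) @[n --> \oo] --> Ex P' (fun w => f (V w)).
Proof.
move=> cf fC; apply/cvgrPdist_le => eps e0.
have C0 : 0 <= C by exact: le_trans (fC 0).
have e8 : 0 < eps / 8 by rewrite divr_gt0.
(* Chosen so that the exceptional events contribute at most [2 * C * eta <= eps
   / 8]. *)
pose eta := eps / (16 * (C + 1)).
have eta0 : 0 < eta by rewrite divr_gt0// mulr_gt0//; lra.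
have [K1 K10 V_K] := bounded_in_prob_row tightV_ eta0.
have tightV j : bounded_in_prob P' (fun (_ : nat) w => V w 0 j) := bounded_in_prob_cst P' (mV 0 j).
have [K2 K20 VK] := bounded_in_prob_row tightV eta0.
have K0 : 0 < K1 + K2 by rewrite addr_gt0.
have [F [tF FC Ff]] := trig_poly_approx cf K0 fC e8.
have mfV : measurable_fun [set: T'] (fun w => f (V w)) := measurable_continuous_comp mV cf.
have close (d0 : measure_display) (T0 : measurableType d0) (P0 : probability T0 R)
    (W : T0 -> 'rV[R]_N) : random_mx W ->
    outside_event P0 eta (fun w => forall j, `|W w 0 j| <= K1 + K2) ->
    `|Ex P0 (fun w => f (W w)) - Ex P0 (fun w => F (W w))| <= eps / 4.
  move=> mW [A [mA PA AW]].
  have mfW : measurable_fun [set: T0] (fun w => f (W w)) := measurable_continuous_comp mW cf.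
  have ifW : integr P0 (fun w => f (W w)) := integr_bounded P0 mfW (fun w => fC (W w)).
  have iFW : integr P0 (fun w => F (W w)) := integr_trig_poly P0 mW tF.
  rewrite -(ExB ifW iFW).
  apply: (@le_trans _ _ (eps / 8 + (2 * C) * eta)).
    apply: norm_Ex_outside_event => //.
    - exact: integr_measurable (integrB ifW iFW).
    - by move=> w; rewrite (le_trans (ler_normB _ _))// mulr_natl mulr2n lerD.
    - by rewrite mulr_ge0.
    - exact: ltW.
    - by exists A; split => // w Aw; rewrite distrC; apply: Ff; exact: AW.
  have : 2 * C * eta <= eps / 8.
    rewrite /eta mulrA ler_pdivrMr; last by rewrite mulr_gt0//; lra.
    by have := e0; nra.
  lra.
have [n0 _ VK'] := VK; have limV := close _ _ P' V mV.
have {limV} limV : `|Ex P' (fun w => f (V w)) - Ex P' (fun w => F (V w))| <= eps / 4.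
  apply: limV; have [A [mA PA AV]] := VK' n0 (leqnn n0).
  by exists A; split => // w Aw j; rewrite (le_trans (AV w Aw j))// lerDr ltW.
have e4 : 0 < eps / 4 by rewrite divr_gt0.
have /cvgrPdist_le/(_ _ e4) := cvg_trig_poly tF.
apply: filterS2 V_K => n [A [mA PA AV]] mid.
have limV_ : `|Ex P (fun w => f (V_ n w)) - Ex P (fun w => F (V_ n w))| <= eps / 4.
  apply: close => //; exists A; split => // w Aw j.
  by rewrite (le_trans (AV w Aw j))// lerDl ltW.
have t1 := ler_distD (Ex P' (fun w => F (V w))) (Ex P' (fun w => f (V w)))
  (Ex P (fun w => f (V_ n w))).
have t2 := ler_distD (Ex P (fun w => F (V_ n w))) (Ex P' (fun w => F (V w)))
  (Ex P (fun w => f (V_ n w))).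
move: t2; rewrite [X in _ <= _ + X]distrC; lra.
Qed.

End weak_convergence.

(** A Lipschitz function of two variables that get close in probability has the
  same limiting expectation. *)
Lemma slutsky_char {R : realType} {d : measure_display} {T : measurableType d}
    (P : probability T R) (X Y : nat -> T -> R) (g : R -> R) (l : R) :
  continuous g -> (forall x, `|g x| <= 1) -> (forall x y, `|g y - g x| <= `|y - x|) ->
  (forall n, measurable_fun [set: T] (X n)) -> (forall n, measurable_fun [set: T] (Y n)) ->
  to0_in_prob P (fun n w => Y n w - X n w) ->
  Ex P (fun w => g (X n w)) @[n --> \oo] --> l ->
  Ex P (fun w => g (Y n w)) @[n --> \oo] --> l.
Proof.
move=> cg g1 lip mX mY XY Xl.
have mg (Z : T -> R) : measurable_fun [set: T] Z -> measurable_fun [set: T] (fun w => g (Z w)).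
  by move=> mZ; apply: measurableT_comp => //; exact: continuous_measurable_fun.
have ig (Z : T -> R) : measurable_fun [set: T] Z -> integr P (fun w => g (Z w)).
  by move=> mZ; exact: integr_bounded (mg Z mZ) (fun w => g1 _).
have diff0 : Ex P (fun w => g (Y n w)) - Ex P (fun w => g (X n w)) @[n --> \oo] --> (0 : R).
  apply/cvgr0Pnorm_le => eps e0.
  have e2 : 0 < eps / 2 by rewrite divr_gt0.
  have e4 : 0 < eps / 4 by rewrite divr_gt0.
  apply: filterS (XY _ _ e2 e4) => n [A [mA PA AXY]].
  rewrite -ExB; [|exact: ig|exact: ig].
  apply: (@le_trans _ _ (eps / 2 + 2 * (eps / 4))); last by lra.
  apply: norm_Ex_outside_event => //.
  - by apply: measurable_funB; exact: mg.
  - by move=> w; rewrite (le_trans (ler_normB _ _))// (_ : 2 = 1 + 1) ?lerD//; ring.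
  - exact: ltW.
  - exists A; split => // w Aw.
    by rewrite (le_trans (lip _ _))//; exact: AXY.
rewrite -[X in _ --> X]add0r.
rewrite (_ : (fun n => _) = (fun n => (Ex P (fun w => g (Y n w)) - Ex P (fun w => g (X n w))) +
  Ex P (fun w => g (X n w)))); first exact: cvgD.
by apply/funext => n; rewrite subrK.
Qed.

(** * Entrywise limits, trace forms and positive definite matrices *)

Section entrywise_limits.
Context {R : realType} {T : Type} {F : set_system T} {FF : Filter F}.

(** Convergence of every entry, along an arbitrary filter: it serves for
  sequences of designs as well as for continuity of matrix functions at a
  point. *)
Definition mx_cvg (m n : nat) (f : T -> 'M[R]_(m, n)) (A : 'M[R]_(m, n)) : Prop :=
  forall i j, f x i j @[x --> F] --> A i j.

Lemma mx_cvg_cst (m n : nat) (A : 'M[R]_(m, n)) : mx_cvg (fun=> A) A.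
Proof. by move=> i j; exact: cvg_cst. Qed.

Lemma mx_cvgM (m n p : nat) (f : T -> 'M[R]_(m, n)) (g : T -> 'M[R]_(n, p)) A B :
  mx_cvg f A -> mx_cvg g B -> mx_cvg (fun x => f x *m g x) (A *m B).
Proof.
move=> fA gB i j; rewrite mxE.
rewrite (_ : (fun x => _) = fun x => \sum_l f x i l * g x l j); last first.
  by apply/funext => x; rewrite mxE.
by apply: cvg_big => [|l _]; [exact: add_continuous|exact: cvgM].
Qed.

Lemma cvg_det (n : nat) (f : T -> 'M[R]_n) A :
  mx_cvg f A -> \det (f x) @[x --> F] --> \det A.
Proof.
move=> fA; rewrite /determinant.
apply: cvg_big => [|s _]; first exact: add_continuous.
apply: cvgM; first exact: cvg_cst.
by apply: cvg_big => [|i _]; [exact: mul_continuous|exact: fA].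
Qed.

Lemma near_unitmx (n : nat) (f : T -> 'M[R]_n) A :
  mx_cvg f A -> A \in unitmx -> \forall x \near F, f x \in unitmx.
Proof.
move=> /cvg_det fA; rewrite unitmxE unitfE => A0.
have : \forall x \near F, \det (f x) != 0.
  exact: fA _ (open_nbhs_nbhs (conj (@open_neq R 0) A0)).
by apply: filterS => x; rewrite unitmxE unitfE.
Qed.

(** Near an invertible limit the inverse is given by the adjugate formula. *)
Lemma mx_cvg_inv (n : nat) (f : T -> 'M[R]_n) A :
  mx_cvg f A -> A \in unitmx -> mx_cvg (fun x => invmx (f x)) (invmx A).
Proof.
move=> fA uA i j; have fu := near_unitmx fA uA.
have cvg_adj : (\det (f x))^-1 * cofactor (f x) j i @[x --> F] -->
    (\det A)^-1 * cofactor A j i.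
  apply: cvgM; first by apply: cvgV; [rewrite -unitfE -unitmxE|exact: cvg_det].
  apply: cvgM; first exact: cvg_cst.
  apply: cvg_det => a b; rewrite !mxE.
  rewrite (_ : (fun x => _) = fun x => f x (lift j a) (lift i b)); first exact: fA.
  by apply/funext => x; rewrite !mxE.
rewrite /invmx uA !mxE; apply: cvg_trans cvg_adj; apply: near_eq_cvg.
by apply: filterS fu => x ux; rewrite ux !mxE.
Qed.

End entrywise_limits.
Arguments mx_cvg {R T} F {m n} f A.

Lemma cvg_entries {R : realType} {T : Type} {F : set_system T} {FF : Filter F}
    (m n : nat) (f : T -> 'M[R]_(m, n)) (A : 'M[R]_(m, n)) :
  f x @[x --> F] --> A -> mx_cvg F f A.
Proof.
move=> fA i j.
exact: (cvg_comp _ _ fA (@coord_continuous R^o m n i j A)).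
Qed.

Lemma mx_cvg_id {R : realType} (m n : nat) (A : 'M[R]_(m, n)) : mx_cvg (nbhs A) id A.
Proof. by apply: cvg_entries; exact: cvg_id. Qed.

Section trace_forms.
Context {R : realType}.

Lemma dotv_mxvec (m n : nat) (t : 'rV[R]_(m * n)) (M : 'M[R]_(m, n)) :
  dotv t (mxvec M) = \tr ((vec_mx t)^T *m M).
Proof.
rewrite /dotv (reindex _ (curry_mxvec_bij _ _)) /=.
rewrite /mxtrace; under [RHS]eq_bigr do rewrite mxE.
rewrite exchange_big pair_bigA /=; apply: eq_bigr => -[i j] _ /=.
by rewrite mxvecE !mxE.
Qed.

(** [mxvec] turns the Kronecker product into a two-sided multiplication. *)
Lemma mulmx_tens (m n : nat) (A : 'M[R]_m) (B : 'M[R]_n) (t : 'rV[R]_(m * n)) :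
  t *m (A *t B) = mxvec (A^T *m vec_mx t *m B).
Proof.
apply/rowP => kl; case/mxvec_indexP: kl => k l; rewrite mxvecE !mxE.
rewrite (reindex _ (curry_mxvec_bij _ _)) /=.
under [RHS]eq_bigr => j _ do rewrite mxE mulr_suml.
rewrite exchange_big pair_bigA /=; apply: eq_bigr => -[i j] _ /=.
by rewrite !mxvec_index_tens tensmxE !mxE mxvec_index_tens mulrCA mulrA.
Qed.

Lemma tens_quadratic_form (m n : nat) (A : 'M[R]_m) (B : 'M[R]_n) (t : 'rV[R]_(m * n)) :
  (t *m (A *t B) *m t^T) 0 0 = \tr ((vec_mx t)^T *m A^T *m vec_mx t *m B).
Proof.
rewrite mulmx_tens -!mulmxA -dotv_mxvec /dotv mxE; apply: eq_bigr => j _.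
by rewrite mulrC [t^T _ _]mxE !mulmxA.
Qed.

End trace_forms.

Section positive_definite.
Context {R : realType}.

Lemma posdefmx_unit (n : nat) (A : 'M[R]_n) : posdefmx A -> A \in unitmx.
Proof.
move=> [_ A0]; rewrite -row_free_unit -kermx_eq0; apply/eqP/row_matrixP => i.
rewrite row0; apply/eqP/negPn/negP => v0.
have := A0 (row i (kermx A))^T; rewrite trmx_eq0 trmxK => /(_ v0).
by rewrite -row_mul mulmx_ker row0 mul0mx mxE ltxx.
Qed.

Lemma posdefmx_inv (n : nat) (A : 'M[R]_n) : posdefmx A -> posdefmx (invmx A).
Proof.
move=> pA; have uA := posdefmx_unit pA; have [sA A0] := pA.
split=> [|v v0]; first by rewrite trmx_inv sA.
have w0 : invmx A *m v != 0.
  by apply: contra v0 => /eqP w0; rewrite -(mulKVmx uA v) w0 mulmx0.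
have := A0 _ w0; rewrite trmx_mul trmx_inv sA -!mulmxA mulKVmx//.
Qed.

Lemma posdefmx_congr (p q : nat) (A : 'M[R]_p) (Z : 'M[R]_(p, q)) :
  \rank Z = q -> posdefmx A -> posdefmx (Z^T *m A *m Z).
Proof.
move=> rZ [sA A0]; split=> [|v v0]; first by rewrite !trmx_mul trmxK sA mulmxA.
have fZ : row_free Z^T by rewrite /row_free mxrank_tr rZ.
have Zv0 : Z *m v != 0.
  apply: contra v0 => /eqP Zv; rewrite -trmx_eq0; apply/eqP.
  by apply: (row_free_inj fZ); rewrite -trmx_mul Zv trmx0 mul0mx.
by have := A0 _ Zv0; rewrite trmx_mul !mulmxA.
Qed.

(** The Cholesky factorization, by induction on the Schur complement of the
  first diagonal entry. *)
Lemma posdefmx_sqrt (n : nat) (A : 'M[R]_n) : posdefmx A ->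
  exists L : 'M[R]_n, A = L *m L^T.
Proof.
elim: n A => [|n IH] A.
  by move=> _; exists 0; apply/matrixP => -[].
rewrite -[n.+1]/(1 + n)%N in A *; rewrite -[A]submxK.
set a := ulsubmx A; set b := ursubmx A; set c := dlsubmx A; set D := drsubmx A.
move=> [+ A0]; rewrite tr_block_mx => /eq_block_mx[_ cb bc sD].
have a0 : 0 < a 0 0.
  have v0 : col_mx 1%:M 0 != 0 :> 'cV[R]_(1 + n).
    apply/negP => /eqP; rewrite -[RHS]col_mx0 => /eq_col_mx[/matrixP/(_ 0 0)].
    by rewrite !mxE => /eqP; rewrite oner_eq0.
  have := A0 _ v0; rewrite tr_col_mx trmx1 trmx0 mul_row_block mul_row_col.
  by rewrite !mul1mx !mul0mx !addr0 mulmx1 mulmx0 addr0.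
have ea : a = (a 0 0)%:M by rewrite -mx11_scalar.
pose s := Num.sqrt (a 0 0).
have s0 : s != 0 by rewrite sqrtr_eq0 -ltNge.
have ss : s * s = a 0 0 by rewrite -expr2 sqr_sqrtr// ltW.
(* The Schur complement is positive: its quadratic form at [v] is that of [A]
   at the vector extended by the minimizing first coordinate [u]. *)
have pS : posdefmx (D - (a 0 0)^-1 *: (c *m b)).
  split=> [|v v0].
    by rewrite linearB linearZ /= trmx_mul sD bc cb.
  pose u : 'cV[R]_1 := - (a 0 0)^-1 *: (b *m v).
  have w0 : col_mx u v != 0.
    apply: contra v0 => /eqP; rewrite -[X in _ = X]col_mx0 => /eq_col_mx[_ ->].
    by rewrite eqxx.
  have := A0 _ w0; rewrite tr_col_mx mul_row_block mul_row_col.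
  have -> : u^T *m a + v^T *m c = 0.
    rewrite ea mul_mx_scalar /u linearZ /= trmx_mul bc scalerA mulrN divff ?gt_eqF//.
    by rewrite scaleN1r addNr.
  rewrite mul0mx add0r mulmxDl /u linearZ /= trmx_mul bc -!scalemxAl scaleNr.
  by rewrite mulmxBr mulmxBl -scalemxAr -scalemxAl addrC !mulmxA.
have [L SL] := IH _ pS.
exists (block_mx s%:M 0 (s^-1 *: c) L).
rewrite tr_block_mx mulmx_block trmx0 !mulmx0 !mul0mx !addr0.
have eD : D = (s^-1 *: c) *m (s^-1 *: c)^T + L *m L^T.
  rewrite -SL linearZ /= -scalemxAl -scalemxAr scalerA -invfM ss cb.
  by rewrite addrC subrK.
rewrite -eD tr_scalar_mx -scalar_mxM ss -ea; congr block_mx.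
  by rewrite linearZ /= mul_scalar_mx scalerA divff// scale1r cb.
by rewrite mul_mx_scalar scalerA divff// scale1r.
Qed.

Lemma projmxE (n m : nat) (X : 'M[R]_(n, m)) : X^T *m X \in unitmx ->
  projmx X = X *m invmx (X^T *m X) *m X^T.
Proof. by move=> uX; rewrite /projmx pinvmxE. Qed.

End positive_definite.
Arguments mx_cvg_cst {R T F FF m n} A i j.
Arguments mx_cvgM {R T F FF m n p f g A B} fA gB i j.
Arguments mx_cvg_inv {R T F FF n f A} fA uA i j.
Arguments mx_cvg_id {R m n} A i j.
Arguments cvg_entries {R T F FF m n f A} fA i j.

(** * The weak law of large numbers *)

Definition clip {R : realType} (M x : R) : R := Num.max (- M) (Num.min x M).

Lemma clip_norm {R : realType} (M x : R) : 0 <= M -> `|clip M x| <= M.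
Proof. by rewrite /clip ler_norml /Num.max /Num.min; case: (ltP x M) => xM; case: ltP; lra. Qed.

Lemma clip_err {R : realType} (M x : R) : 0 <= M -> `|x - clip M x| <= `|x|.
Proof.
move=> M0; rewrite ler_norml /clip /Num.max /Num.min.
by case: (ltP x M) => xM; case: ltP => Mx; case: (ger0P x) => x0; lra.
Qed.

Lemma clip_id {R : realType} (M x : R) : `|x| <= M -> clip M x = x.
Proof. by rewrite /clip ler_norml /Num.max /Num.min => /andP[Mx1 Mx2]; case: (ltP x M) => xM; case: ltP; lra. Qed.

Section law_of_large_numbers.
Context {d : measure_display} {T : measurableType d} {R : realType}.
Variable P : probability T R.
Context {d' : measure_display} {T' : measurableType d'}.
Variable X : nat -> T -> T'.
Hypothesis mX : forall a, measurable_fun [set: T] (X a).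
Hypothesis indX : forall (n : nat) (A : nat -> set T'),
  (forall a, measurable (A a)) ->
  P (\bigcap_(a < n) (X a @^-1` A a)) = (\prod_(a < n) P (X a @^-1` A a))%E.
Hypothesis identX : forall a (A : set T'), measurable A ->
  P (X 0%N @^-1` A) = P (X a @^-1` A).

(** Clip the summands at a level that leaves a remainder of small mean absolute
  value. The clipped and centred summands are bounded, hence their average has
  variance of order [n%:R^-1]; the remainder is controlled in mean, uniformly
  in [n]. *)
Lemma weak_lln (h : T' -> R) (mu : R) : measurable_fun [set: T'] h ->
  integr P (fun w => h (X 0%N w)) -> Ex P (fun w => h (X 0%N w)) = mu ->
  to0_in_prob P (fun n w => n%:R^-1 * (\sum_(a < n) h (X a w)) - mu).
Proof.
move=> mh ih hmu.
have mc (M : R) : measurable_fun [set: T'] (fun x => clip M (h x)).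
  by apply: measurable_maxr => //; exact: measurable_minr.
have mr (M : R) : measurable_fun [set: T'] (fun x => h x - clip M (h x)).
  exact: measurable_funB.
have mhX a (g : T' -> R) : measurable_fun [set: T'] g ->
    measurable_fun [set: T] (fun w => g (X a w)).
  by move=> mg; exact: (measurableT_comp mg).
have rest0 : Ex P (fun w => `|h (X 0%N w) - clip M%:R (h (X 0%N w))|) @[M --> \oo] --> Ex P (fun=> 0).
  apply: (@Ex_dominated _ _ _ P (fun (M : nat) w => `|h (X 0%N w) - clip M%:R (h (X 0%N w))|)
    _ (fun w => `|h (X 0%N w)|)) => [M|w||M w].
  - by apply: measurableT_comp => //; exact: (mhX 0%N _ (mr M%:R)).
  - apply: cvg_near_cst; near=> M; rewrite clip_id ?subrr ?normr0//.
    by near: M; exact: nbhs_infty_ger.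
  - exact: integr_abs.
  - by rewrite normr_id; exact: clip_err.
rewrite Ex_cst in rest0.
have inv0 : n%:R^-1 @[n --> \oo] --> (0 : R).
  by rewrite -(cvg_shiftS (fun n => n%:R^-1 : R)); exact: cvg_harmonic.
have iY n : integr P (fun w => n%:R^-1 * (\sum_(a < n) h (X a w)) - mu).
  apply: integrB; last exact: integr_cst.
  apply: integrZ; apply: integr_sum => a.
  by have [] := Ex_ident mX identX a mh ih.
apply: to0_in_prob_L1 => [n|]; first exact: integr_abs.
apply/cvgr0Pnorm_le => eps e0.
have e4 : 0 < eps / 4 by rewrite divr_gt0.
have [M _ restM] : \forall M \near \oo, Ex P (fun w => `|h (X 0%N w) - clip M%:R (h (X 0%N w))|) <= eps / 4.
  by apply: filterS (cvgr_le 0 rest0 _ e4).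
have {}restM := restM M (leqnn M).
pose c x := clip M%:R (h x); pose r x := h x - c x.
have cM x : `|c x| <= M%:R by exact: clip_norm.
have icX a : integr P (fun w => c (X a w)) := integr_bounded P (mhX a _ (mc _)) (fun w => cM _).
pose nu := Ex P (fun w => c (X 0%N w)).
have nuM : `|nu| <= M%:R by exact: norm_Ex_bounded (mhX _ _ (mc _)) (fun w => cM _).
pose u (a : nat) x := c x - nu.
have mu_ a : measurable_fun [set: T'] (u a) by apply: (measurable_funB (mc M%:R)); exact: measurable_cst.
have uM x a : `|u a x| <= 2 * M%:R.
  by apply: (le_trans (ler_normB _ _)); rewrite mulr_natl mulr2n; exact: lerD.
have u2M x a : `|u a x ^+ 2| <= (2 * M%:R) ^+ 2 by rewrite normrX; apply: lerXn2r; [exact: normr_ge0|exact: mulr_ge0|exact: uM].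
have mu2X a : measurable_fun [set: T] (fun w => u a (X a w) ^+ 2).
  by apply: measurable_funX; exact: mhX.
have iu2 a : integr P (fun w => u a (X a w) ^+ 2) :=
  integr_bounded P (mu2X a) (fun w => u2M _ _).
have u_mean0 a : Ex P (fun w => u a (X a w)) = 0.
  rewrite ExB ?Ex_cst//; last exact: integr_cst.
  by have [_ ->] := Ex_ident mX identX a (mc M%:R) (icX 0%N); rewrite subrr.
have iabsr a : integr P (fun w => `|r (X a w)|) /\
    Ex P (fun w => `|r (X a w)|) = Ex P (fun w => `|r (X 0%N w)|).
  apply: (@Ex_ident _ _ _ _ _ _ X mX identX (fun x => `|r x|)).
    by apply: measurableT_comp => //; exact: mr.
  by apply: integr_abs; exact: integrB.
near=> n.
have n0 : (0 < n%:R :> R) by rewrite ltr0n; near: n; exists 1%N.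
have [_ iU EU] := sum_past_moment mX indX mu_ iu2 u_mean0 n.
have EU_le : Ex P (fun w => (\sum_(a < n) u a (X a w)) ^+ 2) <= n%:R * (2 * M%:R) ^+ 2.
  rewrite EU mulr_natl -[n in _ *+ n]card_ord -sumr_const; apply: ler_sum => a _.
  by rewrite (le_trans (ler_norm _))//; exact: (norm_Ex_bounded P (mu2X a) (fun w => u2M _ _)).
rewrite ger0_norm; last exact: Ex_ge0.
(* The square enters through [z <= z ^+ 2 / eps + eps / 4], which avoids square
   roots of second moments. *)
have bound w : `|n%:R^-1 * (\sum_(a < n) h (X a w)) - mu| <=
    eps^-1 * n%:R^-2 * (\sum_(a < n) u a (X a w)) ^+ 2 + eps / 4 +
    n%:R^-1 * (\sum_(a < n) `|r (X a w)|) + `|nu - mu|.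
  have -> : n%:R^-1 * (\sum_(a < n) h (X a w)) - mu =
      n%:R^-1 * (\sum_(a < n) u a (X a w)) + n%:R^-1 * (\sum_(a < n) r (X a w)) + (nu - mu).
    rewrite !sumrB sumr_const card_ord -[nu *+ n]mulr_natl !mulrBr mulKf ?gt_eqF//.
    by ring.
  apply: (le_trans (ler_normD _ _)); rewrite lerD2r.
  apply: (le_trans (ler_normD _ _)); apply: lerD; last first.
    rewrite normrM gtr0_norm ?invr_gt0//; apply: ler_wpM2l; last exact: ler_norm_sum.
    by rewrite invr_ge0 ltW.
  set S := \sum_(a < n) u a (X a w).
  have -> : eps^-1 * n%:R^-2 * S ^+ 2 = eps^-1 * `|n%:R^-1 * S| ^+ 2.
    by rewrite real_normK ?num_real// exprMn exprVn [RHS]mulrA.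
  set z := `|_|; have : 0 <= eps^-1 * (z - eps / 2) ^+ 2.
    by rewrite mulr_ge0 ?sqr_ge0// invr_ge0 ltW.
  have -> : eps^-1 * (z - eps / 2) ^+ 2 = eps^-1 * z ^+ 2 - z + eps / 4.
    by field; rewrite gt_eqF.
  lra.
have isr : integr P (fun w => \sum_(a < n) `|r (X a w)|).
  by apply: integr_sum => a; have [] := iabsr a.
have i1 := integrZ (eps^-1 * n%:R^-2) iU.
have i2 := integrD i1 (integr_cst P (eps / 4)).
have i3 := integrD i2 (integrZ n%:R^-1 isr).
have i4 := integrD i3 (integr_cst P `|nu - mu|).
apply: (le_trans (le_Ex (integr_abs (iY n)) i4 bound)).
rewrite (ExD i3 (integr_cst P _)) (ExD i2 (integrZ _ isr)) (ExD i1 (integr_cst P _)) !Ex_cst.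
rewrite (ExZ _ iU) (ExZ _ isr) Ex_sum; last by move=> a; have [] := iabsr a.
have -> : \sum_(a < n) Ex P (fun w => `|r (X a w)|) = n%:R * Ex P (fun w => `|r (X 0%N w)|).
  rewrite mulr_natl -[n in RHS]card_ord -sumr_const; apply: eq_bigr => a _.
  by have [_ ->] := iabsr a.
rewrite mulKf ?gt_eqF//.
have h4 : `|nu - mu| <= eps / 4.
  apply: le_trans restM; rewrite -hmu distrC -(ExB ih (icX 0%N)).
  by apply: norm_Ex; exact: integrB.
have h1 : eps^-1 * n%:R^-2 * Ex P (fun w => (\sum_(a < n) u a (X a w)) ^+ 2) <= eps / 4.
  apply: (@le_trans _ _ (eps^-1 * n%:R^-2 * (n%:R * (2 * M%:R) ^+ 2))).
    by rewrite ler_wpM2l// mulr_ge0 ?invr_ge0 ?exprn_ge0// ltW.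
  rewrite (_ : _ * _ = eps^-1 * (2 * M%:R) ^+ 2 * n%:R^-1); last by field; rewrite !gt_eqF.
  near: n; apply: (cvgr_le _ _ _ e4).
  by rewrite -[X in _ --> X](mulr0 (eps^-1 * (2 * M%:R) ^+ 2)); exact: cvgMr.
have := restM; rewrite -/(c _) -/(r _); lra.
Unshelve. all: by end_near. Qed.

End law_of_large_numbers.

(** * Weighted sums of independent rows *)

Lemma sqr_sum_le {R : realType} (p : nat) (a : 'I_p -> R) :
  (\sum_j a j) ^+ 2 <= p%:R * \sum_j a j ^+ 2.
Proof.
have -> : (\sum_j a j) ^+ 2 = \sum_i \sum_j a i * a j.
  by rewrite expr2 mulr_suml; apply: eq_bigr => i _; rewrite mulr_sumr.
have -> : p%:R * \sum_j a j ^+ 2 = \sum_i \sum_j (a i ^+ 2 + a j ^+ 2) / 2.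
  under [RHS]eq_bigr => i _ do rewrite -mulr_suml big_split /= sumr_const card_ord.
  rewrite -[RHS]mulr_suml big_split /= sumr_const card_ord sumrMnl -mulr_natl.
  by field.
apply: ler_sum => i _; apply: ler_sum => j _.
by have := sqr_ge0 (a i - a j); rewrite sqrrB mulr2n; lra.
Qed.

Lemma gram_sum {R : realType} (m q n : nat) (y : nat -> 'rV[R]_m) (z : nat -> 'rV[R]_q) :
  (rowsmx y n)^T *m rowsmx z n = \sum_(a < n) (y a)^T *m z a.
Proof.
apply/matrixP => i j; rewrite mxE summxE; apply: eq_bigr => a _.
by rewrite !mxE big_ord1 !mxE.
Qed.

Lemma cvg_natVn {R : realType} : (n%:R^-1 : R) @[n --> \oo] --> (0 : R).
Proof. by rewrite -(cvg_shiftS (fun n => n%:R^-1 : R)); exact: cvg_harmonic. Qed.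

(** If the averages [q n] of the squares converge, then [y n ^+ 2 / n.+1 = q
  n.+1 - (1 - n.+1%:R^-1) * q n] tends to 0, which bounds the late terms; the
  finitely many early ones are bounded by a constant. *)
Lemma design_negligible {R : realType} (y : nat -> R) (r delta : R) :
  n%:R^-1 * (\sum_(a < n) y a ^+ 2) @[n --> \oo] --> r -> 0 < delta ->
  \forall n \near \oo, forall a, (a < n)%N -> n%:R^-1 * y a ^+ 2 <= delta.
Proof.
move=> qr d0; pose q n : R := n%:R^-1 * (\sum_(a < n) y a ^+ 2).
have last0 : n.+1%:R^-1 * y n ^+ 2 @[n --> \oo] --> (0 : R).
  have -> : (fun n => n.+1%:R^-1 * y n ^+ 2) =
      fun n => q n.+1 - (1 - n.+1%:R^-1) * q n.
    apply/funext => n; rewrite /q big_ord_recr /=.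
    have [->|n0] := eqVneq n 0%N; first by rewrite !big_ord0 invr0; ring.
    have n0' : n%:R != 0 :> R by rewrite pnatr_eq0.
    have n1 : n.+1%:R != 0 :> R by rewrite pnatr_eq0.
    rewrite (_ : n.+1%:R = n%:R + 1); last by rewrite -natr1.
    by field; rewrite ?n0' ?natr1 ?nat1r ?n1 ?n0'.
  rewrite -[X in _ --> X](subrr r) -[X in _ - X]mul1r -[X in _ - X * _]subr0.
  apply: cvgB; first by rewrite (cvg_shiftS q).
  by apply: cvgM => //; apply: cvgB; [exact: cvg_cst|exact: cvg_harmonic].
have [N _ HN] := cvgr_le 0 last0 _ d0.
pose K : R := \sum_(a < N) y a ^+ 2.
near=> n => a an; have n0 : (0 < n%:R :> R) by rewrite ltr0n (leq_ltn_trans _ an).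
rewrite mulrC ler_pdivrMr//; have [aN|Na] := ltnP a N.
  have yK : y a ^+ 2 <= K.
    rewrite /K (bigD1 (Ordinal aN))//= lerDl; apply: sumr_ge0 => b _; exact: sqr_ge0.
  apply: (le_trans yK); rewrite mulrC -ler_pdivrMr//.
  by near: n; exact: nbhs_infty_ger.
have := HN a Na; rewrite /= mulrC ler_pdivrMr// => /le_trans; apply.
by rewrite ler_pM2l// ler_nat.
Unshelve. all: by end_near. Qed.

Section error_rows.
Context {R : realType} {d : measure_display} {T : measurableType d}.
Variables (P : probability T R) (p : nat) (X : nat -> T -> 'rV[R]_p) (Sigma : 'M[R]_p).
Hypothesis mX : forall a, random_mx (X a).
Hypothesis indX : independent_rows P X.
Hypothesis identX : identically_distributed_rows P X.
Hypothesis iX : forall a j, integr P (fun w => X a w 0 j).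
Hypothesis iX2 : forall a j l, integr P (fun w => X a w 0 j * X a w 0 l).
Hypothesis X_mean : forall a j, Ex P (fun w => X a w 0 j) = 0.
Hypothesis X_cov : forall a j l, Ex P (fun w => X a w 0 j * X a w 0 l) = Sigma j l.

Let bX (a : nat) : T -> borelM (R:=R) 1 p := X a.
Let mbX a : measurable_fun [set: T] (bX a) := random_mx_measurable (mX a).
Let indbX (n : nat) (A : nat -> set (borelM (R:=R) 1 p)) :
  (forall a, measurable (A a)) ->
  P (\bigcap_(a < n) (bX a @^-1` A a)) = (\prod_(a < n) P (bX a @^-1` A a))%E.
Proof. exact: indX. Qed.
Let identbX a (A : set (borelM (R:=R) 1 p)) : measurable A ->
  P (bX 0%N @^-1` A) = P (bX a @^-1` A).
Proof. exact: identX. Qed.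

Lemma measurable_entry (j : 'I_p) : measurable_fun [set: borelM (R:=R) 1 p] (fun v => v 0 j).
Proof. by apply: (continuous_borelM (f := fun v : 'rV[R]_p => v 0 j)); exact: coord_continuous. Qed.

Lemma measurable_linear (t : 'rV[R]_p) : measurable_fun [set: borelM (R:=R) 1 p] (dotv t).
Proof.
by apply: measurable_sum => j; apply: measurable_funM => //; exact: measurable_entry.
Qed.

Lemma lln_products (j l : 'I_p) :
  to0_in_prob P (fun n w => n%:R^-1 * (\sum_(a < n) X a w 0 j * X a w 0 l) - Sigma j l).
Proof.
apply: (weak_lln mbX indbX identbX (h := fun v : borelM 1 p => v 0 j * v 0 l)).
- by apply: measurable_funM; exact: measurable_entry.
- exact: iX2.
- exact: X_cov.
Qed.

Lemma linear_moments (t : 'rV[R]_p) a : [/\ integr P (fun w => dotv t (X a w)),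
  Ex P (fun w => dotv t (X a w)) = 0, integr P (fun w => dotv t (X a w) ^+ 2) &
  Ex P (fun w => dotv t (X a w) ^+ 2) = (t *m Sigma *m t^T) 0 0].
Proof.
have i1 j : integr P (fun w => t 0 j * X a w 0 j) by exact: integrZ.
have i2 j l : integr P (fun w => t 0 j * t 0 l * (X a w 0 j * X a w 0 l)) by exact: integrZ.
have sq : (fun w => dotv t (X a w) ^+ 2) =
    fun w => \sum_j \sum_l t 0 j * t 0 l * (X a w 0 j * X a w 0 l).
  apply/funext => w; rewrite /dotv expr2 mulr_suml; apply: eq_bigr => j _.
  by rewrite mulr_sumr; apply: eq_bigr => l _; ring.
split.
- exact: integr_sum.
- rewrite /dotv Ex_sum//; apply: big1 => j _.
  by rewrite ExZ// X_mean mulr0.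
- by rewrite sq; apply: integr_sum => j; exact: integr_sum.
- rewrite sq Ex_sum; last by move=> j; exact: integr_sum.
  transitivity (\sum_j \sum_l t 0 j * t 0 l * Sigma j l).
    apply: eq_bigr => j _; rewrite Ex_sum//; apply: eq_bigr => l _.
    by rewrite ExZ// X_cov.
  rewrite mxE exchange_big /=; apply: eq_bigr => j _.
  by rewrite !mxE mulr_suml; apply: eq_bigr => l _; ring.
Qed.

Section weighted_sums.
Variables (y : nat -> 'rV[R]_p) (Q : 'M[R]_p).
Hypothesis yQ : mx_cvg \oo (fun n => n%:R^-1 *: ((rowsmx y n)^T *m rowsmx y n)) Q.

Let c (n a : nat) : 'rV[R]_p := (Num.sqrt n%:R)^-1 *: y a.

Let sqrtVn n : (Num.sqrt n%:R : R)^-1 ^+ 2 = n%:R^-1.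
Proof. by rewrite exprVn sqr_sqrtr. Qed.

Let weighted_sumE n w : (Num.sqrt n%:R)^-1 * \sum_(a < n) dotv (y a) (X a w) =
  \sum_(a < n) dotv (c n a) (X a w).
Proof.
rewrite mulr_sumr; apply: eq_bigr => a _.
by rewrite /dotv mulr_sumr; apply: eq_bigr => j _; rewrite mxE mulrA.
Qed.

Let var_sum n : \sum_(a < n) (c n a *m Sigma *m (c n a)^T) 0 0 =
  \tr (n%:R^-1 *: ((rowsmx y n)^T *m rowsmx y n) *m Sigma).
Proof.
rewrite gram_sum scaler_sumr mulmx_suml linear_sum /=; apply: eq_bigr => a _.
rewrite -trace_mx11 mxtrace_mulC mulmxA.
suff -> : (c n a)^T *m c n a = n%:R^-1 *: ((y a)^T *m y a) by [].
by rewrite /c linearZ /= [(_ *: _)^T]linearZ /= -scalemxAl scalerA -expr2 sqrtVn.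
Qed.

Let cvg_var : \sum_(a < n) (c n a *m Sigma *m (c n a)^T) 0 0 @[n --> \oo] --> \tr (Q *m Sigma).
Proof.
rewrite (funext var_sum); apply: cvg_big => [|j _]; first exact: add_continuous.
exact: (mx_cvgM yQ (mx_cvg_cst Sigma) j j).
Qed.

(** Its second moment is the convergent trace [\tr (n^-1 Y'Y Sigma)]. *)
Lemma weighted_sum_bounded :
  bounded_in_prob P (fun n w => (Num.sqrt n%:R)^-1 * \sum_(a < n) dotv (y a) (X a w)).
Proof.
under eq_fun do under eq_fun do rewrite weighted_sumE.
have moment n : integr P (fun w => (\sum_(a < n) dotv (c n a) (X a w)) ^+ 2) /\
    Ex P (fun w => (\sum_(a < n) dotv (c n a) (X a w)) ^+ 2) =
    \sum_(a < n) (c n a *m Sigma *m (c n a)^T) 0 0.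
  have [|a|a|_ iS ES] := sum_past_moment mbX indbX (u := fun a => dotv (c n a)) _ _ _ n.
  - by move=> a; exact: measurable_linear.
  - by have [] := linear_moments (c n a) a.
  - by have [] := linear_moments (c n a) a.
  split => //; rewrite ES; apply: eq_bigr => a _.
  by have [] := linear_moments (c n a) a.
apply: (bounded_in_prob_moment (M := `|\tr (Q *m Sigma)| + 1)) => [n|].
  by have [] := moment n.
under eq_near do rewrite (moment _).2.
apply: (cvgr_le _ cvg_var); apply: (le_lt_trans (ler_norm _)); by rewrite ltrDl.
Unshelve. all: by end_near. Qed.

(** Lindeberg's theorem for the summands [<c n a, X a>], dominated by the l1
  norm of [c n a] times the l1 norm of the row. *)
Lemma weighted_sum_clt :
  Ex P (fun w => cos ((Num.sqrt n%:R)^-1 * \sum_(a < n) dotv (y a) (X a w)))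
    @[n --> \oo] --> normal_char (Num.sqrt (\tr (Q *m Sigma))) /\
  Ex P (fun w => sin ((Num.sqrt n%:R)^-1 * \sum_(a < n) dotv (y a) (X a w)))
    @[n --> \oo] --> (0 : R).
Proof.
have cE (h : R -> R) :
    (fun n => Ex P (fun w => h ((Num.sqrt n%:R)^-1 * \sum_(a < n) dotv (y a) (X a w)))) =
    fun n => Ex P (fun w => h (\sum_(a < n) dotv (c n a) (X a w))).
  by apply/funext => n; congr (Ex P _); apply/funext => w; rewrite weighted_sumE.
rewrite !cE.
pose k n a : R := \sum_j `|c n a 0 j|.
have diag j n : n%:R^-1 * (\sum_(a < n) y a 0 j ^+ 2) =
    (n%:R^-1 *: ((rowsmx y n)^T *m rowsmx y n)) j j.
  by rewrite !mxE; congr (_ * _); apply: eq_bigr => a _; rewrite !mxE expr2.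
have c2 n a j : `|c n a 0 j| ^+ 2 = n%:R^-1 * y a 0 j ^+ 2.
  by rewrite real_normK ?num_real// mxE exprMn sqrtVn.
apply: (lindeberg_clt mbX indbX identbX (N := fun v => \sum_j `|v 0 j|) _ _ _
  (u := fun n a => dotv (c n a)) (k := k) (v := fun n a => (c n a *m Sigma *m (c n a)^T) 0 0)
  (M := p%:R * (\tr Q + 1))).
- by apply: measurable_sum => j; apply: measurableT_comp => //; exact: measurable_entry.
- by move=> v; apply: sumr_ge0.
- have iS : integr P (fun w => p%:R * \sum_j X 0%N w 0 j * X 0%N w 0 j).
    by apply: integrZ; apply: integr_sum => j.
  apply: (integr_le _ iS) => [|w].
    apply: measurable_funX; apply: measurable_sum => j.
    by apply: measurableT_comp => //; exact: mX.
  rewrite ger0_norm ?sqr_ge0//; apply: le_trans (ler_norm _).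
  apply: (le_trans (sqr_sum_le _)); rewrite ler_wpM2l//; apply: ler_sum => j _.
  by rewrite real_normK ?num_real// expr2.
- by move=> n a; exact: measurable_linear.
- by move=> n a; apply: sumr_ge0.
- move=> n a v; rewrite /dotv; apply: (le_trans (ler_norm_sum _ _ _)).
  rewrite /k mulr_suml; apply: ler_sum => j _; rewrite normrM ler_wpM2l//.
  by rewrite (bigD1 j)//= lerDl; apply: sumr_ge0.
- by move=> n a; have [] := linear_moments (c n a) a.
- by move=> n a; have [] := linear_moments (c n a) a.
- have trQ : \tr (n%:R^-1 *: ((rowsmx y n)^T *m rowsmx y n)) @[n --> \oo] --> \tr Q.
    by apply: cvg_big => [|j _]; [exact: add_continuous|exact: yQ].
  have trQ1 : \tr Q < \tr Q + 1 by rewrite ltrDl.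
  apply: filterS (cvgr_le _ trQ _ trQ1) => n nQ.
  apply: (@le_trans _ _ (p%:R * \tr (n%:R^-1 *: ((rowsmx y n)^T *m rowsmx y n)))); last first.
    by rewrite ler_wpM2l.
  apply: (@le_trans _ _ (\sum_(a < n) p%:R * \sum_j `|c n a 0 j| ^+ 2)).
    by apply: ler_sum => a _; exact: sqr_sum_le.
  rewrite -mulr_sumr exchange_big /=; rewrite le_eqVlt; apply/orP; left; apply/eqP.
  congr (_ * _); apply: eq_bigr => j _; rewrite -diag mulr_sumr.
  by apply: eq_bigr => a _; exact: c2.
- move=> delta delta0; have p1 : 0 < p%:R + 1 :> R by rewrite ltr_wpDl.
  pose dlt : R := (delta / (p%:R + 1)) ^+ 2.
  have dlt0 : 0 < dlt by rewrite exprn_gt0// divr_gt0.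
  have small : \forall n \near \oo, forall j a, (a < n)%N -> n%:R^-1 * y a 0 j ^+ 2 <= dlt.
    apply: filter_forall => j; apply: (design_negligible (r := Q j j)) => //.
    by rewrite (funext (diag j)); exact: yQ.
  apply: filterS small => n small a an.
  apply: (@le_trans _ _ (\sum_(j < p) delta / (p%:R + 1))); last first.
    rewrite sumr_const card_ord -[_ *+ p]mulr_natl mulrCA ger_pMr// ler_pdivrMr//.
    by rewrite mul1r lerDl.
  apply: ler_sum => j _; rewrite -(@ler_pXn2r _ 2) ?nnegrE//; last by rewrite divr_ge0 ?(ltW delta0) ?(ltW p1).
  by rewrite c2; exact: small.
- exact: cvg_var.
Qed.

End weighted_sums.
End error_rows.

(** * Random matrices in probability and algebra of the estimators *)

Section matrices_in_probability.
Context {R : realType} {d : measure_display} {T : measurableType d}.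
Variable P : probability T R.

Definition mx_to0 (m n : nat) (A : nat -> T -> 'M[R]_(m, n)) : Prop :=
  forall i j, to0_in_prob P (fun s w => A s w i j).

Definition mx_bounded (m n : nat) (A : nat -> T -> 'M[R]_(m, n)) : Prop :=
  forall i j, bounded_in_prob P (fun s w => A s w i j).

Lemma to0_in_prob_whp (Y Z : nat -> T -> R) :
  (forall eta, 0 < eta -> whp P eta (fun n w => Y n w = Z n w)) ->
  to0_in_prob P Y -> to0_in_prob P Z.
Proof.
move=> YZ Y0 eps eta e0 eta0; have h2 : 0 < eta / 2 by rewrite divr_gt0.
apply: whp_mono (whp_and (YZ _ h2) (Y0 _ _ e0 h2)); near=> n => w [<-] //.
Unshelve. all: by end_near. Qed.

Lemma whp_near_true (Q : nat -> T -> Prop) : (\forall n \near \oo, forall w, Q n w) ->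
  forall eta, 0 < eta -> whp P eta Q.
Proof. by move=> hQ eta eta0; apply: whp_true => //; exact: ltW. Qed.

Lemma mx_to0_near (m n : nat) (A B : nat -> T -> 'M[R]_(m, n)) :
  (\forall s \near \oo, forall w, A s w = B s w) -> mx_to0 A -> mx_to0 B.
Proof.
move=> AB A0 i j; apply: to0_in_prob_whp (A0 i j); apply: whp_near_true.
by apply: filterS AB => s AB w; rewrite AB.
Qed.

Lemma mx_to0_bounded (m n : nat) (A : nat -> T -> 'M[R]_(m, n)) : mx_to0 A -> mx_bounded A.
Proof. by move=> A0 i j; exact: to0_bounded_in_prob. Qed.

Lemma mx_to0D (m n : nat) (A B : nat -> T -> 'M[R]_(m, n)) :
  mx_to0 A -> mx_to0 B -> mx_to0 (fun s w => A s w + B s w).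
Proof.
move=> A0 B0 i j; under eq_fun do under eq_fun do rewrite mxE.
exact: to0_in_probD.
Qed.

Lemma mx_boundedD (m n : nat) (A B : nat -> T -> 'M[R]_(m, n)) :
  mx_bounded A -> mx_bounded B -> mx_bounded (fun s w => A s w + B s w).
Proof.
move=> A0 B0 i j; under eq_fun do under eq_fun do rewrite mxE.
exact: bounded_in_probD.
Qed.

Lemma mx_to0_sum (m n : nat) (I : Type) (r : seq I) (A : I -> nat -> T -> 'M[R]_(m, n)) :
  (forall l, mx_to0 (A l)) -> mx_to0 (fun s w => \sum_(l <- r) A l s w).
Proof.
move=> A0 i j; under eq_fun do under eq_fun do rewrite summxE.
by apply: to0_in_prob_sum => l; exact: A0.
Qed.

Lemma mx_boundedM (m n p : nat) (A : nat -> T -> 'M[R]_(m, n)) (B : nat -> T -> 'M[R]_(n, p)) :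
  mx_bounded A -> mx_bounded B -> mx_bounded (fun s w => A s w *m B s w).
Proof.
move=> A0 B0 i j; under eq_fun do under eq_fun do rewrite mxE.
by apply: bounded_in_prob_sum => l; exact: bounded_in_probM.
Qed.

Lemma mx_to0Ml (m n p : nat) (A : nat -> T -> 'M[R]_(m, n)) (B : nat -> T -> 'M[R]_(n, p)) :
  mx_to0 A -> mx_bounded B -> mx_to0 (fun s w => A s w *m B s w).
Proof.
move=> A0 B0 i j; under eq_fun do under eq_fun do rewrite mxE.
by apply: to0_in_prob_sum => l; exact: to0_in_probMl.
Qed.

Lemma mx_to0Mr (m n p : nat) (A : nat -> T -> 'M[R]_(m, n)) (B : nat -> T -> 'M[R]_(n, p)) :
  mx_bounded A -> mx_to0 B -> mx_to0 (fun s w => A s w *m B s w).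
Proof.
move=> A0 B0 i j; under eq_fun do under eq_fun do rewrite mxE.
by apply: to0_in_prob_sum => l; exact: to0_in_probMr.
Qed.

Lemma mx_bounded_tr (m n : nat) (A : nat -> T -> 'M[R]_(m, n)) :
  mx_bounded A -> mx_bounded (fun s w => (A s w)^T).
Proof. by move=> A0 i j; under eq_fun do under eq_fun do rewrite mxE; exact: A0. Qed.

Lemma mx_bounded_cvg (m n : nat) (A : nat -> 'M[R]_(m, n)) B :
  mx_cvg \oo A B -> mx_bounded (fun s _ => A s).
Proof. by move=> AB i j; exact: bounded_in_prob_cvg (AB i j). Qed.

Lemma mx_to0_cvg (m n : nat) (A : nat -> 'M[R]_(m, n)) B :
  mx_cvg \oo A B -> mx_to0 (fun s _ => A s - B).
Proof.
move=> AB i j; apply: to0_in_prob_cvg; rewrite -[X in _ --> X](subrr (B i j)).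
by rewrite (_ : (fun s => _) = fun s => A s i j - B i j);
  [apply: cvgB => //; exact: cvg_cst|apply/funext => s; rewrite !mxE].
Qed.

Lemma mx_to0Z (m n : nat) (c : nat -> R) (l : R) (A : nat -> T -> 'M[R]_(m, n)) :
  c s @[s --> \oo] --> l -> mx_to0 A -> mx_to0 (fun s w => c s *: A s w).
Proof.
move=> cl A0 i j; under eq_fun do under eq_fun do rewrite mxE.
by apply: to0_in_probMr => //; exact: bounded_in_prob_cvg cl.
Qed.

Lemma mx_to0Z0 (m n : nat) (c : nat -> R) (A : nat -> T -> 'M[R]_(m, n)) :
  c s @[s --> \oo] --> (0 : R) -> mx_bounded A -> mx_to0 (fun s w => c s *: A s w).
Proof.
move=> cl A0 i j; under eq_fun do under eq_fun do rewrite mxE.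
by apply: to0_in_probMl => //; exact: to0_in_prob_cvg cl.
Qed.

(** Entrywise closeness with high probability puts the random matrix in any
  neighbourhood of the limit. *)
Lemma whp_near (m n : nat) (A : nat -> T -> 'M[R]_(m, n)) (B : 'M[R]_(m, n)) (Q : 'M[R]_(m, n) -> Prop) :
  mx_to0 (fun s w => A s w - B) -> (\forall M \near B, Q M) ->
  forall eta, 0 < eta -> whp P eta (fun s w => Q (A s w)).
Proof.
move=> AB /nbhs_ballP[e /= e0 eQ] eta eta0; have e2 : 0 < e / 2 by rewrite divr_gt0.
have := whp_forall (fun (ij : 'I_m * 'I_n) eta (eta0 : 0 < eta) => AB ij.1 ij.2 _ _ e2 eta0) eta0.
apply: whp_mono; near=> s => w ABw; apply: eQ; split => // i j; have := ABw (i, j); rewrite !mxE /=.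
rewrite /ball /= distrC => /le_lt_trans; apply.
by rewrite ltr_pdivrMr// ltr_pMr// ltr1n.
Unshelve. all: by end_near. Qed.

(** The continuous mapping principle at a constant limit. *)
Lemma mx_to0_continuous (m n m' n' : nat) (A : nat -> T -> 'M[R]_(m, n)) (B : 'M[R]_(m, n))
    (f : 'M[R]_(m, n) -> 'M[R]_(m', n')) :
  mx_to0 (fun s w => A s w - B) -> mx_cvg (nbhs B) f (f B) ->
  mx_to0 (fun s w => f (A s w) - f B).
Proof.
move=> AB fB i j eps eta e0 eta0.
apply: (whp_near (Q := fun M => `|(f M - f B) i j| <= eps) AB _ eta0).
have /cvgrPdist_le/(_ _ e0) := fB i j; apply: filterS => M.
by rewrite !mxE distrC.
Qed.

End matrices_in_probability.

Section estimator.
Context {R : realType}.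

Lemma posdefmx1 (n : nat) : posdefmx (1%:M : 'M[R]_n).
Proof.
split=> [|v v0]; first by rewrite trmx1.
rewrite mulmx1 mxE; have [j vj] : exists j, v j 0 != 0.
  apply/existsP; apply: contraNT v0; rewrite negb_exists => /forallP v0.
  by apply/eqP/colP => j; rewrite mxE; apply/eqP; rewrite -[_ == _]negbK.
rewrite (bigD1 j)//= mxE -expr2 ltr_wpDr//; last by rewrite exprn_even_gt0.
by apply: sumr_ge0 => l _; rewrite mxE -expr2 sqr_ge0.
Qed.

Lemma gram_posdef (n m : nat) (X : 'M[R]_(n, m)) : \rank X = m -> posdefmx (X^T *m X).
Proof. by move=> rX; have := posdefmx_congr rX (posdefmx1 n); rewrite mulmx1. Qed.

Lemma gram_unit (n m : nat) (X : 'M[R]_(n, m)) : \rank X = m -> X^T *m X \in unitmx.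
Proof. by move=> rX; exact/posdefmx_unit/gram_posdef. Qed.

(** Row vectors multiplied by [gls Z S] give the generalized least squares
  coefficients on the columns of [Z] when the covariance is [S]; it is the
  right inverse of [Z^T] used by the estimator. *)
Definition gls (p q : nat) (Z : 'M[R]_(p, q)) (S : 'M[R]_p) : 'M[R]_(p, q) :=
  invmx S *m Z *m invmx (Z^T *m invmx S *m Z).

Lemma gls_cvg (p q : nat) (Z : 'M[R]_(p, q)) (S : 'M[R]_p) : \rank Z = q -> posdefmx S ->
  mx_cvg (nbhs S) (gls Z) (gls Z S).
Proof.
move=> rZ pS; have uS := posdefmx_unit pS.
have uZ := posdefmx_unit (posdefmx_congr rZ (posdefmx_inv pS)).
have ci : mx_cvg (nbhs S) invmx (invmx S) by exact: (mx_cvg_inv (mx_cvg_id S) uS).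
have cZ : mx_cvg (nbhs S) (fun S' => Z^T *m invmx S' *m Z) (Z^T *m invmx S *m Z).
  exact: (mx_cvgM (mx_cvgM (mx_cvg_cst Z^T) ci) (mx_cvg_cst Z)).
exact: (mx_cvgM (mx_cvgM ci (mx_cvg_cst Z)) (mx_cvg_inv cZ uZ)).
Qed.

Lemma near_gls_units (p q : nat) (Z : 'M[R]_(p, q)) (S : 'M[R]_p) : \rank Z = q -> posdefmx S ->
  \forall S' \near S, Z^T *m invmx S' *m Z \in unitmx.
Proof.
move=> rZ pS; have uS := posdefmx_unit pS.
have uZ := posdefmx_unit (posdefmx_congr rZ (posdefmx_inv pS)).
have ci : mx_cvg (nbhs S) invmx (invmx S) by exact: (mx_cvg_inv (mx_cvg_id S) uS).
exact: (near_unitmx (mx_cvgM (mx_cvgM (mx_cvg_cst Z^T) ci) (mx_cvg_cst Z)) uZ).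
Qed.

(** The covariance of the generalized least squares coefficients. *)
Lemma gls_var (p q : nat) (Z : 'M[R]_(p, q)) (S : 'M[R]_p) : \rank Z = q -> posdefmx S ->
  (gls Z S)^T *m S *m gls Z S = invmx (Z^T *m invmx S *m Z).
Proof.
move=> rZ pS; have uS := posdefmx_unit pS.
have [sV _] := posdefmx_inv pS; have pZ := posdefmx_congr rZ (posdefmx_inv pS).
have uZ := posdefmx_unit pZ; have [sZ _] := posdefmx_inv pZ.
rewrite /gls !trmx_mul sZ sV -!mulmxA mulKVmx//.
by rewrite -[RHS]mul1mx -(mulVmx uZ) !mulmxA.
Qed.

Section fixed_sample_size.
Context {k p n : nat} {m q : 'I_k -> nat}.
Variables (X : forall l : 'I_k, 'M[R]_(n, m l)) (Z : forall l, 'M[R]_(p, q l)).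
Variables (Theta : forall l, 'M[R]_(m l, q l)) (E : 'M[R]_(n, p)).
Hypothesis rX : forall l, \rank (X l) = m l.
Hypothesis orthX : forall l l', l != l' -> (X l)^T *m X l' = 0.

Let uX l : (X l)^T *m X l \in unitmx. Proof. exact: gram_unit. Qed.

Let resid : 'M[R]_n := 1%:M - \sum_(l < k) projmx (X l).

Let proj_design l l' : projmx (X l') *m X l = if l' == l then X l else 0.
Proof.
rewrite projmxE//; have [->|ll] := eqVneq l' l; first by rewrite -mulmxA mulmxKV.
by rewrite -mulmxA (orthX ll) mulmx0.
Qed.

Let resid_design l : resid *m X l = 0.
Proof.
rewrite /resid mulmxBl mul1mx mulmx_suml (bigD1 l)//= proj_design eqxx big1 ?addr0 ?subrr//.
by move=> l' ll; rewrite proj_design (negbTE ll).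
Qed.

Let proj_sym l : (projmx (X l))^T = projmx (X l).
Proof. by rewrite projmxE// !trmx_mul trmx_inv trmx_mul trmxK mulmxA. Qed.

Let resid_sym : resid^T = resid.
Proof.
rewrite /resid linearB /= trmx1 linear_sum /=; congr (_ - _).
by apply: eq_bigr => l _; exact: proj_sym.
Qed.

(** The weight matrix is a multiple of the projection orthogonal to all design
  columns, by orthogonality of the designs, so the mean of the observations
  drops out on both sides. *)
Lemma Sigma_hat_error : Sigma_hat X (observation X Z Theta E) =
  (n%:R - \sum_(l < k) (m l)%:R)^-1 *:
  (E^T *m E - \sum_(l < k) ((X l)^T *m E)^T *m invmx ((X l)^T *m X l) *m ((X l)^T *m E)).
Proof.
have rs : \sum_(l < k) (\rank (X l))%:R = \sum_(l < k) (m l)%:R :> R.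
  by apply: eq_bigr => l _; rewrite rX.
rewrite /Sigma_hat /weightmx rs -/resid -scalemxAr -scalemxAl; congr (_ *: _).
have rY : resid *m observation X Z Theta E = resid *m E.
  rewrite /observation mulmxDr mulmx_sumr big1 ?add0r// => l _.
  by rewrite !mulmxA resid_design !mul0mx.
have Yr : (observation X Z Theta E)^T *m resid = E^T *m resid.
  by rewrite -resid_sym -!trmx_mul rY.
rewrite Yr -mulmxA rY.
rewrite /resid mulmxBl mul1mx mulmxBr; congr (_ - _).
rewrite mulmx_suml mulmx_sumr; apply: eq_bigr => l _.
by rewrite projmxE// trmx_mul trmxK !mulmxA.
Qed.

(** Orthogonality removes the other designs, and [(Z i)^T *m gls (Z i) S =
  1%:M] returns [Theta i] exactly, so that no error of [S] enters the mean. *)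
Lemma Theta_hat_error (i : 'I_k) (S := Sigma_hat X (observation X Z Theta E)) :
  \rank (Z i) = q i -> (Z i)^T *m invmx S *m Z i \in unitmx ->
  Theta_hat X Z i (observation X Z Theta E) - Theta i =
  invmx ((X i)^T *m X i) *m ((X i)^T *m E) *m gls (Z i) S.
Proof.
move=> rZ uZ; have uZZ := gram_unit rZ.
have XY : invmx ((X i)^T *m X i) *m (X i)^T *m observation X Z Theta E =
    Theta i *m (Z i)^T + invmx ((X i)^T *m X i) *m ((X i)^T *m E).
  rewrite /observation mulmxDr -[in X in _ + X]mulmxA; congr (_ + _).
  rewrite mulmx_sumr (bigD1 i)//= big1 ?addr0; last first.
    move=> l; rewrite eq_sym => il.
    by rewrite !mulmxA -[_ *m _ *m X l]mulmxA (orthX il) mulmx0 !mul0mx.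
  by rewrite !mulmxA -[_ *m _ *m X i]mulmxA mulVmx// mul1mx.
rewrite /Theta_hat XY /Hmx -/S.
have -> : forall B : 'M[R]_(m i, p), B *m (invmx S *m Z i *m invmx ((Z i)^T *m invmx S *m Z i) *m (Z i)^T) *m
    Z i *m invmx ((Z i)^T *m Z i) = B *m gls (Z i) S.
  by move=> B; rewrite -[RHS]mulmx1 -(mulmxV uZZ) /gls !mulmxA.
have ZG : (Z i)^T *m gls (Z i) S = 1%:M by rewrite /gls !mulmxA mulmxV.
by rewrite mulmxDl -mulmxA ZG mulmx1 addrAC subrr add0r.
Qed.

End fixed_sample_size.
End estimator.

(** * Asymptotics of the estimators *)

Lemma quadratic_scale {R : realType} (m p : nat) (a b : R) (S : 'M[R]_(m, p)) (A : 'M[R]_m) :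
  (a *: S)^T *m (b *: A) *m (a *: S) = (a ^+ 2 * b) *: (S^T *m A *m S).
Proof.
rewrite [(a *: S)^T]linearZ /= -scalemxAr -!scalemxAl -scalemxAr -scalemxAl !scalerA.
by congr (_ *: _); ring.
Qed.

Lemma product_scale {R : realType} (m p q : nat) (a b : R) (A : 'M[R]_m) (S : 'M[R]_(m, p))
    (G : 'M[R]_(p, q)) :
  a *: ((b *: A) *m (a *: S) *m G) = (a ^+ 2 * b) *: (A *m S *m G).
Proof. by rewrite -scalemxAr -!scalemxAl !scalerA; congr (_ *: _); ring. Qed.

Section growth_curve.
Context {R : realType} {d : measure_display} {Omega : measurableType d}.
Variables (P : probability Omega R) (k p : nat) (m q : 'I_k -> nat).
Variables (x : forall l : 'I_k, nat -> 'rV[R]_(m l)) (Z : forall l : 'I_k, 'M[R]_(p, q l)).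
Variables (Theta : forall l : 'I_k, 'M[R]_(m l, q l)) (erow : nat -> Omega -> 'rV[R]_p).
Variables (Sigma : 'M[R]_p) (Rlim : forall l : 'I_k, 'M[R]_(m l)) (n0 : nat).
Hypothesis merow : forall a, random_mx (erow a).
Hypothesis indep : independent_rows P erow.
Hypothesis ident : identically_distributed_rows P erow.
Hypothesis ierow : forall a j, integr P (fun w => erow a w 0 j).
Hypothesis ierow2 : forall a j l, integr P (fun w => erow a w 0 j * erow a w 0 l).
Hypothesis erow_mean : forall a j, Ex P (fun w => erow a w 0 j) = 0.
Hypothesis erow_cov : forall a j l, Ex P (fun w => erow a w 0 j * erow a w 0 l) = Sigma j l.
Let X (n : nat) (l : 'I_k) : 'M[R]_(n, m l) := rowsmx (x l) n.
Let E (n : nat) (w : Omega) : 'M[R]_(n, p) := rowsmx (fun a => erow a w) n.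
Let Y (n : nat) (w : Omega) : 'M[R]_(n, p) := observation (X n) Z Theta (E n w).
Hypothesis rX : forall n l, (n0 <= n)%N -> \rank (X n l) = m l.
Hypothesis rZ : forall l, \rank (Z l) = q l.
Hypothesis pSigma : posdefmx Sigma.
Hypothesis orthX : forall n l l', (n0 <= n)%N -> l != l' -> (X n l)^T *m X n l' = 0.
Hypothesis pRlim : forall l, posdefmx (Rlim l).
Hypothesis cvgR : forall l, mx_cvg \oo (fun n => n%:R^-1 *: ((X n l)^T *m X n l)) (Rlim l).

Let A (n : nat) (l : 'I_k) : 'M[R]_(m l) := invmx (n%:R^-1 *: ((X n l)^T *m X n l)).
Let S (l : 'I_k) (n : nat) (w : Omega) : 'M[R]_(m l, p) :=
  (Num.sqrt n%:R)^-1 *: ((X n l)^T *m E n w).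

Let cvgA l : mx_cvg \oo (fun n => A n l) (invmx (Rlim l)).
Proof. exact: (mx_cvg_inv (@cvgR l) (posdefmx_unit (pRlim l))). Qed.

Let invgram n l : (n0 <= n)%N -> (0 < n)%N ->
  invmx ((X n l)^T *m X n l) = n%:R^-1 *: A n l.
Proof.
move=> n0n n1; have nz : n%:R != 0 :> R by rewrite pnatr_eq0 -lt0n.
rewrite /A invmxZ ?unitmxZ ?unitfE ?invr_eq0//; last exact/gram_unit/rX.
by rewrite invrK scalerA mulVf// scale1r.
Qed.

Let scoreE n l w : (0 < n)%N -> (X n l)^T *m E n w = Num.sqrt n%:R *: S l n w.
Proof. by move=> n1; rewrite /S scalerA divff ?scale1r// sqrtr_eq0 -ltNge ltr0n. Qed.

Lemma trace_score l (B : 'M[R]_(m l, p)) n w :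
  \tr (B^T *m S l n w) = (Num.sqrt n%:R)^-1 * \sum_(a < n) dotv (x l a *m B) (erow a w).
Proof.
rewrite /S -scalemxAr linearZ /=; congr (_ * _).
rewrite /X /E (gram_sum n (x l) (fun a => erow a w)) mulmx_sumr linear_sum /=.
apply: eq_bigr => a _; rewrite mulmxA -trmx_mul mxtrace_mulC trace_mx11 mxE.
by apply: eq_bigr => j _; rewrite [_^T _ _]mxE mulrC.
Qed.

Lemma cvg_weighted_gram l (B : 'M[R]_(m l, p)) :
  mx_cvg \oo (fun n => n%:R^-1 *: ((rowsmx (fun a => x l a *m B) n)^T *m
    rowsmx (fun a => x l a *m B) n)) (B^T *m Rlim l *m B).
Proof.
have -> : (fun n => n%:R^-1 *: ((rowsmx (fun a => x l a *m B) n)^T *m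
    rowsmx (fun a => x l a *m B) n)) =
    fun n => B^T *m (n%:R^-1 *: ((X n l)^T *m X n l)) *m B.
  apply/funext => n; have -> : rowsmx (fun a => x l a *m B) n = X n l *m B.
    by apply/row_matrixP => a; rewrite row_mul !rowK.
  by rewrite trmx_mul -scalemxAr -scalemxAl !mulmxA.
exact: (mx_cvgM (mx_cvgM (mx_cvg_cst B^T) (@cvgR l)) (mx_cvg_cst B)).
Qed.

(** An entry of the score [S l = n^(-1/2) X_l' E] is its trace against an
  elementary matrix, hence a weighted sum of rows. *)
Lemma score_bounded l : mx_bounded P (S l).
Proof.
move=> mu j; pose B : 'M[R]_(m l, p) := delta_mx mu j.
have -> : (fun n w => S l n w mu j) =
    fun n w => (Num.sqrt n%:R)^-1 * \sum_(a < n) dotv (x l a *m B) (erow a w).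
  apply/funext => n; apply/funext => w; rewrite -trace_score trmx_delta.
  rewrite /mxtrace (bigD1 j)//= big1 ?addr0 => [|i ij]; last first.
    by rewrite mxE big1// => a _; rewrite mxE (negbTE ij) mul0r.
  rewrite [RHS]mxE (bigD1 mu)//= big1 ?addr0 => [|a am]; first by rewrite [delta_mx _ _ _ _]mxE !eqxx mul1r.
  by rewrite mxE (negbTE am) andbF mul0r.
exact: (weighted_sum_bounded merow indep ierow ierow2 erow_mean erow_cov
  (@cvg_weighted_gram l B)).
Qed.

Let c (n : nat) : R := n%:R * (n%:R - \sum_(l < k) (m l)%:R)^-1.

Let cvg_c : c n @[n --> \oo] --> (1 : R).
Proof.
pose M : R := \sum_(l < k) (m l)%:R.
have lim1 : (1 - M * n%:R^-1)^-1 @[n --> \oo] --> (1 - M * 0 : R)^-1.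
  apply: cvgV; first by rewrite mulr0 subr0 oner_eq0.
  by apply: cvgB; [exact: cvg_cst|apply: cvgMr; exact: cvg_natVn].
rewrite mulr0 subr0 invr1 in lim1.
apply: cvg_trans lim1; apply: near_eq_cvg; exists 1%N => // n /= n1.
have nz : n%:R != 0 :> R by rewrite pnatr_eq0 -lt0n.
by rewrite /c -/M -[RHS]invrK invf_div mulrBl divff.
Qed.

(** In [Sigma_hat_error] the Gram matrix of the errors, divided by [n],
  converges by the law of large numbers; the projections on the designs are
  [n^-1 S' A S] with [S] bounded in probability and [A] convergent, and the
  degrees of freedom are equivalent to [n]. *)
Lemma Sigma_hat_consistent :
  mx_to0 P (fun n w => Sigma_hat (X n) (Y n w) - Sigma).
Proof.
have EE0 : mx_to0 P (fun n w => n%:R^-1 *: ((E n w)^T *m E n w) - Sigma).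
  move=> j l; have := lln_products merow indep ident ierow2 erow_cov j l.
  congr (to0_in_prob P _); apply/funext => n; apply/funext => w; rewrite !mxE.
  by congr (_ * _ - _); apply: eq_bigr => a _; rewrite !mxE.
have proj0 l : mx_to0 P (fun n w => (- n%:R^-1) *: ((S l n w)^T *m A n l *m S l n w)).
  apply: (mx_to0Z0 (c := fun n => - n%:R^-1)).
    by rewrite -[X in _ --> X]oppr0; apply: cvgN; exact: cvg_natVn.
  have bS := @score_bounded l; have bA := mx_bounded_cvg P (@cvgA l).
  exact: (mx_boundedM (mx_boundedM (mx_bounded_tr bS) bA) bS).
have c0 : mx_to0 P (fun n (_ : Omega) => (c n - 1) *: Sigma).
  apply: (mx_to0Z0 (c := fun n => c n - 1)).
    by rewrite -[X in _ --> X](subrr 1); apply: cvgB; [exact: cvg_c|exact: cvg_cst].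
  exact: (mx_bounded_cvg P (mx_cvg_cst Sigma)).
have := mx_to0D (mx_to0Z cvg_c (mx_to0D EE0 (mx_to0_sum (index_enum 'I_k) proj0))) c0.
apply: mx_to0_near; exists (maxn n0 1) => // n /=; rewrite geq_max => /andP[n0n n1] w.
have nz : n%:R != 0 :> R by rewrite pnatr_eq0 -lt0n.
rewrite /Y Sigma_hat_error; [|by move=> l; exact: rX|by move=> l l'; exact: orthX].
have -> : (n%:R - \sum_(l < k) (m l)%:R)^-1 = c n * n%:R^-1 by rewrite /c mulrAC divff// mul1r.
rewrite -[(c n / _) *: _]scalerA.
have -> : n%:R^-1 *: ((E n w)^T *m E n w - \sum_(l < k) ((X n l)^T *m E n w)^T *m
    invmx ((X n l)^T *m X n l) *m ((X n l)^T *m E n w)) =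
    n%:R^-1 *: ((E n w)^T *m E n w) +
    \sum_(l < k) - n%:R^-1 *: ((S l n w)^T *m A n l *m S l n w).
  rewrite scalerBr scaler_sumr -sumrN; congr (_ + _); apply: eq_bigr => l _.
  rewrite scoreE// invgram// quadratic_scale sqr_sqrtr// divff// scale1r.
  by rewrite scaleNr.
set a := n%:R^-1 *: _; set b := \sum_(l < k) _.
by rewrite addrAC scalerBr scalerBl scale1r addrA subrK.
Qed.

Variable i : 'I_k.

Let T_ (n : nat) (w : Omega) : 'M[R]_(m i, q i) :=
  Num.sqrt n%:R *: (Theta_hat (X n) Z i (Y n w) - Theta i).
Let L (n : nat) (w : Omega) : 'M[R]_(m i, q i) :=
  invmx (Rlim i) *m S i n w *m gls (Z i) Sigma.
Let G (n : nat) (w : Omega) := gls (Z i) (Sigma_hat (X n) (Y n w)).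

Let whp_estimator eta : 0 < eta -> whp P eta (fun n w => T_ n w = A n i *m S i n w *m G n w).
Proof.
move=> eta0; have nu := near_gls_units (rZ i) pSigma.
have := whp_near Sigma_hat_consistent nu eta0.
apply: whp_mono; exists (maxn n0 1) => // n /=; rewrite geq_max => /andP[n0n n1] w uZ.
rewrite /T_ /Y Theta_hat_error; [|by move=> l; exact: rX|by move=> l l'; exact: orthX|exact: rZ|exact: uZ].
rewrite scoreE// invgram// product_scale sqr_sqrtr// divff ?scale1r//.
by rewrite pnatr_eq0 -lt0n.
Qed.

(** Replace first the estimated covariance and then the Gram matrix by their
  limits; the score is bounded in probability. *)
Lemma estimator_linearization : mx_to0 P (fun n w => T_ n w - L n w).
Proof.
have G0 : mx_to0 P (fun n w => G n w - gls (Z i) Sigma).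
  exact: mx_to0_continuous Sigma_hat_consistent (@gls_cvg _ _ _ _ _ (rZ i) pSigma).
have bS := @score_bounded i; have bA := mx_bounded_cvg P (@cvgA i).
have A0 := mx_to0_cvg P (@cvgA i).
have bG : mx_bounded P (fun (_ : nat) (_ : Omega) => gls (Z i) Sigma).
  exact: (mx_bounded_cvg P (mx_cvg_cst (gls (Z i) Sigma))).
have h1 := mx_to0Mr (mx_boundedM bA bS) G0.
have h2 := mx_to0Ml (mx_to0Ml A0 bS) bG.
move=> a b; apply: to0_in_prob_whp (mx_to0D h1 h2 a b) => eta eta0.
apply: whp_mono (whp_estimator eta0); near=> n => w ->.
by rewrite /L mulmxBr !mulmxBl addrA subrK.
Unshelve. all: by end_near. Qed.

Lemma estimator_bounded : mx_bounded P T_.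
Proof.
have bL : mx_bounded P L.
  apply: mx_boundedM; last exact: (mx_bounded_cvg P (mx_cvg_cst (gls (Z i) Sigma))).
  apply: mx_boundedM; last exact: score_bounded.
  exact: (mx_bounded_cvg P (mx_cvg_cst (invmx (Rlim i)))).
have := mx_boundedD (mx_to0_bounded estimator_linearization) bL.
by congr (mx_bounded P _); apply/funext => n; apply/funext => w; rewrite subrK.
Qed.

(** The linear form [t] of the linearization is the trace of the score against
  the fixed matrix [B], to which [weighted_sum_clt] applies. *)
Lemma linearization_clt (t : 'rV[R]_(m i * q i))
    (s2 := (t *m (invmx (Rlim i) *t invmx ((Z i)^T *m invmx Sigma *m Z i)) *m t^T) 0 0) :
  Ex P (fun w => cos (dotv t (mxvec (L n w)))) @[n --> \oo] --> normal_char (Num.sqrt s2) /\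
  Ex P (fun w => sin (dotv t (mxvec (L n w)))) @[n --> \oo] --> (0 : R).
Proof.
pose tau := vec_mx t; pose Ri := invmx (Rlim i).
pose B := (gls (Z i) Sigma *m tau^T *m Ri)^T.
have [sRi _] := posdefmx_inv (pRlim i).
have dotE n w : dotv t (mxvec (L n w)) =
    (Num.sqrt n%:R)^-1 * \sum_(a < n) dotv (x i a *m B) (erow a w).
  rewrite -trace_score dotv_mxvec /L /B trmxK mulmxA mxtrace_mulC !mulmxA.
  by [].
have s2E : s2 = \tr (B^T *m Rlim i *m B *m Sigma).
  rewrite /s2 tens_quadratic_form -(gls_var (rZ i) pSigma) /B trmxK.
  move: (gls (Z i) Sigma) => g; rewrite !trmx_mul trmxK sRi -/Ri -/tau.
  have -> : g *m tau^T *m Ri *m Rlim i *m (Ri *m (tau *m g^T)) = g *m (tau^T *m Ri *m tau *m g^T).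
    by rewrite -!mulmxA (mulKVmx (posdefmx_unit (pRlim i))).
  by rewrite -[in RHS]mulmxA [in RHS]mxtrace_mulC !mulmxA.
have [c1 c2] := weighted_sum_clt merow indep ident ierow ierow2 erow_mean erow_cov
  (@cvg_weighted_gram i B).
have LE (h : R -> R) : (fun n => Ex P (fun w => h (dotv t (mxvec (L n w))))) =
    fun n => Ex P (fun w => h ((Num.sqrt n%:R)^-1 * \sum_(a < n) dotv (x i a *m B) (erow a w))).
  by apply/funext => n; congr (Ex P _); apply/funext => w; rewrite dotE.
by rewrite s2E !LE.
Qed.

End growth_curve.

(** * Gaussian matrices *)

Lemma continuous_vec_mx {R : realType} (m n : nat) : continuous (@vec_mx R m n).
Proof.
move=> v A /nbhs_ballP[e /= e0 eA]; rewrite nbhs_simpl /=.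
apply/nbhs_ballP; exists e => // u [_ vu]; apply: eA.
by split=> // i j; rewrite !mxE; exact: vu.
Qed.

Lemma gaussian_vector {R : realType} (N : nat) (K : 'M[R]_N) :
  exists (d : measure_display) (T : measurableType d) (P : probability T R) (G : T -> 'rV[R]_N),
    random_mx G /\
    forall t, has_normal_law P (fun w => dotv t (G w)) ((t *m (K *m K^T) *m t^T) 0 0).
Proof.
have [d [T [P [g gN]]]] := gaussian_family (R := R) N.
exists d, T, P, (fun w => \row_k \sum_l K k l * g l w); split=> [i k|t].
  have [mg _] := gN (K k).
  by rewrite (_ : (fun w => _) = fun w => \sum_l K k l * g l w)//; apply/funext => w; rewrite mxE.
have -> : (t *m (K *m K^T) *m t^T) 0 0 = \sum_l (t *m K) 0 l ^+ 2.
  rewrite !mulmxA -[_ *m K^T *m _]mulmxA -trmx_mul mxE; apply: eq_bigr => l _.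
  by rewrite [_^T _ _]mxE expr2.
rewrite (_ : (fun w => _) = fun w => \sum_l (t *m K) 0 l * g l w); first exact: gN.
apply/funext => w; rewrite /dotv; under eq_bigr do rewrite mxE mulr_sumr.
rewrite exchange_big /=; apply: eq_bigr => l _; rewrite mxE mulr_suml.
by apply: eq_bigr => k _; rewrite mulrA.
Qed.

Lemma tens_sqrt {R : realType} (m n : nat) (A : 'M[R]_m) (B : 'M[R]_n) :
  posdefmx A -> posdefmx B -> exists K : 'M[R]_(m * n), A *t B = K *m K^T.
Proof.
move=> /posdefmx_sqrt[L ->] /posdefmx_sqrt[M ->]; exists (L *t M).
by rewrite trmx_tens tensmx_mul.
Qed.

Lemma matrix_normal_vec_mx {R : realType} {d : measure_display} {T : measurableType d}
    (P : probability T R) (m n : nat) (V : 'M[R]_(m * n)) (G : T -> 'rV[R]_(m * n)) :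
  random_mx G ->
  (forall t, has_normal_law P (fun w => dotv t (G w)) ((t *m V *m t^T) 0 0)) ->
  matrix_normal P (fun w => vec_mx (G w) : 'M[R]_(m, n)) 0 V.
Proof.
move=> mG hG; split=> [i j|c B mB].
  rewrite (_ : (fun w => _) = fun w => G w 0 i); first exact: mG.
  by apply/funext => w; rewrite /vec vec_mxK mxE ord1.
have [_ hB] := hG c^T; have := hB B mB; rewrite trmxK.
have -> : (c^T *m vec (0 : 'M[R]_(m, n))) 0 0 = 0.
  by rewrite /vec linear0 trmx0 mulmx0 mxE.
have dotE w : (c^T *m vec (vec_mx (G w) : 'M[R]_(m, n))) 0 0 = dotv c^T (G w).
  by rewrite /vec vec_mxK [LHS]mxE; apply: eq_bigr => j _; rewrite [(G w)^T _ _]mxE.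
by move=> <-; congr (P _); apply/seteqP; split=> w /=; rewrite dotE.
Qed.

(** * Convergence in distribution of the estimator *)

Lemma random_observation_error {R : realType} {d : measure_display} {T : measurableType d}
    (p n : nat) (erow : nat -> T -> 'rV[R]_p) :
  (forall a, random_mx (erow a)) -> random_mx (fun w => rowsmx (fun a => erow a w) n).
Proof.
move=> me a j; rewrite (_ : (fun w => _) = fun w => erow a w 0 j); first exact: me.
by apply/funext => w; rewrite mxE.
Qed.

Lemma random_mxvec {R : realType} {d : measure_display} {T : measurableType d}
    (m n : nat) (A : T -> 'M[R]_(m, n)) : random_mx A -> random_mx (fun w => mxvec (A w)).
Proof.
move=> mA u j; case/mxvec_indexP: j => a b; rewrite ord1.
by rewrite (_ : (fun w => _) = fun w => A w a b)//; apply/funext => w; rewrite mxvecE.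
Qed.

Lemma random_Theta_hat {R : realType} {d : measure_display} {T : measurableType d}
    (k p n : nat) (m q : 'I_k -> nat) (X : forall l, 'M[R]_(n, m l)) (Z : forall l, 'M[R]_(p, q l))
    (i : 'I_k) (Y : T -> 'M[R]_(n, p)) :
  random_mx Y -> random_mx (fun w => Theta_hat X Z i (Y w)).
Proof.
move=> mY; have cst := @random_mx_cst R d T.
have mS : random_mx (fun w => invmx (Sigma_hat X (Y w))).
  apply: random_invmx; apply: random_mxM => //; apply: random_mxM => //.
  exact: random_trmx.
apply: random_mxM => //; apply: random_mxM => //; apply: random_mxM.
  by apply: random_mxM => //; exact: cst.
rewrite /Hmx; apply: random_mxM => //; apply: random_mxM; first exact: random_mxM.
by apply: random_invmx; apply: random_mxM => //; exact: random_mxM.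
Qed.

Lemma Lfun2_moments {R : realType} {d : measure_display} {T : measurableType d}
    (P : probability T R) (f g : {RV P >-> R}) (s : R) :
  (f : T -> R) \in Lfun P 2%:E -> (g : T -> R) \in Lfun P 2%:E ->
  ('E_P[f] = 0)%E -> ('E_P[g] = 0)%E -> covariance P f g = s%:E ->
  [/\ integr P f, Ex P f = 0, integr P (fun w => f w * g w) &
      Ex P (fun w => f w * g w) = s].
Proof.
move=> f2 g2 f0 g0 cfg.
have L1 h : h \in Lfun P 2%:E -> h \in Lfun P 1.
  by apply: Lfun_subset12; exact: fin_num_measure.
have fg1 := Lfun2_mul_Lfun1 f2 g2.
have i1 : integr P f by apply/Lfun1_integrable; exact: L1.
have i2 : integr P (fun w => f w * g w) by apply/Lfun1_integrable.
have e1 := expectation_Ex i1; have e2 := expectation_Ex i2.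
split=> //.
  by apply: EFin_inj; rewrite -e1.
apply: EFin_inj; rewrite -e2 -cfg (covarianceE (L1 _ f2) (L1 _ g2) fg1).
by rewrite f0 mul0e sube0.
Qed.

Theorem theorem4p3 (R : realType)
  (d : measure_display) (Omega : measurableType d) (P : probability Omega R)
  (k p : nat) (m q : 'I_k -> nat)
  (* x l a is the a-th row of the design matrices X_l *)
  (x : forall l : 'I_k, nat -> 'rV[R]_(m l))
  (Z : forall l : 'I_k, 'M[R]_(p, q l))
  (Theta : forall l : 'I_k, 'M[R]_(m l, q l))
  (* e a j is the j-th entry of the a-th row of the error matrices *)
  (e : nat -> 'I_p -> {RV P >-> R})
  (Sigma : 'M[R]_p)
  (Rlim : forall l : 'I_k, 'M[R]_(m l))
  (* the sample sizes are n >= n0 *)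
  (n0 : nat)
  (X := fun (n : nat) (l : 'I_k) => rowsmx (x l) n)
  (erow := fun (a : nat) (w : Omega) => \row_j e a j w)
  (E := fun (n : nat) (w : Omega) => rowsmx (fun a => erow a w) n)
  (Y := fun (n : nat) (w : Omega) => observation (X n) Z Theta (E n w))
  (hX : forall n l, (n0 <= n)%N -> (m l < n)%N /\ \rank (X n l) = m l)
  (hZ : forall l, (q l < p)%N /\ \rank (Z l) = q l)
  (hE_cont : forall n, (n0 <= n)%N -> continuous_type P (E n))
  (hE_indep : independent_rows P erow)
  (hE_ident : identically_distributed_rows P erow)
  (hE_L2 : forall a j, (e a j : Omega -> R) \in Lfun P 2%:E)
  (hE_mean : forall a j, ('E_P[e a j] = 0)%E)
  (hE_cov : forall a j l, covariance P (e a j) (e a l) = (Sigma j l)%:E)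
  (hSigma : posdefmx Sigma)
  (hrank : forall n l, (n0 <= n)%N -> (\rank (X n l) + p <= n)%N)
  (horth : forall n l l', (n0 <= n)%N -> l != l' -> (X n l)^T *m X n l' = 0)
  (hSigma_hat : forall n, (n0 <= n)%N ->
    {ae P, forall w, posdefmx (Sigma_hat (X n) (Y n w))})
  (hlim : forall l, posdefmx (Rlim l) /\
    n%:R^-1 *: ((X n l)^T *m X n l) @[n --> \oo] --> Rlim l)
  (i : 'I_k) :
  exists (d' : measure_display) (Omega' : measurableType d')
    (P' : probability Omega' R) (T : Omega' -> 'M[R]_(m i, q i)),
    matrix_normal P' T 0
      (invmx (Rlim i) *t invmx ((Z i)^T *m invmx Sigma *m Z i)) /\
    cvg_in_distribution P P'
      (fun n w =>
         Num.sqrt n%:R *: (Theta_hat (X n) Z i (Y n w) - Theta i)) T.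
Proof.
have mom a j l := Lfun2_moments (hE_L2 a j) (hE_L2 a l) (hE_mean a j) (hE_mean a l) (hE_cov a j l).
have erE a j w : erow a w 0 j = e a j w by rewrite mxE.
have er1 a j : (fun w => erow a w 0 j) = e a j by apply/funext => w; exact: erE.
have er2 a j l : (fun w => erow a w 0 j * erow a w 0 l) = fun w => e a j w * e a l w.
  by apply/funext => w; rewrite !erE.
have merow a : random_mx (erow a).
  by move=> u j; rewrite ord1 er1.
have i1 a j : integr P (fun w => erow a w 0 j) by rewrite er1; have [] := mom a j j.
have i2 a j l : integr P (fun w => erow a w 0 j * erow a w 0 l).
  by rewrite er2; have [] := mom a j l.
have m1 a j : Ex P (fun w => erow a w 0 j) = 0 by rewrite er1; have [] := mom a j j.
have m2 a j l : Ex P (fun w => erow a w 0 j * erow a w 0 l) = Sigma j l.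
  by rewrite er2; have [] := mom a j l.
have rX n l : (n0 <= n)%N -> \rank (X n l) = m l by move=> n0n; have [] := hX n l n0n.
have rZ l : \rank (Z l) = q l by have [] := hZ l.
have pR l : posdefmx (Rlim l) by have [] := hlim l.
have cR l : mx_cvg \oo (fun n => n%:R^-1 *: ((X n l)^T *m X n l)) (Rlim l).
  by apply: cvg_entries; have [] := hlim l.
pose T_ n w := Num.sqrt n%:R *: (Theta_hat (X n) Z i (Y n w) - Theta i).
have mT n : random_mx (T_ n).
  apply: random_mxZ; apply: random_mxD; last exact: random_mx_cst.
  apply: random_Theta_hat; apply: random_mxD; first exact: random_mx_cst.
  exact: random_observation_error.
have pV := posdefmx_congr (rZ i) (posdefmx_inv hSigma).
set V := _ *t _.
have [K VK] := tens_sqrt (posdefmx_inv (pR i)) (posdefmx_inv pV).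
have [d1 [T1 [Q [G [mG normG]]]]] := gaussian_vector K.
rewrite -VK -/V in normG.
exists d1, T1, Q, (fun w => vec_mx (G w)); split; first exact: matrix_normal_vec_mx.
have V0 (t : 'rV[R]_(m i * q i)) : 0 <= (t *m V *m t^T) 0 0.
  rewrite /V VK mulmxA -[_ *m K^T *m _]mulmxA -trmx_mul mxE; apply: sumr_ge0 => l _.
  by rewrite [_^T _ _]mxE -expr2 sqr_ge0.
have mvT n := random_mxvec (mT n).
have lin := estimator_linearization Theta merow hE_indep hE_ident i1 i2 m1 m2 rX rZ hSigma horth pR cR (i := i).
have bnd := estimator_bounded Theta merow hE_indep hE_ident i1 i2 m1 m2 rX rZ hSigma horth pR cR (i := i).
have clt t := linearization_clt merow hE_indep hE_ident i1 i2 m1 m2 rZ hSigma pR cR (i := i) t.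
(* The limiting law is first identified for the linearization, and then carried
   over to the estimation error by [slutsky_char]. *)
pose L n w := invmx (Rlim i) *m ((Num.sqrt n%:R)^-1 *: ((X n i)^T *m E n w)) *m gls (Z i) Sigma.
have mL n : random_mx (L n).
  apply: random_mxM; last exact: random_mx_cst.
  apply: random_mxM; first exact: random_mx_cst.
  apply: random_mxZ; apply: random_mxM; first exact: random_mx_cst.
  exact: random_observation_error.
have mvL n := random_mxvec (mL n).
have close t : to0_in_prob P (fun n w => dotv t (mxvec (T_ n w)) - dotv t (mxvec (L n w))).
  rewrite (_ : (fun n w => _) = fun n w => \sum_j t 0 j * mxvec (T_ n w - L n w) 0 j); last first.
    apply/funext => n; apply/funext => w; rewrite -sumrB; apply: eq_bigr => j _.
    by rewrite -mulrBr linearB [in RHS]mxE [in RHS]mxE.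
  apply: to0_in_prob_sum => j; apply: to0_in_probMr.
    by apply: (bounded_in_prob_cvg P (c := fun=> t 0 j) (l := t 0 j)); exact: cvg_cst.
  case/mxvec_indexP: j => a b; rewrite (_ : (fun n w => _) = fun n w => (T_ n w - L n w) a b).
    exact: lin.
  by apply/funext => n; apply/funext => w; rewrite mxvecE.
have mdT t n := measurable_dotv t (mvT n).
have mdL t n := measurable_dotv t (mvL n).
have charG t := has_normal_law_char (V0 t) (normG t).
have cc t : Ex P (fun w => cos (dotv t (mxvec (T_ n w)))) @[n --> \oo] -->
    Ex Q (fun w => cos (dotv t (G w))).
  rewrite (charG t).1.
  exact: (slutsky_char (@continuous_cos R) (@cos_max R) (@cos_lipschitz R) (mdL t) (mdT t) (close t) (clt t).1).
have cs t : Ex P (fun w => sin (dotv t (mxvec (T_ n w)))) @[n --> \oo] -->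
    Ex Q (fun w => sin (dotv t (G w))).
  rewrite (charG t).2.
  exact: (slutsky_char (@continuous_sin R) (@sin_max R) (@sin_lipschitz R) (mdL t) (mdT t) (close t) (clt t).2).
have tight j : bounded_in_prob P (fun n w => mxvec (T_ n w) 0 j).
  case/mxvec_indexP: j => a b; rewrite (_ : (fun n w => _) = fun n w => T_ n w a b).
    exact: bnd.
  by apply/funext => n; apply/funext => w; rewrite mxvecE.
have mvG : random_mx (fun w => vec_mx (G w) : 'M[R]_(m i, q i)).
  by move=> a b; rewrite (_ : (fun w => _) = fun w => G w 0 (mxvec_index a b))//;
    apply/funext => w; rewrite mxE.
split=> [||f cf [C fC]]; [exact: mT|exact: mvG|].
have cfv : continuous (fun v : 'rV[R]_(m i * q i) => f (vec_mx v)).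
  by move=> v; apply: continuous_comp; [exact: continuous_vec_mx|exact: cf].
have ET n : ('E_P[fun w => f (T_ n w)] = (Ex P (fun w => f (vec_mx (mxvec (T_ n w)))))%:E)%E.
  rewrite (_ : (fun w => f (vec_mx _)) = fun w => f (T_ n w)).
    apply: expectation_Ex.
    exact: integr_bounded (measurable_continuous_comp (mT n) cf) (fun w => fC _).
  by apply/funext => w; rewrite mxvecK.
have EG : ('E_Q[fun w => f (vec_mx (G w))] = (Ex Q (fun w => f (vec_mx (G w))))%:E)%E.
  apply: expectation_Ex.
  exact: integr_bounded (measurable_continuous_comp mvG cf) (fun w => fC _).
have lim := weak_cvg_of_char mvT mG tight cc cs cfv (fun v => fC _).
rewrite EG; have -> : (fun n => 'E_P[fun w => f (T_ n w)])%E =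
    fun n => (Ex P (fun w => f (vec_mx (mxvec (T_ n w)))))%:E by exact/funext.
by apply: cvg_EFin; [near=> n|exact: lim].
Unshelve. all: by end_near. Qed.
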